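(* Let $(K,v)$ be a tame field and $(K(x)|K,v)$ an extension of valued fields with $x$ transcendental over $K$. Then $\mathrm{IC}(K(x)|K,v)$ is a countably generated separable-algebraic extension of $K$.
   Context: Valuations are Krull valuations; $vL$ and $Lv$ denote value group and residue field of $(L,v)$; $\widetilde K$ is the algebraic closure of $K$. An algebraic extension $(L|K,v)$ is unibranched if the extension of $v$ from $K$ to $L$ is unique; it is tame if it is unibranched and every finite subextension $E|K$ satisfies: $(vE:vK)$ is not divisible by $\mathrm{char}\,Kv$; $Ev|Kv$ is separable; and $[E:K]=(vE:vK)[Ev:Kv]$. A tame field is a henselian field $(K,v)$ such that $(\widetilde K|K,v)$ is a tame extension. For an extension $(F|K,v)$, the implicit constant field $\mathrm{IC}(F|K,v)$ is the relative algebraic closure of $K$ in a fixed henselization of $(F,v)$. *)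

(* Defs.v *)
From HB Require Import structures.
From mathcomp Require Import all_boot all_order all_algebra all_field.
From mathcomp Require Import generic_quotient ring_quotient.

Set Implicit Arguments.
Unset Strict Implicit.
Unset Printing Implicit Defensive.

Import Order.TTheory GRing.Theory.
Local Open Scope ring_scope.
Local Open Scope quotient_scope.

Definition ordered_abelian_group (G : porderZmodType) : Prop :=
  total (<=%R : rel G) /\ forall g x y : G, x <= y -> g + x <= g + y.

(* [option G] is [G] with a largest element [None] adjoined, the value        *)
(* "infinity" of 0.                                                           *)
Section ExtendedValues.
Variable G : porderZmodType.
Implicit Types a b : option G.

Definition vle a b : bool :=
  match a, b with
  | _, None => true
  | None, Some _ => false
  | Some g, Some h => g <= h
  end.

Definition vmin a b : option G := if vle a b then a else b.

Definition vadd a b : option G :=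
  match a, b with
  | Some g, Some h => Some (g + h)
  | _, _ => None
  end.

Lemma vle_refl a : vle a a.
Proof. by case: a => /=. Qed.

Lemma vle_trans b a c : vle a b -> vle b c -> vle a c.
Proof. by case: a b c => [a|] [b|] [c|] //=; apply: le_trans. Qed.

Lemma vle_min c a b : vle c a -> vle c b -> vle c (vmin a b).
Proof. by rewrite /vmin; case: ifP. Qed.

Lemma vmin_Nle c a b : ~~ vle a c -> ~~ vle b c -> ~~ vle (vmin a b) c.
Proof. by rewrite /vmin; case: ifP. Qed.

End ExtendedValues.

(* Krull valuations, written additively.  [vmap] need not be onto: the value  *)
(* group is the subgroup [value_group] of [vgroup] defined below.             *)
Record valuation (K : fieldType) := Valuation {
  vgroup : porderZmodType;
  vgroupP : ordered_abelian_group vgroup;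
  vmap :> K -> option vgroup;
  vmap_eq0 : forall x, (vmap x == None) = (x == 0);
  vmapM : forall x y, vmap (x * y) = vadd (vmap x) (vmap y);
  vmapD : forall x y, vle (vmin (vmap x) (vmap y)) (vmap (x + y))
}.

Definition value_group (K : fieldType) (v : valuation K) (g : vgroup v) : Prop :=
  exists2 x : K, x != 0 & v x = Some g.
Arguments value_group {K} v g.

Section ResidueField.
Variables (K : fieldType) (v : valuation K).

Lemma vmap0 : v 0 = None.
Proof. by apply/eqP; rewrite vmap_eq0. Qed.

Lemma vmap1 : v 1 = Some 0.
Proof.
have := vmapM v 1 1; rewrite mulr1.
case E: (v 1) => [g|] /=; last first.
  by move/eqP: E; rewrite vmap_eq0 oner_eq0.
by case=> /eqP; rewrite -{1}(addr0 g) (inj_eq (addrI g)) => /eqP <-.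
Qed.

Lemma vmapN x : v (- x) = v x.
Proof.
have [tot tr] := vgroupP v.
have vN1 : v (-1) = Some 0.
  have := vmapM v (-1) (-1); rewrite mulrNN mulr1 vmap1.
  case: (v (-1)) => [g|] //= [] gg; congr Some; apply: le_anti.
  have /orP[h|h] := tot g 0.
    by rewrite h /=; have := tr g _ _ h; rewrite -gg addr0.
  by rewrite h andbT; have := tr g _ _ h; rewrite -gg addr0.
rewrite -mulN1r vmapM vN1.
by case: (v x) => [g|] //=; rewrite add0r.
Qed.

Lemma vaddNle a b :
  vle (Some 0) a -> ~~ vle b (Some (0 : vgroup v)) ->
  ~~ vle (vadd a b) (Some 0).
Proof.
have [tot tr] := vgroupP v.
case: a b => [a|] [b|] //= a0; apply: contra; apply: le_trans.
by rewrite -{1}(add0r b) addrC [a + b]addrC; apply: tr.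
Qed.

Definition in_vring : {pred K} := fun x => vle (Some 0) (v x).

Fact in_vring_subring_closed : subring_closed in_vring.
Proof.
have [tot tr] := vgroupP v.
split; rewrite ?unfold_in.
- by rewrite /in_vring vmap1 vle_refl.
- move=> x y vx vy; rewrite unfold_in; apply: vle_trans (vmapD v _ _).
  by apply: vle_min; rewrite ?vmapN.
- move=> x y; rewrite !unfold_in /in_vring vmapM.
  case: (v x) (v y) => [a|] [b|] //= a0 b0; apply: le_trans a0 _.
  by rewrite -{1}(addr0 a); apply: tr.
Qed.

HB.instance Definition _ :=
  GRing.isSubringClosed.Build K in_vring in_vring_subring_closed.

Record vring := VRing { vring_val : K; _ : vring_val \in in_vring }.

HB.instance Definition _ := [isSub for vring_val].
HB.instance Definition _ := [Choice of vring by <:].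
HB.instance Definition _ := [SubChoice_isSubComNzRing of vring by <:].

Definition vmaximal : {pred vring} := fun a => ~~ vle (v (val a)) (Some 0).

Fact vmaximal_idealr_closed : idealr_closed vmaximal.
Proof.
split; rewrite ?unfold_in /vmaximal /= ?vmap0 ?vmap1 ?vle_refl //.
move=> a x y vx vy; rewrite unfold_in.
apply: contra (vmin_Nle (vaddNle (valP a) vx) vy).
by rewrite -vmapM; apply: vle_trans (vmapD v _ _).
Qed.

HB.instance Definition _ :=
  isIdealr.Build vring vmaximal vmaximal_idealr_closed.

Definition residue := {ideal_quot vmaximal}.
HB.instance Definition _ := GRing.ComNzRing.on residue.

Definition residue_pi (a : vring) : residue := \pi_({ideal_quot vmaximal}) a.

Fact residue_pi_zmod_morphism : zmod_morphism residue_pi.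
Proof. exact: (rmorphB (\pi_({ideal_quot vmaximal}))). Qed.
Fact residue_pi_monoid_morphism : monoid_morphism residue_pi.
Proof. by split; [exact: rmorph1 | exact: rmorphM]. Qed.
HB.instance Definition _ :=
  GRing.isZmodMorphism.Build vring residue residue_pi residue_pi_zmod_morphism.
HB.instance Definition _ :=
  GRing.isMonoidMorphism.Build vring residue residue_pi
    residue_pi_monoid_morphism.

Lemma residue_pi_eq a b :
  (residue_pi a == residue_pi b) = (a - b \in vmaximal).
Proof. by rewrite Quotient.idealrBE. Qed.

Lemma residue_pi_eq0 a : (residue_pi a == 0) = (a \in vmaximal).
Proof. by rewrite -(rmorph0 residue_pi) residue_pi_eq subr0. Qed.

Lemma residue_piK (q : residue) : residue_pi (repr q) = q.
Proof. exact: reprK. Qed.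

Definition residue_inv (q : residue) : residue :=
  if q == 0 then 0 else residue_pi (insubd 0 (val (repr q))^-1).

Fact residue_mulVf (q : residue) : q != 0 -> residue_inv q * q = 1.
Proof.
move=> q0; rewrite /residue_inv (negPf q0) -[q in _ * q]residue_piK.
have := q0; rewrite -[q in q != 0]residue_piK residue_pi_eq0 unfold_in negbK.
move: (repr q) => a va; rewrite -rmorphM -[RHS](rmorph1 residue_pi).
have v0a : vle (Some 0) (v (val a)) := valP a.
have a0 : val a != 0 by apply: contraTneq va => ->; rewrite vmap0.
have va0 : v (val a) = Some 0.
  case: (v (val a)) va v0a => [g|] //= h1 h2.
  by congr Some; apply: le_anti; rewrite h1.
have vai : (val a)^-1 \in in_vring.
  have := vmapM v (val a)^-1 (val a); rewrite mulVf // vmap1 va0 unfold_in.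
  by rewrite /in_vring; case: (v _^-1) => [g|] //= [->]; rewrite addr0.
have -> : insubd 0 (val a)^-1 = VRing vai by apply: val_inj; rewrite insubdK.
by congr residue_pi; apply: val_inj; exact: mulVf.
Qed.

Fact residue_inv0 : residue_inv 0 = 0.
Proof. by rewrite /residue_inv eqxx. Qed.

HB.instance Definition _ :=
  GRing.ComNzRing_isField.Build residue residue_mulVf residue_inv0.

End ResidueField.

Section Restriction.
Variables (K L : fieldType) (i : {rmorphism K -> L}) (w : valuation L).

Fact restrict_eq0 x : (w (i x) == None) = (x == 0).
Proof. by rewrite vmap_eq0 fmorph_eq0. Qed.
Fact restrictM x y : w (i (x * y)) = vadd (w (i x)) (w (i y)).
Proof. by rewrite rmorphM vmapM. Qed.
Fact restrictD x y : vle (vmin (w (i x)) (w (i y))) (w (i (x + y))).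
Proof. by rewrite rmorphD vmapD. Qed.

Definition restrict : valuation K :=
  Valuation (vgroupP w) restrict_eq0 restrictM restrictD.

Definition vring_map (a : vring restrict) : vring w :=
  VRing (valP a : i (val a) \in in_vring w).

Fact vring_map_zmod_morphism : zmod_morphism vring_map.
Proof. by move=> a b; apply: val_inj; rewrite /= !rmorphB. Qed.
Fact vring_map_monoid_morphism : monoid_morphism vring_map.
Proof.
by split=> [|a b]; apply: val_inj; rewrite /= ?rmorph1 // !rmorphM.
Qed.
HB.instance Definition _ :=
  GRing.isZmodMorphism.Build _ _ vring_map vring_map_zmod_morphism.
HB.instance Definition _ :=
  GRing.isMonoidMorphism.Build _ _ vring_map vring_map_monoid_morphism.

Definition residue_map (q : residue restrict) : residue w :=
  residue_pi (vring_map (repr q)).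

Lemma residue_map_pi a : residue_map (residue_pi a) = residue_pi (vring_map a).
Proof.
apply/eqP; rewrite /residue_map residue_pi_eq -rmorphB.
have : repr (residue_pi a) - a \in @vmaximal K restrict.
  by rewrite -residue_pi_eq residue_piK.
by rewrite !unfold_in.
Qed.

Fact residue_map_zmod_morphism : zmod_morphism residue_map.
Proof.
move=> p q; rewrite -[p]residue_piK -[q]residue_piK -rmorphB !residue_map_pi.
by rewrite !rmorphB.
Qed.
Fact residue_map_monoid_morphism : monoid_morphism residue_map.
Proof.
split=> [|p q]; first by rewrite -(rmorph1 (@residue_pi _ _)) residue_map_pi !rmorph1.
rewrite -[p]residue_piK -[q]residue_piK -rmorphM !residue_map_pi.
by rewrite !rmorphM.
Qed.
HB.instance Definition _ :=
  GRing.isZmodMorphism.Build _ _ residue_map residue_map_zmod_morphism.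
HB.instance Definition _ :=
  GRing.isMonoidMorphism.Build _ _ residue_map residue_map_monoid_morphism.

End Restriction.

Section FieldExtensions.
Variables (K L : fieldType) (i : {rmorphism K -> L}).

Definition algebraic_extension : Prop := forall y : L, algebraicOver i y.

Definition degree (n : nat) : Prop :=
  exists b : 'I_n -> L, forall y : L,
    exists! c : {ffun 'I_n -> K}, y = \sum_k i (c k) * b k.

(* An irreducible polynomial over [K] with root [y] is, up to a constant, the *)
(* minimal polynomial of [y].                                                 *)
Definition separable_over (y : L) : Prop :=
  exists p : {poly K},
    [/\ irreducible_poly p, separable_poly p & root (map_poly i p) y].

(* The subfield generated over [K] by the elements of [S].                    *)
Definition generated (S : L -> Prop) (y : L) : Prop :=
  forall P : {pred L}, GRing.divring_closed P ->
    (forall a, i a \in P) -> (forall s, S s -> s \in P) -> y \in P.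

Definition separable_algebraic (A : L -> Prop) : Prop :=
  forall y, A y -> separable_over y.

(* Finitely generated extensions are included: [s] may have repetitions.      *)
Definition countably_generated (A : L -> Prop) : Prop :=
  exists s : nat -> L, forall y, A y <-> generated (fun z => exists n, z = s n) y.

End FieldExtensions.

(* Two valuations are equivalent if they have the same valuation ring.        *)
Definition equivalent (K : fieldType) (v w : valuation K) : Prop :=
  in_vring v =1 in_vring w.

(* [(L|K, v)] is an extension of valued fields, up to equivalence.            *)
Definition extends (K L : fieldType) (i : {rmorphism K -> L})
    (v : valuation K) (w : valuation L) : Prop :=
  equivalent v (restrict i w).

Section ValuedExtensions.
Variables (K L : fieldType) (i : {rmorphism K -> L}) (w : valuation L).

Definition ramification_index (e : nat) : Prop :=
  exists r : 'I_e -> vgroup w, (forall k, value_group w (r k)) /\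
    forall g, value_group w g ->
      exists! k, exists2 h, value_group (restrict i w) h & g = r k + h.

Definition inertia_degree (f : nat) : Prop := degree (@residue_map K L i w) f.

Definition residually_separable : Prop :=
  forall y : residue w, separable_over (@residue_map K L i w) y.

Definition unibranched : Prop :=
  forall w' : valuation L, extends i (restrict i w) w' -> equivalent w w'.

End ValuedExtensions.

(* A finite subextension of [L|K] is given as a finite extension [j : K -> E] *)
(* with a [K]-embedding [k] of [E] in [L].                                    *)
Definition tame_extension (K L : fieldType) (i : {rmorphism K -> L})
    (w : valuation L) : Prop :=
  [/\ algebraic_extension i, unibranched i w &
      forall (E : fieldType) (j : {rmorphism K -> E}) (k : {rmorphism E -> L})
        (n : nat), k \o j =1 i -> degree j n ->
        let u := restrict k w in
        exists e f : nat,
          [/\ ramification_index j u e, inertia_degree j u f,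
              forall p, p \in [pchar (residue (restrict j u))] -> ~~ (p %| e)%N,
              residually_separable j u & n = (e * f)%N]].

Definition henselian (K : fieldType) (v : valuation K) : Prop :=
  forall (L : fieldType) (i : {rmorphism K -> L}) (w : valuation L),
    algebraic_extension i -> extends i v w -> unibranched i w.

(* [C] is the algebraic closure of [K], unique up to isomorphism over [K]; by *)
(* henselianity the valuation [w] extending [v] is unique up to equivalence.  *)
Definition tame_field (K : fieldType) (v : valuation K) : Prop :=
  henselian v /\
  exists (C : closedFieldType) (i : {rmorphism K -> C}) (w : valuation C),
    [/\ algebraic_extension i, extends i v w & tame_extension i w].

(* [(H, u)], with [h : F -> H], is a henselization of [(F, w)]: a henselian   *)
(* extension embedding uniquely in every other one.                           *)
Definition henselization (F H : fieldType) (h : {rmorphism F -> H})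
    (w : valuation F) (u : valuation H) : Prop :=
  [/\ extends h w u, henselian u &
      forall (L : fieldType) (l : {rmorphism F -> L}) (w' : valuation L),
        extends l w w' -> henselian w' ->
        let embedding (g : {rmorphism H -> L}) :=
          g \o h =1 l /\ extends g u w' in
        exists2 g : {rmorphism H -> L}, embedding g &
          forall g' : {rmorphism H -> L}, embedding g' -> g' =1 g].

(* For [i : K -> F] and a henselization [h : F -> H] of [F].                  *)
Definition implicit_constant_field (K F H : fieldType) (i : {rmorphism K -> F})
    (h : {rmorphism F -> H}) : H -> Prop :=
  fun z => algebraicOver (h \o i) z.

(* Main.v *)
From HB Require Import structures.
From mathcomp Require Import all_boot all_order all_algebra all_field.
From mathcomp Require Import fingroup perm generic_quotient ring_quotient ring.
From mathcomp Require Import boolp classical_sets functions filter.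
Require Import Defs.

(** Let C be the algebraic closure of K, with its valuation, and let Om be an
    algebraically closed field, algebraic over F = K(x), with a valuation that
    extends that of F; write X for the image of x. As the valuation of K has only
    one extension to C, any embedding of C in Om over K respects valuations, and
    as algebraically closed valued fields are henselian, the henselization H of F
    embeds in Om. The elements of H that are algebraic over K thereby become
    elements of C. They are separable over K because tame fields are perfect: a
    p-th root outside K, for p the characteristic, would generate an extension of
    degree divisible by p whose residue field extension is purely inseparable,
    hence trivial by tameness, so that p would divide the ramification index.

    Countable generation depends on the values of X - y for y in C, the closeness
    of y to X. Suppose that an automorphism s of C over K preserves closeness.
    Polynomials over C are products of linear factors, so s preserves the values
    of all polynomials at X, and it extends to an embedding t of Om over F that
    preserves values (extend_embedding). Composed with t, the embedding of H in
    Om remains an embedding of valued fields over F. A henselization has only one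
    of these, hence t is the identity on H and s on its constants
    (constant_fixed).

    It remains to find a countably generated extension K0 of K in C such that
    every s over K0 preserves closeness. If some b in C is closest to X, then
    K0 = K(b) will do, since the closeness of y is then the smaller one of the
    closeness of b and the value of y - b. Otherwise choose successively elements
    a_n of C that are closer to X than everything in K(a_0, ..., a_(n-1)); if
    finitely many elements generate a field that comes arbitrarily close to X,
    take these instead. The a_n generate K0. If K0 contains an element b closer to
    X than a given y, then the closeness of y is the value of y - b, and s
    preserves it. And there is always such a b, by tameness: some b in K0 is at
    least as close to y as some conjugate s y over K0 is (tame_approximation),
    whereas, if y were closer to X than all elements of K0, then a_n closer to X
    than b would bound the value of y - s y = (y - a_n) - s (y - a_n) from below
    by that of X - a_n, which exceeds that of X - b = (X - y) + (y - b)
    (no_limit).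

    The approximation b is Tr(t y) / Tr(t) for an integral t whose trace is a
    unit. In a finite Galois extension N of K such t exists for the trace of
    every subgroup of the Galois group (tame_trace): on residues, the trace is a
    sum of distinct automorphisms times the order of a subgroup of the inertia
    group. That order divides the ramification index, so it is not divisible by
    the residue characteristic, and distinct automorphisms are linearly
    independent.

    Finally, the constants, being separable and fixed by all s over K0, lie in
    K0. As a vector space over K this has countable dimension, and so has the
    subspace of the constants (countable_subspace); a basis generates it as a
    field. *)

Set Implicit Arguments.
Unset Strict Implicit.
Unset Printing Implicit Defensive.

Import Order.TTheory GRing.Theory.
Local Open Scope ring_scope.

(** * Ordered groups with a point at infinity *)

Section ExtendedValueTheory.
Variable G : porderZmodType.
Hypothesis GP : ordered_abelian_group G.
Implicit Types (a b c : option G) (g h : G).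

Definition vlt a b := ~~ vle b a.

Lemma vle_total a b : vle a b || vle b a.
Proof. by case: a b => [a|] [b|] //=; have [tot _] := GP; apply: tot. Qed.

Lemma vltW a b : vlt a b -> vle a b.
Proof. by rewrite /vlt; have /orP[->//|->] := vle_total a b. Qed.

Lemma vle_anti a b : vle a b -> vle b a -> a = b.
Proof.
by case: a b => [a|] [b|] //= ab ba; congr Some; apply: le_anti; rewrite ab.
Qed.

Lemma vle_lt_trans b a c : vle a b -> vlt b c -> vlt a c.
Proof. by move=> ab; apply: contra => ca; apply: vle_trans ab. Qed.

Lemma vlt_le_trans b a c : vlt a b -> vle b c -> vlt a c.
Proof. by move=> ab bc; apply: contra ab => ca; apply: vle_trans ca. Qed.

Lemma vlt_trans b a c : vlt a b -> vlt b c -> vlt a c.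
Proof. by move=> /vltW; apply: vle_lt_trans. Qed.

Lemma vltxx a : vlt a a = false.
Proof. by rewrite /vlt vle_refl. Qed.

Lemma vlt_neqVgt a b : a <> b -> vlt a b \/ vlt b a.
Proof.
move=> ab; rewrite /vlt; have [ba|] := boolP (vle b a); last by left.
by right; apply/negP => /vle_anti /(_ ba).
Qed.

Lemma vaddC a b : vadd a b = vadd b a.
Proof. by case: a b => [a|] [b|] //=; rewrite addrC. Qed.

Lemma vaddA a b c : vadd a (vadd b c) = vadd (vadd a b) c.
Proof. by case: a b c => [a|] [b|] [c|] //=; rewrite addrA. Qed.

Lemma vadd0 a : vadd (Some 0) a = a.
Proof. by case: a => //= a; rewrite add0r. Qed.

Lemma ler_addl2 g x y : (g + x <= g + y :> G) = (x <= y).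
Proof.
have [_ tr] := GP; apply/idP/idP => [/(tr (- g))|/tr//].
by rewrite !addKr.
Qed.

Lemma vle_add2l g a b : vle (vadd (Some g) a) (vadd (Some g) b) = vle a b.
Proof. by case: a b => [a|] [b|] //=; apply: ler_addl2. Qed.

Lemma vle_add a b c d : vle a b -> vle c d -> vle (vadd a c) (vadd b d).
Proof.
case: a b c d => [a|] [b|] [c|] [d|] //= ab cd.
apply: (@le_trans _ _ (a + d)); first by rewrite ler_addl2.
by rewrite addrC (addrC b) ler_addl2.
Qed.

Lemma vlt_add_le g h a d :
  vlt (Some g) a -> vle (Some h) d -> vlt (vadd (Some g) (Some h)) (vadd a d).
Proof.
move=> ga hd; apply: (@vlt_le_trans (vadd a (Some h))); last first.
  by apply: vle_add; rewrite ?vle_refl.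
by rewrite /vlt vaddC (vaddC _ (Some h)) vle_add2l.
Qed.

Lemma vlt_shift a b h : vlt a (vadd b (Some h)) = vlt (vadd a (Some (- h))) b.
Proof.
rewrite /vlt; congr (~~ _); rewrite -(vle_add2l h b).
rewrite [vadd a _]vaddC vaddA -[vadd (Some h) (Some (- h))]/(Some (h - h)).
by rewrite subrr vadd0 [vadd b _]vaddC.
Qed.

Lemma pmulrn_gt0 g n : 0 < g -> 0 < g *+ n.+1.
Proof.
move=> g0; elim: n => // n IH; rewrite mulrS; apply: lt_le_trans g0 _.
by rewrite -{1}(addr0 g) ler_addl2 ltW.
Qed.

Lemma ordered_torsion_free g n : g *+ n.+1 = 0 -> g = 0.
Proof.
have [tot tr] := GP => gn; apply/eqP; apply: contraT => g0.
have /orP[gle|gge] := tot g 0.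
  have : 0 < - g.
    rewrite lt_neqAle eq_sym oppr_eq0 g0 /=; have := tr (- g) _ _ gle.
    by rewrite addNr addr0.
  by move/(pmulrn_gt0 n); rewrite mulNrn gn oppr0 ltxx.
have : 0 < g by rewrite lt_neqAle eq_sym g0.
by move/(pmulrn_gt0 n); rewrite gn ltxx.
Qed.

End ExtendedValueTheory.

Section ValuationTheory.
Variables (K : fieldType) (v : valuation K).
Implicit Types x y z : K.
Let GP := vgroupP v.

Lemma vmap_neq0 x : x != 0 -> exists g, v x = Some g.
Proof. by rewrite -(vmap_eq0 v); case: (v x) => // g _; exists g. Qed.

Lemma vmapB x y : vle (vmin (v x) (v y)) (v (x - y)).
Proof. by rewrite -(vmapN v y); apply: vmapD. Qed.

Lemma vle_vmapD c x y : vle c (v x) -> vle c (v y) -> vle c (v (x + y)).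
Proof. by move=> cx cy; apply: vle_trans (vmapD v x y); apply: vle_min. Qed.

Lemma vle_vmapB c x y : vle c (v x) -> vle c (v y) -> vle c (v (x - y)).
Proof. by move=> cx cy; apply: vle_vmapD; rewrite ?vmapN. Qed.

Lemma vmapD_lt x y : vlt (v x) (v y) -> v (x + y) = v x.
Proof.
move=> xy; apply: vle_anti; last first.
  by apply: vle_vmapD; [apply: vle_refl | apply: vltW].
apply: contraT => xxy; have: vle (v (x + y)) (v (x + y)) by apply: vle_refl.
have : vlt (v x) (v (x + y - y)).
  apply: vlt_le_trans (vmapB _ _); rewrite /vlt; exact: vmin_Nle.
by rewrite addrK vltxx.
Qed.

Lemma vlt_vmap_sum (I : Type) (r : seq I) (P : pred I) (F : I -> K) c :
  c != None -> (forall i, P i -> vlt c (v (F i))) ->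
  vlt c (v (\sum_(i <- r | P i) F i)).
Proof.
move=> c0 cF; apply: (big_ind (fun z => vlt c (v z))) => //.
  by rewrite vmap0; case: c c0 {cF}.
by move=> x y; rewrite /vlt => cx cy; apply: vlt_le_trans (vmapD _ _ _); apply: vmin_Nle.
Qed.

Lemma vmapV x g : v x = Some g -> v x^-1 = Some (- g).
Proof.
move=> vx; have x0 : x != 0 by rewrite -(vmap_eq0 v) vx.
have := vmapM v x x^-1; rewrite mulfV // vmap1 vx.
case: (v x^-1) => [h|] //= [] /esym/eqP; rewrite addrC addr_eq0 => /eqP ->.
by [].
Qed.

Lemma vmapX x g n : v x = Some g -> v (x ^+ n) = Some (g *+ n).
Proof.
by move=> vx; elim: n => [|n IH]; rewrite ?vmap1 // exprS vmapM IH vx mulrS.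
Qed.

Lemma vle_div x y : y != 0 -> vle (v y) (v x) = in_vring v (x / y).
Proof.
move=> y0; have [g vy] := vmap_neq0 y0.
rewrite -{1}(divfK y0 x) vmapM [vadd (v (x / y)) _]vaddC vy.
by rewrite -{1}[g]addr0 -[Some (g + 0)]/(vadd (Some g) (Some 0)) vle_add2l.
Qed.

End ValuationTheory.

Lemma equivalent_vle (K : fieldType) (v w : valuation K) x y :
  equivalent v w -> vle (v x) (v y) = vle (w x) (w y).
Proof.
move=> vw; have [->|x0] := eqVneq x 0.
  by rewrite !vmap0; have := vmap_eq0 v y; have := vmap_eq0 w y;
     case: (v y); case: (w y) => //= a; case: (y == 0).
by rewrite !vle_div //; apply: vw.
Qed.

Lemma equivalent_vlt (K : fieldType) (v w : valuation K) x y :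
  equivalent v w -> vlt (v x) (v y) = vlt (w x) (w y).
Proof. by move=> vw; rewrite /vlt (equivalent_vle _ _ vw). Qed.

(** * Minimal polynomials *)

Section MinimalPolynomial.
Variables (N A : fieldType) (j : {rmorphism N -> A}).

Lemma minimal_polynomial y : algebraicOver j y ->
  exists f : {poly N}, [/\ f \is monic, irreducible_poly f, root (map_poly j f) y &
    forall q, root (map_poly j q) y = (f %| q)].
Proof.
move=> [p0 p0n p0y].
pose P n := `[<exists p : {poly N}, [/\ p != 0, root (map_poly j p) y & size p = n]>].
have exP : exists n, P n by exists (size p0); apply/asboolP; exists p0.
case: (ex_minnP exP) => n /asboolP[p [pn py sp]] minn.
pose f := (lead_coef p)^-1 *: p.
have lp : lead_coef p != 0 by rewrite lead_coef_eq0.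
have fm : f \is monic by rewrite monicE lead_coefZ mulVf.
have fy : root (map_poly j f) y.
  by rewrite /f map_polyZ rootZ // fmorph_eq0 invr_eq0.
have sf : size f = n by rewrite size_scale ?invr_eq0.
have fn : f != 0 by apply: monic_neq0.
have divP q : root (map_poly j q) y = (f %| q).
  apply/idP/idP => [qy|]; last first.
    by move/dvdpP=> [h ->]; rewrite rmorphM rootM fy orbT.
  rewrite /dvdp; apply: contraT => rn.
  have ry : root (map_poly j (q %% f)) y.
    have := qy; rewrite {1}(divp_eq q f) rmorphD rmorphM /= /root hornerD hornerM.
    by rewrite (eqP fy) mulr0 add0r.
  have : (n <= size (q %% f)%R)%N.
    by apply: minn; apply/asboolP; exists (q %% f).
  by rewrite -sf leqNgt ltn_modp fn.
exists f; split=> //; split.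
  rewrite ltnNge; apply/negP => /size1_polyC fc; move: fy fn; rewrite fc.
  by rewrite map_polyC /= /root hornerC fmorph_eq0 polyC_eq0 => ->.
move=> q sq qf; have /dvdpP[h fE] := qf; rewrite -dvdp_size_eqp //.
have qn : q != 0 by apply: contraTneq fn; rewrite fE => ->; rewrite mulr0 eqxx.
have : root (map_poly j (h * q)) y by rewrite -fE.
rewrite rmorphM rootM !divP => /orP[fh|fq]; last first.
  by rewrite eqn_leq (dvdp_leq fn qf) (dvdp_leq qn fq).
case/negP: sq; have hn : h != 0.
  by apply: contraTneq fn; rewrite fE => ->; rewrite mul0r eqxx.
have := dvdp_leq hn fh; rewrite fE size_mul //.
have := qn; rewrite -size_poly_gt0; case: (size q) => [|[|m]] //= _.
by rewrite !addnS /= -addnS -{2}[size h]addn0 leq_add2l.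
Qed.

End MinimalPolynomial.

(** * Values of roots *)

Section Peaks.
Variables (A : fieldType) (al : valuation A) (g : vgroup al).
Implicit Types p q : {poly A}.
Let GP := vgroupP al.

Definition term_value p k := vadd (al p`_k) (Some (g *+ k)).

(** The terms of p at an element of value g have the values [term_value p k]. By
    the ultrametric inequality a polynomial with a single least one has no root
    of value g, and over an algebraically closed field the converse holds by
    factorization. Whether an element of value g is a root of some polynomial is
    thus decided by the values of coefficients, which embeddings transport. *)
Definition peaked p := exists i, forall k, k != i -> vlt (term_value p i) (term_value p k).

Lemma peakedC c : c != 0 -> peaked c%:P.
Proof.
move=> c0; exists 0%N => k k0; rewrite /term_value !coefC (negPf k0) eqxx vmap0.
by have [h ->] := vmap_neq0 al c0.
Qed.

Lemma peakedXsubC r : al r <> Some g -> peaked ('X - r%:P).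
Proof.
move=> rg; have [lt|lt] := vlt_neqVgt rg; [exists 0%N|exists 1%N] => -[|[|k]] //= _;
  rewrite /term_value !coefB !coefX !coefC /= ?subr0 ?sub0r ?vmapN ?vmap1 ?vmap0 //=.
- by rewrite vaddC !vadd0 add0r.
- by rewrite vaddC vadd0; case: (al r) lt.
- by rewrite [vadd (al r) _]vaddC !vadd0 add0r.
Qed.

(** As for the lexicographically least monomial: the products of other terms have
    larger values than that of the two least terms. *)
Lemma peakedM p q : peaked p -> peaked q -> peaked (p * q).
Proof.
move=> [i pi] [k qk]; exists (i + k)%N.
have fin (r : {poly A}) m : (forall n, n != m -> vlt (term_value r m) (term_value r n)) ->
    exists h, al r`_m = Some h.
  move/(_ m.+1); rewrite -{1}(addn1 m) -{2}[m]addn0 eqn_add2l => /(_ isT).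
  by rewrite /term_value /vlt; case: (al r`_m) => [h|] /=; [exists h | case: (vadd _ _)].
have [a pa] := fin _ _ pi; have [b qb] := fin _ _ qk.
have tv n (l : 'I_n.+1) : vadd (al (p`_l * q`_(n - l))) (Some (g *+ n)) =
    vadd (term_value p l) (term_value q (n - l)).
  have -> : g *+ n = g *+ l + g *+ (n - l) by rewrite -mulrnDr subnKC // -ltnS.
  rewrite /term_value vmapM.
  by case: (al p`_l) (al q`_(n - l)) => [?|] [?|] //=; congr Some; rewrite addrACA.
have lts n (l : 'I_n.+1) : (n != i + k)%N || (l != i :> nat) ->
    vlt (vadd (term_value p i) (term_value q k)) (vadd (al (p`_l * q`_(n - l))) (Some (g *+ n))).
  move=> nl; rewrite tv /(term_value p i) /(term_value q k) pa qb.
  have [li|li] := eqVneq (l : nat) i; last first.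
    apply: (vlt_add_le GP); first by have := pi _ li; rewrite /(term_value p i) pa.
    have [->|nk] := eqVneq (n - l)%N k; first by rewrite /term_value qb vle_refl.
    by apply: (vltW GP); have := qk _ nk; rewrite /(term_value q k) qb.
  move: nl; rewrite li eqxx orbF => nik; rewrite vaddC [vadd (term_value p i) _]vaddC.
  apply: (vlt_add_le GP).
    have := qk (n - i)%N; rewrite /(term_value q k) qb; apply.
    by apply: contra nik => /eqP <-; rewrite subnKC // -li -ltnS.
  by rewrite /term_value pa vle_refl.
have c0 : vadd (term_value p i) (term_value q k) != None.
  by rewrite /term_value pa qb.
have E : term_value (p * q) (i + k) = vadd (term_value p i) (term_value q k).
  have ii : (i < (i + k).+1)%N by rewrite ltnS leq_addr.
  have tvi : vadd (al (p`_i * q`_k)) (Some (g *+ (i + k))) =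
      vadd (term_value p i) (term_value q k).
    by have := tv (i + k)%N (Ordinal ii); rewrite /= addKn.
  rewrite {1}/term_value coefM (bigD1 (Ordinal ii)) //= addKn vmapD_lt ?tvi //.
  apply: vlt_vmap_sum => [|l li]; first by rewrite vmapM pa qb.
  have := lts (i + k)%N l; rewrite eqxx /= => /(_ li).
  by rewrite -tvi vlt_shift // -vaddA /= subrr [vadd _ (Some 0)]vaddC vadd0.
move=> n nik; rewrite E {3}/term_value coefM vlt_shift //.
apply: vlt_vmap_sum => [|l _]; first by rewrite /term_value pa qb.
by rewrite -vlt_shift //; apply: lts; rewrite nik.
Qed.

End Peaks.

(** Otherwise p would be a product of peaked linear factors. *)
Lemma root_of_value (Om : closedFieldType) (om : valuation Om) (g : vgroup om)
    (p : {poly Om}) : p != 0 -> ~ peaked g p ->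
  exists2 r, root p r & om r = Some g.
Proof.
move=> p0 npk; apply: contrapT => nr; apply: npk.
have [s ps] := closed_field_poly_normal p.
have lp : lead_coef p != 0 by rewrite lead_coef_eq0.
have rs r : r \in s -> om r <> Some g.
  move=> rs rg; apply: nr; exists r => //.
  by rewrite ps rootZ // root_prod_XsubC.
rewrite ps -mul_polyC; apply: peakedM; first exact: peakedC.
elim: s rs {ps} => [|r s IH] rs; first by rewrite big_nil -polyC1; apply: peakedC (oner_neq0 _).
rewrite big_cons; apply: peakedM.
  by apply/peakedXsubC/rs; rewrite mem_head.
by apply: IH => r' r's; apply: rs; rewrite in_cons r's orbT.
Qed.

Lemma root_not_peaked (A : fieldType) (al : valuation A) (g : vgroup al)
    (p : {poly A}) r : root p r -> al r = Some g -> ~ peaked g p.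
Proof.
move=> pr rg [i pi].
have tv k : term_value g p k = al (p`_k * r ^+ k) by rewrite vmapM (vmapX _ rg).
have ni : term_value g p i != None.
  have /pi : i.+1 != i by rewrite -{2}[i]addn0 -addn1 eqn_add2l.
  by rewrite /vlt; case: (term_value g p i) => [a|] /=; last case: (term_value g p i.+1).
have isz : (i < size p)%N.
  rewrite ltnNge; apply: contra ni => /(nth_default 0) pi0.
  by rewrite /term_value pi0 vmap0.
move/eqP: pr; rewrite horner_coef (bigD1 (Ordinal isz)) //= => /(congr1 al).
rewrite vmap0 vmapD_lt -?tv; first by move=> E; rewrite E in ni.
by apply: vlt_vmap_sum => // k ki; rewrite -tv; apply: pi.
Qed.

(** * Embeddings that preserve values *)

Section PowersModulo.
Variables (D : fieldType) (f q : {poly D}) (d n : nat).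

(** The powers of q modulo f, below the exponent d, in coordinates: composition
    with q becomes multiplication by a matrix. *)
Definition power_mx : 'M[D]_(d, n) := \matrix_(i < d) poly_rV ((q ^+ i) %% f).

Lemma mul_power_mx (c : {poly D}) : (size c <= d)%N ->
  poly_rV c *m power_mx = poly_rV ((c \Po q) %% f).
Proof.
move=> sc; rewrite (comp_polyE _ _) (big_ord_widen d (fun i => c`_i *: q ^+ i)) //.
rewrite (big_morph _ (modpD f) (mod0p f)) linear_sum big_mkcond mulmx_sum_row.
apply: eq_bigr => i _; rewrite mxE rowK; case: ltnP => [_|ci].
  by rewrite modpZl linearZ.
by rewrite nth_default // scale0r.
Qed.

End PowersModulo.

(** The conjugates of q(y), for f and p the minimal polynomials of y and of
    q(y), are the values of q at the conjugates of y: otherwise f would be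
    coprime to q - r for a root r of p, hence divide (p / (X - r))(q), which
    contradicts the linear independence of the powers of q modulo f below the
    degree of p. *)
Lemma conjugate_image (N : fieldType) (Om : closedFieldType)
    (t : {rmorphism N -> Om}) (f p q : {poly N}) rho :
  f != 0 -> p != 0 -> (forall c, (f %| c \Po q) = (p %| c)) ->
  root (map_poly t p) rho ->
  exists2 r, root (map_poly t f) r & (map_poly t q).[r] = rho.
Proof.
move=> f0 p0 fp prho; apply: contrapT => nr.
pose d := (size p).-1; pose n := (size f).-1.
have sp : size p = d.+1 by rewrite prednK // size_poly_gt0.
have Bfree : row_free (power_mx f q d n).
  apply: inj_row_free => u uB; rewrite -[u]rVpolyK.
  have : p %| rVpoly u.
    rewrite -fp; apply/modp_eq0P; rewrite -[LHS](@poly_rV_K _ n); last first.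
      by rewrite -ltnS prednK ?size_poly_gt0 // ltn_modp.
    by rewrite -(@mul_power_mx _ f q d n) ?size_poly // rVpolyK uB linear0.
  move=> pu; suff -> : rVpoly u = 0 by rewrite linear0.
  by apply: contraTeq pu => u0; apply/negP => /(dvdp_leq u0); rewrite sp ltnNge size_poly.
pose tf := map_poly t f; pose tq := map_poly t q.
have cop : coprimep tf (tq - rho%:P).
  apply/Pdiv.ClosedField.coprimepP => r fr; apply/negP => /eqP.
  rewrite hornerD hornerN hornerC => /eqP; rewrite subr_eq0 => /eqP qr.
  by apply: nr; exists r.
have [p1 pE] := factor_theorem (map_poly t p) rho prho.
have p1n : p1 != 0.
  by apply: contraNneq p0 => p10; rewrite -(map_poly_eq0 t) pE p10 mul0r.
have sp1 : (size p1 <= d)%N.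
  have := size_map_poly t p; rewrite pE size_Mmonic ?monicXsubC // sp size_XsubC.
  by rewrite addnS addn1 => -[->].
have : tf %| p1 \Po tq.
  rewrite -(Gauss_dvdpl _ cop) -[tq - _]/(tq - rho%:P).
  have -> : (p1 \Po tq) * (tq - rho%:P) = map_poly t (p \Po q).
    by rewrite map_comp_poly pE comp_polyM comp_polyB comp_polyX comp_polyC.
  by rewrite dvdp_map fp dvdpp.
move/modp_eq0P => fp1; case/negP: p1n; apply/eqP.
rewrite -[p1](poly_rV_K sp1).
suff -> : poly_rV p1 = 0 :> 'rV_d by rewrite linear0.
have : row_free (map_mx t (power_mx f q d n)) by rewrite row_free_map.
move/row_free_inj; apply; rewrite mul0mx.
have -> : map_mx t (power_mx f q d n) = power_mx tf tq d n.
  by apply/matrixP=> a b; rewrite !mxE -rmorphXn -map_modp coef_map.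
by rewrite mul_power_mx // fp1 linear0.
Qed.

Section ExtendSimple.
Variables (A : fieldType) (Om : closedFieldType).
Variables (al : valuation A) (om : valuation Om) (phi : vgroup al -> vgroup om).
Hypothesis phiD : {morph phi : g h / g + h}.
Hypothesis phi_le : {mono phi : g h / g <= h}.

Let phiMn g n : phi (g *+ n) = phi g *+ n.
Proof.
elim: n => [|n IH]; last by rewrite !mulrS phiD IH.
by apply: (addrI (phi 0)); rewrite -phiD !addr0.
Qed.

Let omap_vadd a b : omap phi (vadd a b) = vadd (omap phi a) (omap phi b).
Proof. by case: a b => [a|] [b|] //=; rewrite phiD. Qed.

Let omap_vlt a b : vlt (omap phi a) (omap phi b) = vlt a b.
Proof. by rewrite /vlt; case: a b => [a|] [b|] //=; rewrite phi_le. Qed.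

Section OneElement.
Variables (N : fieldType) (j : {rmorphism N -> A}) (t : {rmorphism N -> Om}) (y : A).
Hypothesis tj : forall c, om (t c) = omap phi (al (j c)).
Local Notation eA q := (map_poly j q).[y].
Local Notation eO q r := (map_poly t q).[r].

Definition separated (q : {poly N}) r := om (eO q r) <> omap phi (al (eA q)).

(** If the values of q^n Q at r and at y agreed for two exponents n, then, value
    groups being torsion-free, those of q would agree and therefore those of Q. *)
Lemma separated_pow q Q r : eA q != 0 -> eA Q != 0 ->
    separated q r \/ separated Q r ->
  exists n0, forall n, (n0 <= n)%N -> separated (q ^+ n * Q) r.
Proof.
move=> q0 Q0 sqQ; apply: contrapT => nex.
have nsep n0 : exists2 n, (n0 <= n)%N & ~ separated (q ^+ n * Q) r.
  apply: contrapT => nn; apply: nex; exists n0 => n n0n sep.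
  by apply: nn; exists n => //; apply/contrapT.
have [n n1 /contrapT en] := nsep 1%N; have [m nm /contrapT em] := nsep n.+1.
have [c vc] := vmap_neq0 al q0; have [d vd] := vmap_neq0 al Q0.
have [k mE] : exists k, m = (n + k.+1)%N.
  by exists (m - n.+1)%N; rewrite -addSnnS subnKC.
have eE l : al (eA (q ^+ l * Q)) = Some (c *+ l + d).
  by rewrite rmorphM rmorphXn /= hornerM horner_exp vmapM (vmapX _ vc) vd.
rewrite !eE /= !phiD !phiMn !rmorphM !rmorphXn /= !hornerM !horner_exp !vmapM in en em.
have qr0 : eO q r != 0.
  by apply: contraPneq en => ->; case: n n1 {nm mE} => // n _; rewrite expr0n /= vmap0.
have Qr0 : eO Q r != 0 by apply: contraPneq en => ->; rewrite vmap0; case: (om _).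
have [a va] := vmap_neq0 om qr0; have [b vb] := vmap_neq0 om Qr0.
rewrite !(vmapX _ va) vb /= in en em; case: en => en; case: em => em.
have ac : a = phi c.
  apply/eqP; rewrite -subr_eq0; apply/eqP/(ordered_torsion_free (vgroupP om) (n := k)).
  rewrite mulrnBl; apply/eqP; rewrite subr_eq0; apply/eqP/(addrI (a *+ n + b)).
  by rewrite {2}en addrAC -mulrnDr -mE em mE mulrnDr addrAC.
move: en; rewrite ac => /addrI bd.
by case: sqQ; apply; rewrite ?vc ?vd ?va ?vb /= ?ac ?bd.
Qed.

(** By induction on s: a high power of a polynomial that separates the earlier
    elements, times one that separates the new element, separates all. *)
Lemma separated_all (s : seq Om) :
    (forall r, r \in s -> exists2 Q, eA Q != 0 & separated Q r) ->
  exists2 q, eA q != 0 & forall r, r \in s -> separated q r.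
Proof.
elim: s => [|r s IH] sep; first by exists 1 => //; rewrite rmorph1 hornerC oner_neq0.
have [|q q0 qs] := IH; first by move=> r' r's; apply: sep; rewrite in_cons r's orbT.
have [Q Q0 Qr] := sep r (mem_head _ _).
have [n0 n0P] : exists n0, forall n, (n0 <= n)%N ->
    forall r', r' \in r :: s -> separated (q ^+ n * Q) r'.
  have : forall r', r' \in r :: s -> separated q r' \/ separated Q r'.
    by move=> r'; rewrite in_cons => /orP[/eqP->|/qs]; [right | left].
  elim: (r :: s) => [|r' s' IH'] qQ; first by exists 0%N.
  have [|n1 n1P] := IH'; first by move=> z zs; apply: qQ; rewrite in_cons zs orbT.
  have [n2 n2P] := separated_pow q0 Q0 (qQ r' (mem_head _ _)).
  exists (maxn n1 n2) => n; rewrite geq_max => /andP[n1n n2n] z.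
  by rewrite in_cons => /orP[/eqP->|]; [apply: n2P | apply: n1P].
exists (q ^+ n0 * Q); last exact: n0P.
by rewrite rmorphM rmorphXn hornerM horner_exp mulf_neq0 ?expf_neq0.
Qed.

(** Let f be the minimal polynomial of y over N. If no root of f had the same
    values as y, a single q would separate y from all of them. The minimal
    polynomial of q(y) has a root of the value g of q(y), hence its image over Om
    has one too, as this concerns only values of coefficients. But the roots over
    Om are the values of q at the roots of f. *)
Lemma extend_simple : algebraicOver j y ->
  exists r, forall q, om (eO q r) = omap phi (al (eA q)).
Proof.
move=> algy; have [f [fm firr fy fdiv]] := minimal_polynomial algy.
apply: contrapT => nex; have f0 := monic_neq0 fm.
have [s sE] := closed_field_poly_normal (map_poly t f).
have [r|q q0 qs] := @separated_all s.
  move=> rs; have fr : root (map_poly t f) r.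
    by rewrite sE rootZ ?lead_coef_eq0 ?map_poly_eq0 // root_prod_XsubC.
  have [q qr] : exists q, separated q r.
    apply: contrapT => nq; apply: nex; exists r => q; apply: contrapT => sq.
    by apply: nq; exists q.
  exists q => //; apply/eqP => qy; apply: qr.
  have /dvdpP[h ->] : f %| q by rewrite -fdiv /root qy.
  by rewrite !rmorphM !hornerM (eqP fy) (eqP fr) !mulr0 !vmap0.
have [g vg] := vmap_neq0 al q0.
have algz : algebraicOver j (eA q).
  apply/integral_algebraic/integral_horner; last exact/integral_algebraic.
  by apply/(integral_poly j) => k; rewrite coef_map; apply: integral_id.
have [p [pm pirr pz pdiv]] := minimal_polynomial algz.
have npk : ~ peaked (phi g) (map_poly t p).
  have tvE k : term_value (phi g) (map_poly t p) k =
      omap phi (term_value g (map_poly j p) k).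
    by rewrite /term_value !coef_map /= tj omap_vadd /= phiMn.
  move=> [i ip]; apply: (root_not_peaked pz vg); exists i => k ki.
  by have := ip k ki; rewrite !tvE omap_vlt.
have p0 : map_poly t p != 0 by rewrite map_poly_eq0 monic_neq0.
have [rho prho vrho] := root_of_value p0 npk.
have [c|r fr qr] := @conjugate_image _ _ t f p q rho f0 (monic_neq0 pm) _ prho.
  by rewrite -fdiv -pdiv map_comp_poly /root horner_comp.
have rs : r \in s.
  by move: fr; rewrite sE rootZ ?lead_coef_eq0 ?map_poly_eq0 // root_prod_XsubC.
by apply: (qs r rs); rewrite qr vrho vg.
Qed.

End OneElement.
End ExtendSimple.

Local Open Scope classical_set_scope.

Lemma Zorn_above (T : Type) (P : set (set T)) (S : set T) : P S ->
    (forall F : set (set T), F !=set0 -> F `<=` P -> total_on F subset ->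
       P (\bigcup_(X in F) X)) ->
  exists M, [/\ P M, S `<=` M & forall M', P M' -> M `<=` M' -> M' `<=` M].
Proof.
move=> PS chain; pose P' X := X = set0 \/ P X /\ S `<=` X.
(* The empty set is added to the family for the sake of the empty chain. *)
have [F FP tot|M [PM Mmax]] := @Zorn_bigcup T P'.
  have [[X [FX [s Xs]]]|nF] := pselect (exists X, F X /\ X !=set0); last first.
    left; rewrite -subset0 => s [X FX Xs]; apply: nF.
    by exists X; split=> //; exists s.
  right; have PX Y : F Y -> Y !=set0 -> P Y /\ S `<=` Y.
    by move=> /FP[->|//] [z].
  split; last first.
    by move=> z /(PX _ FX (ex_intro _ _ Xs)).2 Xz; exists X.
  have -> : \bigcup_(X in F) X = \bigcup_(X in F `&` [set X | X !=set0]) X.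
    apply/seteqP; split=> z [Y FY Yz]; last by case: FY => FY _; exists Y.
    by exists Y => //; split=> //; exists z.
  apply: chain; first by exists X; split=> //; exists s.
    by move=> Y [/PX h /h[]].
  by move=> Y Z [FY _] [FZ _]; apply: tot.
have SM : P M /\ S `<=` M.
  case: PM => // M0; have [S0|/set0P S0] := eqVneq S set0.
    by rewrite M0 -{1}S0; split=> //; rewrite S0.
  exfalso; apply: (Mmax S); last by right; split.
  by rewrite M0; split; [apply: sub0set | case: S0 => z Sz /(_ z Sz)].
case: SM => {}PM SM; exists M; split=> // M' PM' MM'; apply: contrapT => nM.
by apply: (Mmax M'); [split | right; split=> //; apply: subset_trans MM'].
Qed.

Section Extension.
Variables (A : fieldType) (Om : closedFieldType).
Variables (al : valuation A) (om : valuation Om) (phi : vgroup al -> vgroup om).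

(** A partial embedding of A in Om is encoded by its graph, a subring of
    A * Om; preserving values makes the graph functional and injective. *)
Definition value_graph (R : set (A * Om)) :=
  [/\ R (1, 1), forall p q, R p -> R q -> R (p - q),
      forall p q, R p -> R q -> R (p * q) &
      forall p, R p -> om p.2 = omap phi (al p.1)].

Lemma value_graph_fun R p q : value_graph R -> R p -> R q -> p.1 = q.1 -> p.2 = q.2.
Proof.
move=> [_ RB _ Rv] Rp Rq pq; apply/eqP; rewrite -subr_eq0 -(vmap_eq0 om).
by have := Rv _ (RB _ _ Rp Rq); rewrite /= pq subrr vmap0 => ->.
Qed.

Lemma value_graph_bigcup (F : set (set (A * Om))) :
  F !=set0 -> F `<=` value_graph -> total_on F subset ->
  value_graph (\bigcup_(X in F) X).
Proof.
move=> [X FX] FG tot.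
have two p q : (\bigcup_(X in F) X) p -> (\bigcup_(X in F) X) q ->
    exists Y, [/\ F Y, Y p & Y q].
  move=> [Y FY Yp] [Z FZ Zq]; have [YZ|ZY] := tot _ _ FY FZ.
    by exists Z; split=> //; apply: YZ.
  by exists Y; split=> //; apply: ZY.
split.
- by exists X => //; have [] := FG _ FX.
- move=> p q pF qF; have [Y [FY Yp Yq]] := two p q pF qF.
  by exists Y => //; have [_ YB _ _] := FG _ FY; apply: YB.
- move=> p q pF qF; have [Y [FY Yp Yq]] := two p q pF qF.
  by exists Y => //; have [_ _ YM _] := FG _ FY; apply: YM.
- by move=> p [Y FY Yp]; have [_ _ _ Yv] := FG _ FY; apply: Yv.
Qed.

End Extension.

(** A graph that is closed under inverses is a field with embeddings in A and in
    Om, which makes it available as a base field for simple extensions. *)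
Record field_graph (A Om : fieldType) := FieldGraph {
  fg_pred :> {pred A * Om};
  fg_subring : subring_closed fg_pred;
  fg_inj : forall p, p \in fg_pred -> p.1 = 0 -> p = 0;
  fg_inv : forall p, p \in fg_pred -> p.1 != 0 -> (p.1^-1, p.2^-1) \in fg_pred }.

Section FieldGraphField.
Variables (A Om : fieldType) (R : field_graph A Om).

HB.instance Definition _ :=
  GRing.isSubringClosed.Build (A * Om)%type (fg_pred R) (fg_subring R).

Record graph_field := GraphField { graph_val : A * Om; _ : graph_val \in fg_pred R }.

HB.instance Definition _ := [isSub for graph_val].
HB.instance Definition _ := [Choice of graph_field by <:].
HB.instance Definition _ := [SubChoice_isSubComNzRing of graph_field by <:].

Definition graph_inv (a : graph_field) : graph_field :=
  if (val a).1 == 0 then 0 else insubd 0 ((val a).1^-1, (val a).2^-1).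

Fact graph_mulVf a : a != 0 -> graph_inv a * a = 1.
Proof.
move=> a0; have a10 : (val a).1 != 0.
  by apply: contra a0 => /eqP a1; apply/eqP/val_inj; rewrite (fg_inj (valP a) a1).
have [R1 RB RM] := fg_subring R.
have Rinv := fg_inv (valP a) a10.
have aa : val a * ((val a).1^-1, (val a).2^-1) = 1.
  apply/eqP; rewrite -subr_eq0; apply/eqP/(@fg_inj _ _ R).
    by apply: RB => //; apply: RM => //; apply: valP.
  by rewrite /= mulfV // subrr.
apply: val_inj; rewrite /graph_inv (negPf a10) mulrC.
rewrite [LHS](_ : _ = val a * ((val a).1^-1, (val a).2^-1)) //.
by congr (_ * _); rewrite insubdK.
Qed.

Fact graph_inv0 : graph_inv 0 = 0.
Proof. by rewrite /graph_inv eqxx. Qed.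

HB.instance Definition _ :=
  GRing.ComNzRing_isField.Build graph_field graph_mulVf graph_inv0.

Definition graph_fst (a : graph_field) : A := (val a).1.
Definition graph_snd (a : graph_field) : Om := (val a).2.

Fact graph_fst_zmod_morphism : zmod_morphism graph_fst.
Proof. by []. Qed.
Fact graph_fst_monoid_morphism : monoid_morphism graph_fst.
Proof. by []. Qed.
Fact graph_snd_zmod_morphism : zmod_morphism graph_snd.
Proof. by []. Qed.
Fact graph_snd_monoid_morphism : monoid_morphism graph_snd.
Proof. by []. Qed.
HB.instance Definition _ := GRing.isZmodMorphism.Build _ _ graph_fst graph_fst_zmod_morphism.
HB.instance Definition _ := GRing.isMonoidMorphism.Build _ _ graph_fst graph_fst_monoid_morphism.
HB.instance Definition _ := GRing.isZmodMorphism.Build _ _ graph_snd graph_snd_zmod_morphism.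
HB.instance Definition _ := GRing.isMonoidMorphism.Build _ _ graph_snd graph_snd_monoid_morphism.

End FieldGraphField.

Section Conjugation.
Variables (A : fieldType) (Om : closedFieldType).
Variables (al : valuation A) (om : valuation Om) (phi : vgroup al -> vgroup om).
Hypothesis phiD : {morph phi : g h / g + h}.
Hypothesis phi_le : {mono phi : g h / g <= h}.

Let omap_vadd a b : omap phi (vadd a b) = vadd (omap phi a) (omap phi b).
Proof. by case: a b => [a|] [b|] //=; rewrite phiD. Qed.

(** The products of elements of M by powers of (p.1^-1, p.2^-1) form a value
    graph again, since powers of p.1 and of p.2 have matching values. *)
Lemma maximal_value_graph_inv (M : set (A * Om)) p :
  value_graph phi M -> (forall M', value_graph phi M' -> M `<=` M' -> M' `<=` M) ->
  M p -> p.1 != 0 -> M (p.1^-1, p.2^-1).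
Proof.
move=> [M1 MB MM Mv] Mmax Mp p10.
have MX n : M (p ^+ n).
  by elim: n => [|n IH]; rewrite ?expr0 // exprS; apply: MM.
have [g vg] := vmap_neq0 al p10.
have vp2 : om p.2 = Some (phi g) by rewrite Mv // vg.
have p20 : p.2 != 0 by rewrite -(vmap_eq0 om) vp2.
apply: (Mmax [set z | exists n, M (z * p ^+ n)]); first last.
- exists 1%N; rewrite expr1; suff -> : (p.1^-1, p.2^-1) * p = (1, 1) by [].
  by congr pair; rewrite mulVf.
- by move=> z Mz; exists 0%N; rewrite expr0 mulr1.
split; first by exists 0%N; rewrite expr0 mulr1.
- move=> z w [n Mz] [m Mw]; exists (n + m)%N.
  by rewrite mulrBl exprD mulrA (mulrC (p ^+ n)) mulrA; apply: MB; apply: MM.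
- move=> z w [n Mz] [m Mw]; exists (n + m)%N.
  by rewrite exprD mulrACA; apply: MM.
move=> z [n /Mv]; rewrite [(z * _).2]/(z.2 * (p ^+ n).2) [(z * _).1]/(z.1 * (p ^+ n).1).
rewrite !vmapM omap_vadd -(Mv _ (MX n)) -[(p ^+ n).2]/(snd (p ^+ n)) rmorphXn.
rewrite (vmapX _ vp2) ![vadd _ (Some _)]vaddC => E.
by apply: vle_anti; rewrite -(vle_add2l (vgroupP om) (phi g *+ n)) E vle_refl.
Qed.

Lemma value_graph_field (M : set (A * Om)) :
  value_graph phi M -> (forall M', value_graph phi M' -> M `<=` M' -> M' `<=` M) ->
  exists R : field_graph A Om, forall p, (p \in R) = `[< M p >].
Proof.
move=> Mg Mmax; have [M1 MB MM Mv] := Mg.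
pose P : {pred A * Om} := fun p => `[< M p >].
have Psub : subring_closed P.
  split; first exact/asboolP.
    by move=> p q /asboolP Mp /asboolP Mq; apply/asboolP/MB.
  by move=> p q /asboolP Mp /asboolP Mq; apply/asboolP/MM.
have Pinj p : p \in P -> p.1 = 0 -> p = 0.
  move=> /asboolP Mp p1; case: p p1 Mp => p1 p2 /= -> Mp.
  have := Mv _ Mp; rewrite /= vmap0 /= => /eqP; rewrite vmap_eq0 => /eqP -> //.
have Pinv p : p \in P -> p.1 != 0 -> (p.1^-1, p.2^-1) \in P.
  by move=> /asboolP Mp p10; apply/asboolP; exact: (maximal_value_graph_inv Mg Mmax Mp p10).
by exists (FieldGraph Psub Pinj Pinv).
Qed.

(** By Zorn's lemma and the case of simple extensions. Taking B to be a ring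
    allows polynomial rings: an embedding of K(x) need only be given, and its
    values compared, on polynomials. *)
Theorem extend_embedding (B : comNzRingType) (j0 : {rmorphism B -> A})
    (t0 : {rmorphism B -> Om}) :
  (forall b, om (t0 b) = omap phi (al (j0 b))) ->
  (forall y : A, exists2 p : {poly B}, map_poly j0 p != 0 & root (map_poly j0 p) y) ->
  exists t : {rmorphism A -> Om},
    (forall b, t (j0 b) = t0 b) /\ forall y, om (t y) = omap phi (al y).
Proof.
move=> t0v algA.
pose S : set (A * Om) := [set (j0 b, t0 b) | b in setT].
have Sg : value_graph phi S.
  split; first by exists 1; rewrite // !rmorph1.
  - by move=> _ _ [a _ <-] [b _ <-]; exists (a - b); rewrite // !rmorphB.
  - by move=> _ _ [a _ <-] [b _ <-]; exists (a * b); rewrite // !rmorphM.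
  - by move=> _ [a _ <-] /=.
have [M [Mg SM Mmax]] := Zorn_above Sg (@value_graph_bigcup _ _ _ _ phi).
have [R RE] := value_graph_field Mg Mmax.
have [M1 MB MM Mv] := Mg.
pose N := graph_field R; pose j : {rmorphism N -> A} := @graph_fst _ _ R.
pose t : {rmorphism N -> Om} := @graph_snd _ _ R.
have NM (c : N) : M (j c, t c).
  have -> : (j c, t c) = val c by rewrite [RHS]surjective_pairing.
  by apply/asboolP; rewrite -RE; apply: valP.
have MN p : M p -> exists c : N, j c = p.1 /\ t c = p.2.
  by move=> Mp; have Rp : p \in R by [rewrite RE; apply/asboolP]; exists (GraphField Rp).
have tj c : om (t c) = omap phi (al (j c)) by exact: (Mv _ (NM c)).
have total y : exists z, M (y, z).
  have algy : algebraicOver j y.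
    have [p p0 py] := algA y.
    have cP b : exists c : N, j c = j0 b by have [|c []] := MN (j0 b, t0 b); [apply: SM; exists b | exists c].
    pose q : {poly N} := \poly_(i < size p) projT1 (cid (cP p`_i)).
    have qE : map_poly j q = map_poly j0 p.
      apply/polyP => i; rewrite !coef_map coef_poly; case: ltnP => ip.
        exact: (projT2 (cid (cP p`_i))).
      by rewrite (nth_default _ ip); transitivity (0 : A); [exact: (rmorph0 j) | exact: esym (rmorph0 j0)].
    by exists q; rewrite -?(map_poly_eq0 j) qE.
  have [z zP] := extend_simple phiD phi_le tj algy.
  exists z; apply: (Mmax [set ((map_poly j q).[y], (map_poly t q).[z]) | q in setT]).
  - split; first by exists 1; rewrite // !rmorph1 !hornerC.
    + by move=> _ _ [a _ <-] [b _ <-]; exists (a - b); rewrite // !rmorphB !hornerD !hornerN.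
    + by move=> _ _ [a _ <-] [b _ <-]; exists (a * b); rewrite // !rmorphM !hornerM.
    + by move=> _ [a _ <-] /=.
  - move=> p /MN[c [c1 c2]]; exists c%:P => //.
    by rewrite !map_polyC !hornerC /= c1 c2; case: p {c1 c2}.
  by exists 'X => //; rewrite !map_polyX !hornerX.
pose T y := projT1 (cid (total y)).
have TM y : M (y, T y) by exact: (projT2 (cid (total y))).
have TE y z : M (y, z) -> T y = z.
  by move=> Mz; exact: (value_graph_fun Mg (TM y) Mz).
have Tadd : zmod_morphism T by move=> a b; apply: TE; exact: (MB _ _ (TM a) (TM b)).
have Tmul : monoid_morphism T.
  by split=> [|a b]; apply: TE; [exact: M1 | exact: (MM _ _ (TM a) (TM b))].
pose Ta := GRing.isZmodMorphism.Build _ _ T Tadd.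
pose Tm := GRing.isMonoidMorphism.Build _ _ T Tmul.
pose Tr : {rmorphism A -> Om} := HB.pack T Ta Tm.
exists Tr; split=> [b|y]; last exact: (Mv _ (TM y)).
by apply: TE; apply: SM; exists b.
Qed.

End Conjugation.

Local Close Scope classical_set_scope.

Local Open Scope quotient_scope.

(** * The valuation of a valuation ring *)

Record valuation_ring (L : fieldType) := ValuationRing {
  vr_pred :> {pred L};
  vr_subring : subring_closed vr_pred;
  vr_total : forall x, x \in vr_pred \/ x^-1 \in vr_pred }.

Section ValueGroupOfRing.
Variables (L : fieldType) (A : valuation_ring L).

Let A1 : 1 \in (A : {pred L}). Proof. by have [] := vr_subring A. Qed.
Let AB x y : x \in (A : {pred L}) -> y \in (A : {pred L}) -> x - y \in (A : {pred L}).
Proof. by have [_ AB _] := vr_subring A; apply: AB. Qed.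
Let AM x y : x \in (A : {pred L}) -> y \in (A : {pred L}) -> x * y \in (A : {pred L}).
Proof. by have [_ _ AM] := vr_subring A; apply: AM. Qed.

Definition nonzero := {x : L | x != 0}.
Definition associated (x y : nonzero) :=
  (val x / val y \in vr_pred A) && (val y / val x \in vr_pred A).

Let divA (y x z : L) : y != 0 -> x / y \in vr_pred A -> y / z \in vr_pred A ->
  x / z \in vr_pred A.
Proof. by move=> y0 xy yz; rewrite -(divfK y0 x) -[x / y * y / z]mulrA; apply: AM. Qed.

Fact associated_refl : reflexive associated.
Proof.
by move=> x; rewrite /associated (divff (valP x)) andbb; apply: A1.
Qed.
Fact associated_sym : symmetric associated.
Proof. by move=> x y; rewrite /associated andbC. Qed.
Fact associated_trans : transitive associated.
Proof.
move=> y x z /andP[xy yx] /andP[yz zy]; rewrite /associated.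
by rewrite (divA (valP y) xy yz) (divA (valP y) zy yx).
Qed.

Canonical associated_equiv :=
  EquivRel associated associated_refl associated_sym associated_trans.

(** The multiplicative group of L modulo the units of A, written additively. *)
Definition value_quotient := {eq_quot associated}.
HB.instance Definition _ := Choice.on value_quotient.

Definition value_class (x : L) : value_quotient :=
  \pi_value_quotient (insubd (Sub 1 (oner_neq0 L)) x).
Definition value_repr (a : value_quotient) : L := val (repr a).

Lemma value_repr_neq0 a : value_repr a != 0.
Proof. exact: valP (repr a). Qed.

Lemma value_classE x y : x != 0 -> y != 0 ->
  (value_class x == value_class y) = (x / y \in vr_pred A) && (y / x \in vr_pred A).
Proof. by move=> x0 y0; rewrite eqmodE /= /associated !insubdK. Qed.

Lemma value_reprK a : value_class (value_repr a) = a.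
Proof. by rewrite /value_class /value_repr valKd reprK. Qed.

Lemma value_classK x : x != 0 ->
  (value_repr (value_class x) / x \in vr_pred A) /\
  (x / value_repr (value_class x) \in vr_pred A).
Proof.
move=> x0; apply/andP; rewrite -value_classE ?value_repr_neq0 //.
by rewrite value_reprK.
Qed.

Definition value_add a b := value_class (value_repr a * value_repr b).
Definition value_opp a := value_class (value_repr a)^-1.
Definition value_zero := value_class 1.
Definition value_le a b := value_repr b / value_repr a \in vr_pred A.

Lemma value_class_eq x y : x != 0 -> y != 0 -> x / y \in vr_pred A ->
  y / x \in vr_pred A -> value_class x = value_class y.
Proof. by move=> x0 y0 xy yx; apply/eqP; rewrite value_classE // xy. Qed.

Lemma value_class_mul x y : x != 0 -> y != 0 ->
  value_class (x * y) = value_add (value_class x) (value_class y).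
Proof.
move=> x0 y0; have [x1 x2] := value_classK x0; have [y1 y2] := value_classK y0.
apply: value_class_eq; rewrite ?mulf_neq0 ?value_repr_neq0 //.
  by rewrite invfM mulrACA AM.
by rewrite invfM mulrACA AM.
Qed.

Lemma value_classP a : exists2 x, x != 0 & a = value_class x.
Proof. by exists (value_repr a); rewrite ?value_repr_neq0 ?value_reprK. Qed.

Fact value_addA : associative value_add.
Proof.
move=> a b c; have [x x0 ->] := value_classP a; have [y y0 ->] := value_classP b.
have [z z0 ->] := value_classP c.
by rewrite -!value_class_mul ?mulf_neq0 // mulrA.
Qed.

Fact value_addC : commutative value_add.
Proof. by move=> a b; rewrite /value_add mulrC. Qed.

Fact value_add0 : left_id value_zero value_add.
Proof.
move=> a; have [x x0 ->] := value_classP a.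
by rewrite -value_class_mul ?oner_neq0 // mul1r.
Qed.

Fact value_addN : left_inverse value_zero value_opp value_add.
Proof.
move=> a; rewrite /value_opp -{2}[a]value_reprK -value_class_mul ?invr_neq0 ?value_repr_neq0 //.
by rewrite mulVf ?value_repr_neq0.
Qed.

HB.instance Definition _ :=
  GRing.isZmodule.Build value_quotient value_addA value_addC value_add0 value_addN.

Lemma value_le_class x y : x != 0 -> y != 0 ->
  value_le (value_class x) (value_class y) = (y / x \in vr_pred A).
Proof.
move=> x0 y0; have [x1 x2] := value_classK x0; have [y1 y2] := value_classK y0.
apply/idP/idP => h.
  by apply: (divA (value_repr_neq0 (value_class x)) _ x1); apply: (divA (value_repr_neq0 (value_class y)) y2 h).
by apply: (divA x0 _ x2); apply: (divA y0 y1 h).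
Qed.

Fact value_le_refl : reflexive value_le.
Proof. by move=> a; rewrite /value_le divff ?value_repr_neq0. Qed.

Fact value_le_anti : antisymmetric value_le.
Proof.
move=> a b /andP[ab ba]; rewrite -[a]value_reprK -[b]value_reprK.
by apply: value_class_eq; rewrite ?value_repr_neq0.
Qed.

Fact value_le_trans : transitive value_le.
Proof. by move=> b a c ab bc; apply: divA bc ab; rewrite value_repr_neq0. Qed.

HB.instance Definition _ :=
  Order.Le_isPOrder.Build ring_display value_quotient
    value_le_refl value_le_anti value_le_trans.

Definition value_group_of_ring : porderZmodType := value_quotient.

Lemma value_group_of_ringP : ordered_abelian_group value_group_of_ring.
Proof.
split.
  move=> a b; have [x x0 ->] := value_classP a; have [y y0 ->] := value_classP b.
  rewrite ![_ <= _]value_le_class //.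
  by have [h|] := vr_total A (x / y); [apply/orP; right | rewrite invf_div => h; apply/orP; left].
move=> c a b; have [x x0 ->] := value_classP a; have [y y0 ->] := value_classP b.
have [z z0 ->] := value_classP c.
rewrite -[value_class z + value_class x]value_class_mul // -[value_class z + value_class y]value_class_mul //.
by rewrite ![_ <= _]value_le_class ?mulf_neq0 // -mulf_div divff // mul1r.
Qed.

Definition ring_value (x : L) : option value_group_of_ring :=
  if x == 0 then None else Some (value_class x).

Fact ring_value_eq0 x : (ring_value x == None) = (x == 0).
Proof. by rewrite /ring_value; case: (x == 0). Qed.

Fact ring_valueM x y : ring_value (x * y) = vadd (ring_value x) (ring_value y).
Proof.
rewrite /ring_value mulf_eq0; have [//|x0] := eqVneq x 0.
by have [//|y0] := eqVneq y 0; congr Some; apply: value_class_mul.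
Qed.

Lemma vle_ring_value x y : y != 0 ->
  vle (ring_value y) (ring_value x) = (x / y \in vr_pred A).
Proof.
move=> y0; rewrite /ring_value (negPf y0); have [->|x0] := eqVneq x 0.
  by rewrite mul0r -(subrr 1) AB.
exact: value_le_class.
Qed.

Fact ring_valueD x y : vle (vmin (ring_value x) (ring_value y)) (ring_value (x + y)).
Proof.
wlog xy : x y / vle (ring_value x) (ring_value y) => [hw|].
  have /orP[|] := vle_total value_group_of_ringP (ring_value x) (ring_value y).
    exact: hw.
  move=> yx; have := hw y x yx; rewrite addrC /vmin yx; case: ifP => // xy.
  by rewrite (vle_anti xy yx).
rewrite /vmin xy; have [x0|x0] := eqVneq x 0; first by rewrite x0 add0r -{1}x0.
rewrite vle_ring_value // mulrDl divff //; move: xy; rewrite vle_ring_value // => yx.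
by rewrite -[y / x]opprK AB // -sub0r AB // -(subrr 1) AB.
Qed.

Definition valuation_of_ring : valuation L :=
  Valuation value_group_of_ringP ring_value_eq0 ring_valueM ring_valueD.

Lemma in_vring_of_ring x : in_vring valuation_of_ring x = (x \in vr_pred A).
Proof.
have := vle_ring_value x (oner_neq0 L); rewrite divr1 => <-.
by rewrite /in_vring -(vmap1 valuation_of_ring).
Qed.

End ValueGroupOfRing.

Local Close Scope quotient_scope.

Local Open Scope classical_set_scope.

(** * Extension of valuations *)

Section Chevalley.
Variables (F L : fieldType) (l : {rmorphism F -> L}) (w : valuation F).
Let GP := vgroupP w.

Let maxideal f := vlt (Some 0) (w f).

(** Subrings of L that meet F in its valuation ring; as the ideals of a
    valuation ring are linearly ordered, the last condition says that the
    maximal ideal of F does not generate the unit ideal. *)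
Definition dominating (A : set L) :=
  [/\ A 1, forall x y, A x -> A y -> A (x - y), forall x y, A x -> A y -> A (x * y) &
      forall f, A (l f) <-> in_vring w f].

Lemma notin_vring f : ~~ in_vring w f -> f != 0 /\ maxideal f^-1.
Proof.
move=> nf; have f0 : f != 0 by apply: contraNneq nf => ->; rewrite /in_vring vmap0.
split=> //; have [g vf] := vmap_neq0 w f0; move: nf; rewrite /in_vring /maxideal vf.
by rewrite (vmapV vf) /vlt /= -[- g <= 0](ler_addl2 GP g) subrr addr0.
Qed.

Lemma maxideal_in f : maxideal f -> in_vring w f.
Proof. exact: vltW. Qed.

Section Maximal.
Variable A : set L.
Hypothesis Adom : dominating A.
Hypothesis Amax : forall A', dominating A' -> A `<=` A' -> A' `<=` A.

Let A1 : A 1. Proof. by case: Adom. Qed.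
Let AB x y : A x -> A y -> A (x - y). Proof. by case: Adom => _ h _ _; apply: h. Qed.
Let AM x y : A x -> A y -> A (x * y). Proof. by case: Adom => _ _ h _; apply: h. Qed.
Let Al f : A (l f) <-> in_vring w f. Proof. by case: Adom. Qed.
Let A0 : A 0. Proof. by rewrite -(subrr (1 : L)); apply: AB. Qed.
Let AD x y : A x -> A y -> A (x + y).
Proof. by move=> Ax Ay; rewrite -[y]opprK -[- y]sub0r; do 2?apply: AB. Qed.
Let AX x n : A x -> A (x ^+ n).
Proof. by move=> Ax; elim: n => [|n IH]; rewrite ?expr0 // exprS; apply: AM. Qed.

Lemma maxideal_proper m a : maxideal m -> A a -> l m * a != 1.
Proof.
move=> mm Aa; apply/eqP => ma.
have lm0 : l m != 0 by apply: contra_eq_neq ma => ->; rewrite mul0r eq_sym oner_eq0.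
have m0 : m != 0 by rewrite -(fmorph_eq0 l).
have : A (l m^-1) by rewrite fmorphV -[_^-1]mulr1 -ma mulKf.
move/Al; rewrite /in_vring; have [g vm] := vmap_neq0 w m0.
move: mm; rewrite /maxideal vm (vmapV vm) /vlt /= => /negP mm g0; apply: mm.
by rewrite -(ler_addl2 GP (- g)) addNr addr0.
Qed.

(** One of m and m' divides the other in the valuation ring of F, so that the sum
    is a multiple of one of them and maxideal_proper applies. *)
Lemma maxideal_add m a m' a' : maxideal m -> maxideal m' -> A a -> A a' ->
  l m * a + l m' * a' != 1.
Proof.
wlog mm' : m a m' a' / vle (w m) (w m').
  move=> hw m1 m2 Aa Aa'; have /orP[|] := vle_total GP (w m) (w m'); first by move/hw; apply.
  by move=> h; rewrite addrC; apply: hw.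
move=> m1 m2 Aa Aa'; have [m0|m0] := eqVneq m 0.
  have m'0 : m' = 0 by apply/eqP; move: mm'; rewrite m0 vmap0 -(vmap_eq0 w); case: (w m').
  by rewrite m0 m'0 rmorph0 !mul0r addr0 eq_sym oner_neq0.
rewrite -(divfK m0 m') rmorphM [l (m' / m) * _]mulrC -mulrA -mulrDr.
by apply: maxideal_proper => //; apply: AD => //; apply: AM => //; apply/Al; rewrite -vle_div.
Qed.

(** By maximality, A' contains an element f of F outside the valuation ring; its
    inverse lies in the maximal ideal. *)
Lemma dominating_adjoin (A' : set L) : A `<=` A' ->
  (forall x y, A' x -> A' y -> A' (x - y)) -> (forall x y, A' x -> A' y -> A' (x * y)) ->
  ~ A' `<=` A -> exists2 m, maxideal m & exists2 z, A' z & l m * z = 1.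
Proof.
move=> AA' B' M' nA'; apply: contrapT => nm; apply: nA'; apply: Amax => //.
split=> //; first exact: AA'.
move=> f; split=> [A'f|/Al/AA'//]; apply: contraT => /notin_vring[f0 mf].
case: nm; exists f^-1 => //; exists (l f) => //.
by rewrite fmorphV mulVf // fmorph_eq0.
Qed.

(** The powers of s = 1 - l m * a are 1 modulo l m A. If A[s^-1] were larger than
    A, it would contain an element z / s^r with f z = s^r for some f in the
    maximal ideal, which writes 1 as a combination of f and m. *)
Lemma one_sub_inv m a : maxideal m -> A a -> A (1 - l m * a)^-1.
Proof.
move=> mm Aa; set s := 1 - l m * a.
have s0 : s != 0 by rewrite subr_eq0 eq_sym maxideal_proper.
have As : A s by apply: AB => //; apply: AM => //; apply/Al/maxideal_in.
have powE r : exists2 b, A b & 1 - s ^+ r = l m * b.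
  elim: r => [|r [b Ab bE]]; first by exists 0; rewrite // expr0 subrr mulr0.
  exists (b + a * s ^+ r); first by apply: AD => //; apply: AM => //; apply: AX.
  by rewrite mulrDr -bE exprS /s; ring.
have [//|nA] := pselect (A s^-1).
have [|x y [n Ax] [k Ay]|x y [n Ax] [k Ay]||f mf [z [r Azr] fz]] :=
    @dominating_adjoin [set z | exists r, A (z * s ^+ r)].
- by move=> x Ax; exists 0%N; rewrite expr0 mulr1.
- exists (n + k)%N; have -> : (x - y) * s ^+ (n + k) = x * s ^+ n * s ^+ k - y * s ^+ k * s ^+ n.
    by rewrite exprD; ring.
  by apply: AB; apply: AM => //; apply: AX.
- exists (n + k)%N; have -> : (x * y) * s ^+ (n + k) = x * s ^+ n * (y * s ^+ k).
    by rewrite exprD; ring.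
  exact: AM.
- by move/(_ s^-1) => h; apply: nA; apply: h; exists 1%N; rewrite expr1 mulVf.
have [b Ab bE] := powE r; have /eqP[] := maxideal_add mm mf Ab Azr.
by rewrite -bE mulrA fz mul1r subrK.
Qed.

(** In [one_combination y n], 1 lies in the ideal that the maximal ideal of F
    generates in A[y], as a combination of powers of y up to n. *)
Definition one_combination y n := exists2 m, maxideal m &
  exists2 a : nat -> L, (forall i, A (a i)) & l m * (\sum_(i < n.+1) a i * y ^+ i) = 1.

Lemma one_combinationW y n k : (n <= k)%N -> one_combination y n -> one_combination y k.
Proof.
move=> nk [m mm [a Aa aE]]; exists m => //.
exists (fun i => if (i < n.+1)%N then a i else 0); first by move=> i; case: ifP.
rewrite -[RHS]aE (big_ord_widen k.+1 (fun i => a i * y ^+ i)) //.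
by congr (_ * _); rewrite [RHS]big_mkcond; apply: eq_bigr => i _; case: ifP; rewrite ?mul0r.
Qed.

(** The relation for y^-1, multiplied by y^(n+1) and divided by the unit
    1 - l m' * b 0, expresses y^(n+1) by smaller powers of y; this is substituted
    in the relation for y. *)
Lemma one_combination_reduce y n : y != 0 -> one_combination y n.+1 ->
  one_combination y^-1 n.+1 -> one_combination y n.
Proof.
move=> y0 [m mm [a Aa aE]] [m' mm' [b Ab bE]].
set s := 1 - l m' * b 0%N.
have s0 : s != 0 by rewrite subr_eq0 eq_sym maxideal_proper.
have Asi : A s^-1 by apply: one_sub_inv.
have Alm' : A (l m') by apply/Al/maxideal_in.
pose c i := s^-1 * b (n.+1 - i)%N.
have yE : y ^+ n.+1 = l m' * \sum_(i < n.+1) c i * y ^+ i.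
  apply: (mulfI s0); rewrite mulrCA mulr_sumr.
  have -> : s * y ^+ n.+1 = l m' * (\sum_(i < n.+1) b i.+1 * y^-1 ^+ i.+1) * y ^+ n.+1.
    congr (_ * _); move: bE; rewrite big_ord_recl expr0 mulr1 mulrDr => bE.
    by rewrite /s -bE addrAC subrr add0r.
  rewrite -mulrA mulr_suml; congr (_ * _).
  rewrite (reindex_inj rev_ord_inj) /=; apply: eq_bigr => i _.
  rewrite /c !mulrA mulfV // mul1r -mulrA subSS -subSn -1?ltnS //; congr (_ * _).
  have -> : y ^+ n.+1 = y ^+ (n.+1 - i) * y ^+ i by rewrite -exprD subnK // ltnW.
  by rewrite exprVn mulKf // expf_neq0.
exists m => //; exists (fun i => a i + a n.+1 * l m' * c i).
  by move=> i; apply: AD => //; rewrite /c; do ?apply: AM.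
rewrite -[RHS]aE [in RHS]big_ord_recr /= yE !mulrA; congr (_ * _).
under eq_bigr => i _ do rewrite mulrDl.
rewrite big_split /= mulr_sumr; congr (_ + _); apply: eq_bigr => i _.
by rewrite !mulrA.
Qed.

(** Descent on n + k, always shortening the longer one of the two relations. *)
Lemma one_combinationV y n k : y != 0 -> one_combination y n -> one_combination y^-1 k -> False.
Proof.
have [N] := ubnP (n + k); elim: N => // N IH in n k y *; rewrite ltnS => nkN y0.
wlog kn : n k y nkN y0 / (k <= n)%N.
  move=> hw yn yk; have [kn|/ltnW nk] := leqP k n; first exact: (hw n k y).
  by apply: (hw k n y^-1) => //; rewrite ?invr_eq0 ?invrK 1?addnC.
case: n => [|n] in nkN kn *.
  move=> [m mm [a Aa]]; rewrite big_ord1 expr0 mulr1 => aE _.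
  by have /eqP[] := maxideal_proper mm (Aa 0%N).
move=> yn yk; apply: (IH n k y) => //; apply: one_combination_reduce => //.
exact: one_combinationW yk.
Qed.

Lemma adjoin_one_combination y : ~ A y -> exists n, one_combination y n.
Proof.
move=> nAy; pose P (p : {poly L}) := forall i, A p`_i.
have [|_ _ [p Pp <-] [q Pq <-]|_ _ [p Pp <-] [q Pq <-]||m mm [_ [p Pp <-] pE]] :=
    @dominating_adjoin [set p.[y] | p in P].
- move=> x Ax; exists x%:P; rewrite ?hornerC // => i; rewrite coefC.
  by case: (i == 0%N).
- by exists (p - q); rewrite ?hornerD ?hornerN // => i; rewrite coefB; apply: AB.
- exists (p * q); rewrite ?hornerM // => i; rewrite coefM; apply: (big_ind A) => // j _.
  exact: AM.
- apply: contra_not nAy; apply; exists 'X; rewrite ?hornerX // => i.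
  by rewrite coefX; case: (i == 1%N).
exists (size p); exists m => //; exists (fun i => p`_i) => //.
by rewrite -[RHS]pE (@horner_coef_wide _ (size p).+1).
Qed.

Lemma maximal_dominating_total y : A y \/ A y^-1.
Proof.
have [|nAy] := pselect (A y); first by left.
have [|nAy'] := pselect (A y^-1); first by right.
have y0 : y != 0 by apply: contra_notN nAy => /eqP ->.
have [n yn] := adjoin_one_combination nAy; have [k yk] := adjoin_one_combination nAy'.
by case: (one_combinationV y0 yn yk).
Qed.

End Maximal.

Lemma dominating_bigcup (C : set (set L)) : C !=set0 -> C `<=` dominating ->
  total_on C subset -> dominating (\bigcup_(X in C) X).
Proof.
move=> [X CX] CD tot.
have two x y : (\bigcup_(X in C) X) x -> (\bigcup_(X in C) X) y ->
    exists Y, [/\ C Y, Y x & Y y].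
  move=> [Y CY Yx] [Z CZ Zy]; have [YZ|ZY] := tot _ _ CY CZ.
    by exists Z; split=> //; apply: YZ.
  by exists Y; split=> //; apply: ZY.
split.
- by exists X => //; have [] := CD _ CX.
- move=> x y xC yC; have [Y [CY Yx Yy]] := two x y xC yC.
  by exists Y => //; have [_ YB _ _] := CD _ CY; apply: YB.
- move=> x y xC yC; have [Y [CY Yx Yy]] := two x y xC yC.
  by exists Y => //; have [_ _ YM _] := CD _ CY; apply: YM.
- move=> f; split=> [[Y CY Yf]|fO].
    by have [_ _ _ Yl] := CD _ CY; apply/Yl.
  by exists X => //; have [_ _ _ Xl] := CD _ CX; apply/Xl.
Qed.

(** Chevalley's extension theorem: a maximal subring of L that meets F in its
    valuation ring is a valuation ring. *)
Theorem valuation_extends : exists om : valuation L, extends l w om.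
Proof.
have Fdom : dominating [set l f | f in [set f | in_vring w f]].
  have [O1 OB OM] := in_vring_subring_closed w.
  split.
  - by exists 1; rewrite ?rmorph1.
  - by move=> _ _ [f fO <-] [g gO <-]; exists (f - g); rewrite ?rmorphB //; exact: (OB _ _ fO gO).
  - by move=> _ _ [f fO <-] [g gO <-]; exists (f * g); rewrite ?rmorphM //; exact: (OM _ _ fO gO).
  - by move=> f; split=> [[g gO lgf]|fO]; [rewrite -(fmorph_inj l lgf) | exists f].
have [A [Adom _ Amax]] := Zorn_above Fdom dominating_bigcup.
have [A1 AB AM Al] := Adom.
pose P : {pred L} := fun x => `[< A x >].
have Psub : subring_closed P.
  split; first exact/asboolP.
    by move=> p q /asboolP Mp /asboolP Mq; apply/asboolP/AB.
  by move=> p q /asboolP Mp /asboolP Mq; apply/asboolP/AM.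
have Ptot x : x \in P \/ x^-1 \in P.
  by have [h|h] := maximal_dominating_total Adom Amax x; [left | right]; apply/asboolP.
exists (valuation_of_ring (ValuationRing Psub Ptot)) => f.
rewrite [RHS](in_vring_of_ring (ValuationRing Psub Ptot) (l f)).
by apply/idP/asboolP => /Al.
Qed.

End Chevalley.

Local Open Scope quotient_scope.

(** * A transcendental element over an algebraically closed field *)

Record ultrafilter := Ultrafilter {
  uf_sets :> set_system nat;
  ufP : UltraFilter uf_sets }.

Section Ultrapower.
Variables (C : closedFieldType) (U : ultrafilter).

Let UU : UltraFilter U := ufP U.
Local Instance uf_filter : ProperFilter U := @ultra_proper _ _ UU.

(** A maximal ideal of the ring of sequences, as U is an ultrafilter. *)
Definition almost_zero : {pred (nat -> C)} := fun f => `[< uf_sets U [set n | f n = 0] >].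

Fact almost_zero_idealr_closed : idealr_closed almost_zero.
Proof.
split.
- by apply/asboolP; apply: filterS filterT => n _.
- apply/asboolP => h; apply: (@filter_not_empty _ U _).
  by apply: filterS h => n /eqP; rewrite oner_eq0.
move=> a f g /asboolP f0 /asboolP g0; apply/asboolP; apply: filterS (filterI f0 g0).
by move=> n [/= fn gn]; rewrite /= addrfctE mulrfctE fn gn mulr0 addr0.
Qed.

HB.instance Definition _ := isIdealr.Build _ almost_zero almost_zero_idealr_closed.

Definition ultrapower := {ideal_quot almost_zero}.
HB.instance Definition _ := GRing.ComNzRing.on ultrapower.

Definition up_pi (f : nat -> C) : ultrapower := \pi_({ideal_quot almost_zero}) f.

Fact up_pi_zmod_morphism : zmod_morphism up_pi.
Proof. exact: (rmorphB (\pi_({ideal_quot almost_zero}))). Qed.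
Fact up_pi_monoid_morphism : monoid_morphism up_pi.
Proof. by split; [exact: rmorph1 | exact: rmorphM]. Qed.
HB.instance Definition _ :=
  GRing.isZmodMorphism.Build (nat -> C) ultrapower up_pi up_pi_zmod_morphism.
HB.instance Definition _ :=
  GRing.isMonoidMorphism.Build (nat -> C) ultrapower up_pi up_pi_monoid_morphism.

Lemma up_pi_eq f g : (up_pi f == up_pi g) = (f - g \in almost_zero).
Proof. by rewrite Quotient.idealrBE. Qed.

Lemma up_piP f g : up_pi f = up_pi g <-> uf_sets U [set n | f n = g n].
Proof.
split=> [/eqP|fg].
  by rewrite up_pi_eq => /asboolP; apply: filterS => n /= /subr0_eq.
apply/eqP; rewrite up_pi_eq; apply/asboolP; apply: filterS fg => n /= fgn.
by rewrite -[LHS]/(f n - g n) fgn subrr.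
Qed.

Lemma up_reprK (q : ultrapower) : up_pi (repr q) = q.
Proof. exact: reprK. Qed.

Definition up_inv (q : ultrapower) : ultrapower := up_pi (fun n => (repr q n)^-1).

Fact up_mulVf q : q != 0 -> up_inv q * q = 1.
Proof.
move=> q0; rewrite /up_inv -[q in _ * q]up_reprK -rmorphM -(rmorph1 up_pi).
apply/up_piP; have [qz|] := in_ultra_setVsetC [set n | repr q n = 0] UU.
  by case/eqP: q0; rewrite -[q]up_reprK -(rmorph0 up_pi); apply/up_piP.
by apply: filterS => n /= /eqP qn; rewrite mulrfctE mulVf.
Qed.

Fact up_inv0 : up_inv 0 = 0.
Proof.
rewrite /up_inv -[RHS](rmorph0 up_pi); apply/up_piP.
have /up_piP : up_pi (repr (0 : ultrapower)) = up_pi 0 by rewrite up_reprK rmorph0.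
by apply: filterS => n /= ->; apply: invr0.
Qed.

HB.instance Definition _ := GRing.ComNzRing_isField.Build ultrapower up_mulVf up_inv0.

(** Equations are solved at each index separately. *)
Fact up_closed : GRing.closed_field_axiom ultrapower.
Proof.
move=> n P n0; pose c k := fun i => repr (P i) k.
have root k : exists x, x ^+ n = \sum_(i < n) c k i * x ^+ i by exact: solve_monicpoly.
exists (up_pi (fun k => projT1 (cid (root k)))).
under eq_bigr => i _ do rewrite -[P i]up_reprK -rmorphXn -rmorphM.
rewrite -rmorph_sum -rmorphXn; apply/up_piP; apply: filterS filterT => k _ /=.
rewrite exprfctE fct_sumE; have := projT2 (cid (root k)) => /= ->.
by apply: eq_bigr => i _; rewrite mulrfctE exprfctE.
Qed.

HB.instance Definition _ := Field_isAlgClosed.Build ultrapower up_closed.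

Definition up_const (c : C) : ultrapower := up_pi (cst c).

Fact up_const_zmod_morphism : zmod_morphism up_const.
Proof. by move=> a b; rewrite -rmorphB. Qed.
Fact up_const_monoid_morphism : monoid_morphism up_const.
Proof. by split=> [|a b]; rewrite -?rmorphM // -(rmorph1 up_pi). Qed.
HB.instance Definition _ := GRing.isZmodMorphism.Build _ _ up_const up_const_zmod_morphism.
HB.instance Definition _ := GRing.isMonoidMorphism.Build _ _ up_const up_const_monoid_morphism.

Lemma up_horner (p : {poly C}) (f : nat -> C) :
  (map_poly up_const p).[up_pi f] = up_pi (fun n => p.[f n]).
Proof.
rewrite horner_coef size_map_poly.
under eq_bigr => i _ do rewrite coef_map /= /up_const -rmorphXn -rmorphM.
rewrite -rmorph_sum; congr up_pi; apply/funext => n; rewrite fct_sumE horner_coef.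
by apply: eq_bigr => i _; rewrite mulrfctE exprfctE.
Qed.

End Ultrapower.

(** The class of an injective sequence in the ultrapower along a free ultrafilter:
    a polynomial vanishes at finitely many entries of the sequence only. *)
Lemma closed_transcendental (C : closedFieldType) :
  exists (Om : closedFieldType) (d : {rmorphism C -> Om}) (xi : Om),
    forall p : {poly C}, p != 0 -> ~~ root (map_poly d p) xi.
Proof.
have [G [GU Goo]] := ultraFilterLemma eventually_filter.
pose U := Ultrafilter GU.
have fresh (s : seq C) : exists c, c \notin s.
  have /closed_nonrootP[c] : \prod_(a <- s) ('X - a%:P) != 0.
    by rewrite monic_neq0 // monic_prod_XsubC.
  by rewrite root_prod_XsubC; exists c.
pose next s := projT1 (cid (fresh s)).
pose pre n := iter n (fun s => rcons s (next s)) [::].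
pose f n := next (pre n).
have pre_mem m n : (m < n)%N -> f m \in pre n.
  elim: n => // n IH; rewrite ltnS leq_eqVlt /= mem_rcons in_cons => /orP[/eqP->|/IH->].
    by rewrite eqxx.
  by rewrite orbT.
have f_inj m n : (m < n)%N -> f m != f n.
  move=> mn; apply: contraTneq (pre_mem _ _ mn) => ->.
  exact: (projT2 (cid (fresh (pre n)))).
exists (ultrapower C U : closedFieldType), (@up_const C U), (@up_pi C U f) => p p0.
rewrite /root up_horner -(rmorph0 (@up_pi C U)); apply/eqP => /up_piP pf0.
have avoid (s : seq C) : exists N, forall n, (N <= n)%N -> f n \notin s.
  elim: s => [|a s [N sN]]; first by exists 0%N.
  have [[m fm]|nm] := pselect (exists m, f m = a); last first.
    exists N => n Nn; rewrite in_cons negb_or sN // andbT.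
    by apply/eqP => fn; apply: nm; exists n.
  exists (maxn N m.+1) => n; rewrite geq_max => /andP[Nn mn].
  by rewrite in_cons negb_or sN // andbT -fm eq_sym f_inj.
have [s sE] := closed_field_poly_normal p; have [N NP] := avoid s.
have GN : G [set n | (N <= n)%N] by apply: Goo; exists N.
have [n [/= /eqP pn /NP /negP]] := filter_ex (filterI pf0 GN); apply.
by move: pn; rewrite -[_ == _]/(root p (f n)) sE rootZ ?lead_coef_eq0 // root_prod_XsubC.
Qed.

Local Close Scope quotient_scope.
Local Close Scope classical_set_scope.

(** * Subfields as types *)

Record subfield (A : fieldType) := Subfield {
  sf_pred :> {pred A};
  sf_divring : divring_closed sf_pred }.

Section SubfieldType.
Variables (A : fieldType) (S : subfield A).

HB.instance Definition _ := GRing.isDivringClosed.Build A (sf_pred S) (sf_divring S).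

Record subfield_type := SubfieldElement { sf_val : A; _ : sf_val \in sf_pred S }.

HB.instance Definition _ := [isSub for sf_val].
HB.instance Definition _ := [Choice of subfield_type by <:].
HB.instance Definition _ := [SubChoice_isSubIntegralDomain of subfield_type by <:].
HB.instance Definition _ := [SubIntegralDomain_isSubField of subfield_type by <:].

Definition sf_inj : subfield_type -> A := val.
HB.instance Definition _ := GRing.RMorphism.on sf_inj.

Lemma sf_injP y : y \in sf_pred S -> exists c : subfield_type, sf_inj c = y.
Proof. by move=> Sy; exists (SubfieldElement Sy). Qed.

Lemma sf_inj_in (c : subfield_type) : sf_inj c \in sf_pred S.
Proof. exact: valP. Qed.

End SubfieldType.

Lemma sf_factor (K A : fieldType) (S : subfield A) (i : {rmorphism K -> A}) :
  (forall x, i x \in sf_pred S) ->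
  exists j : {rmorphism K -> subfield_type S}, forall x, sf_inj (j x) = i x.
Proof.
move=> iS; pose f x := SubfieldElement (iS x).
have fa : zmod_morphism f by move=> x y; apply: val_inj; rewrite /= rmorphB.
have fm : monoid_morphism f.
  by split=> [|x y]; apply: val_inj; rewrite /= ?rmorph1 ?rmorphM.
pose fA := GRing.isZmodMorphism.Build _ _ f fa.
pose fM := GRing.isMonoidMorphism.Build _ _ f fm.
by exists (HB.pack f fA fM : {rmorphism K -> subfield_type S}).
Qed.

Section AlgebraicClosure.
Variables (F : fieldType) (Om : closedFieldType) (l : {rmorphism F -> Om}).

Definition algebraic_elements : {pred Om} := fun y => `[< algebraicOver l y >].

Fact algebraic_elements_divring : divring_closed algebraic_elements.
Proof.
split; first exact/asboolP/algebraic1.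
  by move=> x y /asboolP ax /asboolP ay; apply/asboolP/algebraic_sub.
by move=> x y /asboolP ax /asboolP ay; apply/asboolP/algebraic_div.
Qed.

Let S := Subfield algebraic_elements_divring.

(** A root in Om of a monic polynomial with algebraic coefficients is algebraic. *)
Lemma algebraic_elements_closed : GRing.closed_field_axiom (subfield_type S).
Proof.
move=> n P n0; have [y yE] := solve_monicpoly (fun i => sf_inj (P i)) n0.
have Sy : y \in sf_pred S.
  apply/asboolP/integral_algebraic.
  pose p := 'X^n - \poly_(i < n) sf_inj (P i).
  have sp : (size (\poly_(i < n) sf_inj (P i)) < size ('X^n : {poly Om}))%N.
    by rewrite size_polyXn ltnS size_poly.
  apply: (@integral_root_monic _ _ _ _ p).
  - by rewrite monicE lead_coefDl ?size_polyN ?lead_coefXn.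
  - by rewrite /root hornerD hornerN hornerXn horner_poly yE subrr.
  apply/(integral_poly l) => k; apply/integral_algebraic; rewrite coefB coefXn coef_poly.
  apply: algebraic_sub; first by case: (k == n); [apply: algebraic1 | apply: algebraic0].
  by case: ifP => _; [apply/asboolP; exact: (sf_inj_in (P k)) | apply: algebraic0].
have [z zy] := sf_injP Sy; exists z; apply: (fmorph_inj (@sf_inj _ S)).
rewrite rmorphXn /= zy yE rmorph_sum; apply: eq_bigr => i _.
by rewrite rmorphM rmorphXn /= zy.
Qed.

Lemma algebraic_closure_in_closed :
  exists (Om' : closedFieldType) (l' : {rmorphism F -> Om'}), algebraic_extension l'.
Proof.
pose M := Field_isAlgClosed.Build (subfield_type S) algebraic_elements_closed.
pose Om' : closedFieldType := HB.pack (subfield_type S) M.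
have lS x : l x \in sf_pred S by apply/asboolP/algebraic_id.
have [l' l'E] := sf_factor lS; exists Om', l' => y.
have /asboolP[p p0 py] := sf_inj_in y; exists p => //.
rewrite /root -(fmorph_eq0 (@sf_inj _ S)) -horner_map -map_poly_comp.
by rewrite (eq_map_poly (_ : _ =1 l)) // => x; apply: l'E.
Qed.

End AlgebraicClosure.

(** * Extension of embeddings *)

Section TrivialValuation.
Variable K : fieldType.

Definition trivial_map (x : K) : option int := if x == 0 then None else Some 0.

Fact int_ordered : ordered_abelian_group int.
Proof. by split=> [x y|g x y]; [apply: le_total | rewrite Num.Theory.lerD2l]. Qed.

Fact trivial_eq0 x : (trivial_map x == None) = (x == 0).
Proof. by rewrite /trivial_map; case: (x == 0). Qed.

Fact trivialM x y : trivial_map (x * y) = vadd (trivial_map x) (trivial_map y).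
Proof. by rewrite /trivial_map mulf_eq0; case: (x == 0); case: (y == 0). Qed.

Fact trivialD x y : vle (vmin (trivial_map x) (trivial_map y)) (trivial_map (x + y)).
Proof.
rewrite /trivial_map; case: (eqVneq x 0) => [->|_]; case: (eqVneq y 0) => [->|_];
  by rewrite ?addr0 ?add0r ?eqxx //; case: ifP.
Qed.

(** All embeddings of fields preserve trivial valuations, so that results on
    embeddings that preserve values specialize to arbitrary embeddings. *)
Definition trivial_valuation := Valuation int_ordered trivial_eq0 trivialM trivialD.
End TrivialValuation.

Theorem extend_to_algebraic (A : fieldType) (Om : closedFieldType) (B : comNzRingType)
    (j0 : {rmorphism B -> A}) (t0 : {rmorphism B -> Om}) :
  (forall b, (j0 b == 0) = (t0 b == 0)) ->
  (forall y : A, exists2 p : {poly B}, map_poly j0 p != 0 & root (map_poly j0 p) y) ->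
  exists t : {rmorphism A -> Om}, forall b, t (j0 b) = t0 b.
Proof.
move=> jt algA; pose phi (g : vgroup (trivial_valuation A)) : vgroup (trivial_valuation Om) := g.
have tv b : trivial_valuation Om (t0 b) = omap phi (trivial_valuation A (j0 b)).
  by rewrite /= /trivial_map -jt; case: (j0 b == 0).
have phiD : {morph phi : g h / g + h} by [].
have phi_le : {mono phi : g h / g <= h} by [].
by have [t [tj _]] := extend_embedding phiD phi_le tv algA; exists t.
Qed.

Definition evaluation (N L : fieldType) (f : {rmorphism N -> L}) (x : L) :
  {rmorphism {poly N} -> L} := horner_eval x \o map_poly f.

Lemma evaluationC (N L : fieldType) (f : {rmorphism N -> L}) x c :
  evaluation f x c%:P = f c.
Proof. by rewrite /= /horner_eval map_polyC hornerC. Qed.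

Lemma evaluationX (N L : fieldType) (f : {rmorphism N -> L}) x :
  evaluation f x 'X = x.
Proof. by rewrite /= /horner_eval map_polyX hornerX. Qed.

Lemma evaluationXsubC (N L : fieldType) (f : {rmorphism N -> L}) x c :
  evaluation f x ('X - c%:P) = x - f c.
Proof. by rewrite /= /horner_eval map_polyXsubC hornerXsubC. Qed.

Lemma evaluation_algebraic (N A : fieldType) (j : {rmorphism N -> A}) (x y : A) :
  algebraicOver j y ->
  exists2 p : {poly {poly N}}, map_poly (evaluation j x) p != 0 &
    root (map_poly (evaluation j x) p) y.
Proof.
move=> [p p0 py]; have pE : map_poly (evaluation j x) (map_poly polyC p) = map_poly j p.
  by rewrite -map_poly_comp; apply: eq_map_poly => c; apply: evaluationC.
by exists (map_poly polyC p); rewrite pE // map_poly_eq0.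
Qed.

(** The case of [extend_to_algebraic] where B is the polynomial ring over N and
    the indeterminate goes to y and to z. *)
Lemma extend_conjugate (N A : fieldType) (Om : closedFieldType)
    (j : {rmorphism N -> A}) (t : {rmorphism N -> Om}) (y : A) (z : Om) :
  algebraic_extension j ->
  (forall q : {poly N}, root (map_poly j q) y = root (map_poly t q) z) ->
  exists s : {rmorphism A -> Om}, s y = z /\ forall c, s (j c) = t c.
Proof.
move=> algj yz.
have [q|b|s sE] := @extend_to_algebraic A Om {poly N} (evaluation j y) (evaluation t z).
- exact: yz.
- exact: evaluation_algebraic.
exists s; split=> [|c]; first by rewrite -(evaluationX j y) sE evaluationX.
by rewrite -(evaluationC j y) sE evaluationC.
Qed.

(** * Rational function fields *)

Lemma rational_function (K F : fieldType) (i : {rmorphism K -> F}) (x : F) :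
  ~ algebraicOver i x -> (forall y : F, generated i (fun z => z = x) y) ->
  forall y, exists p q : {poly K}, q != 0 /\ y = (map_poly i p).[x] / (map_poly i q).[x].
Proof.
move=> trx gen y.
pose P : {pred F} := fun y => `[< exists p q : {poly K},
  q != 0 /\ y = (map_poly i p).[x] / (map_poly i q).[x] >].
have nz q : q != 0 -> (map_poly i q).[x] != 0.
  by move=> q0; apply/negP => qx; apply: trx; exists q.
have in1 p : (map_poly i p).[x] \in P.
  by apply/asboolP; exists p, 1; rewrite oner_neq0 rmorph1 hornerC divr1.
suff : y \in P by move/asboolP.
apply: gen => [|a|_ ->]; last first.
- by have := in1 'X; rewrite map_polyX hornerX.
- by have := in1 a%:P; rewrite map_polyC hornerC.
split; first by have := in1 1; rewrite rmorph1 hornerC.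
  move=> _ _ /asboolP[p [q [q0 ->]]] /asboolP[r [s [s0 ->]]]; apply/asboolP.
  exists (p * s - r * q), (q * s); rewrite mulf_neq0 //; split=> //.
  by rewrite rmorphB !rmorphM hornerD hornerN !hornerM -mulNr addf_div ?nz // mulNr.
move=> _ _ /asboolP[p [q [q0 ->]]] /asboolP[r [s [s0 ->]]]; apply/asboolP.
have [->|r0] := eqVneq r 0.
  by exists 0, 1; rewrite oner_neq0 !rmorph0 horner0 !(mul0r, invr0, mulr0).
exists (p * s), (q * r); rewrite mulf_neq0 //; split=> //.
by rewrite !rmorphM !hornerM invf_div mulf_div.
Qed.

Lemma rational_common_denominator (K F : fieldType) (i : {rmorphism K -> F}) (x : F)
    (f : nat -> F) n :
  (forall y, exists p q : {poly K}, q != 0 /\ y = (map_poly i p).[x] / (map_poly i q).[x]) ->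
  ~ algebraicOver i x ->
  exists q : {poly K}, q != 0 /\ forall k, (k < n)%N ->
    exists r : {poly K}, f k * (map_poly i q).[x] = (map_poly i r).[x].
Proof.
move=> rat trx; have nz q : q != 0 -> (map_poly i q).[x] != 0.
  by move=> q0; apply/negP => qx; apply: trx; exists q.
elim: n => [|n [q [q0 qf]]]; first by exists 1; rewrite oner_neq0.
have [p [d [d0 fn]]] := rat (f n); exists (q * d); rewrite mulf_neq0 //; split=> // k.
rewrite ltnS leq_eqVlt => /orP[/eqP->|/qf[r rE]].
  by exists (q * p); rewrite !rmorphM !hornerM fn mulrCA divfK // nz.
by exists (r * d); rewrite !rmorphM !hornerM mulrA rE.
Qed.

(** F embeds in Om because x and xi are both transcendental; the elements of Om
    that are algebraic over F form an algebraically closed field. *)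
Lemma rational_function_closure (K F : fieldType) (Om : closedFieldType)
    (i : {rmorphism K -> F}) (x : F) (d : {rmorphism K -> Om}) (xi : Om) :
  ~ algebraicOver i x -> (forall y : F, generated i (fun z => z = x) y) ->
  ~ algebraicOver d xi ->
  exists (Om' : closedFieldType) (l : {rmorphism F -> Om'}), algebraic_extension l.
Proof.
move=> trx gen trxi; have ratF := rational_function trx gen.
have nz (L : fieldType) (f : {rmorphism K -> L}) z q : ~ algebraicOver f z ->
    (evaluation f z q == 0) = (q == 0).
  move=> trz; have [->|q0] := eqVneq q 0; first by rewrite rmorph0 eqxx.
  by apply/negP => qz; apply: trz; exists q.
have [p|y|l _] := @extend_to_algebraic F Om {poly K} (evaluation i x) (evaluation d xi).
- by rewrite !nz.
- have [p [q [q0 yE]]] := ratF y; pose r : {poly {poly K}} := q *: 'X - p%:P.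
  have rE : map_poly (evaluation i x) r = evaluation i x q *: 'X - (evaluation i x p)%:P.
    by rewrite rmorphB /= map_polyZ map_polyX map_polyC.
  exists r; rewrite rE.
    apply/eqP => /polyP/(_ 1%N); rewrite coefB coefZ coefX coefC /= mulr1 subr0 coef0.
    by move/eqP; rewrite nz // (negPf q0).
  rewrite /root hornerD hornerN hornerZ hornerX hornerC yE mulrC divfK ?subrr //.
  by rewrite nz.
exact: (algebraic_closure_in_closed l).
Qed.

(** * Separability *)

Section IrreducibleRoots.
Variables (N A : fieldType) (j : {rmorphism N -> A}).

(** Up to a constant f is the minimal polynomial of y, which divides it. *)
Lemma irreducible_root (f : {poly N}) y q : irreducible_poly f ->
  root (map_poly j f) y -> root (map_poly j q) y = (f %| q).
Proof.
move=> firr fy; have f0 : f != 0 by apply/eqP => f0; have := firr.1; rewrite f0 size_poly0.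
have [g [gm girr gy gdiv]] : exists g : {poly N}, [/\ g \is monic, irreducible_poly g,
    root (map_poly j g) y & forall q, root (map_poly j q) y = (g %| q)].
  by apply: minimal_polynomial; exists f; rewrite ?map_poly_eq0.
have gf : g %| f by rewrite -gdiv.
have [g1 _] := girr; have /eqp_dvdl <- := firr.2 g (negbT (gtn_eqF g1)) gf.
exact: gdiv.
Qed.

Lemma root_linear (g : {poly N}) y : size g = 2 -> root (map_poly j g) y ->
  exists c, y = j c.
Proof.
move=> sg gy; have g1 : g`_1 != 0.
  have <- : lead_coef g = g`_1 by rewrite lead_coefE sg.
  by rewrite lead_coef_eq0 -size_poly_gt0 sg.
exists (- g`_0 / g`_1); move: gy; rewrite /root horner_coef size_map_poly sg.
rewrite big_ord_recl big_ord1 !coef_map expr0 mulr1 expr1 /= addrC addr_eq0 => /eqP yE.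
by rewrite fmorph_div rmorphN -yE mulrC mulKf // fmorph_eq0.
Qed.

(** The minimal polynomial of y is a power of 'X - y%:P, and having no square
    factor it is linear. *)
Lemma separable_purely_inseparable y (h : {poly N}) n :
  separable_over j y -> map_poly j h = ('X - y%:P) ^+ n.+1 -> exists c, y = j c.
Proof.
move=> [g [girr gsep gy]] hE.
have : g %| h by rewrite -(irreducible_root _ girr gy) hE root_exp_XsubC eqxx.
rewrite -(dvdp_map j) hE => /dvdp_exp_XsubCP[k _ gk].
have k1 : (k <= 1)%N.
  rewrite leqNgt; apply/negP => k1.
  have := separable_nosquare (u := 'X - y%:P) (etrans (separable_map j g) gsep) k1.
  by rewrite size_XsubC (eqp_dvdr _ gk) dvdpp; move/(_ isT).
have sg : size g = k.+1 by rewrite -(size_map_poly j) (eqp_size gk) size_exp_XsubC.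
apply: (@root_linear g) => //; have := girr.1; rewrite sg.
by case: (k) k1 => [|[|]].
Qed.

End IrreducibleRoots.

Lemma separable_tower (K M A : fieldType) (i : {rmorphism K -> M}) (j : {rmorphism M -> A})
    (ij : {rmorphism K -> A}) y : j \o i =1 ij -> separable_over ij y -> separable_over j y.
Proof.
move=> jiE [f [firr fsep fy]].
have f0 : f != 0 by apply: separable_poly_neq0.
have fE : map_poly j (map_poly i f) = map_poly ij f.
  by rewrite -map_poly_comp; apply: eq_map_poly.
have [|g [gm girr gy gdiv]] := @minimal_polynomial M A j y.
  by exists (map_poly i f); rewrite ?map_poly_eq0 ?fE.
exists g; split=> //; apply: (@dvdp_separable _ (map_poly i f)); first by rewrite -gdiv fE.
by rewrite separable_map.
Qed.

(** The minimal polynomial of y is not linear and has distinct roots, so that y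
    has another conjugate. *)
Lemma separable_moved (M : fieldType) (C : closedFieldType) (m : {rmorphism M -> C}) y :
  algebraic_extension m -> separable_over m y -> ~ (exists c, y = m c) ->
  exists s : {rmorphism C -> C}, s y <> y /\ forall c, s (m c) = m c.
Proof.
move=> algm [f [firr fsep fy]] yM.
have [h hE] := factor_theorem _ _ fy.
have h0 : h != 0.
  apply: contraTneq fsep => h0; apply: contraTN isT => /separable_poly_neq0.
  by rewrite -(map_poly_eq0 m) hE h0 mul0r eqxx.
have : size h != 1.
  apply/eqP => sh; apply: yM; apply: (@root_linear _ _ m f) => //.
  by rewrite -(size_map_poly m) hE size_Mmonic ?monicXsubC // sh size_XsubC.
move=> /closed_rootP[z hz].
have fz : root (map_poly m f) z by rewrite hE rootM hz.
have zy : z <> y.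
  move=> zy; have := etrans (separable_map m f) fsep.
  by rewrite hE separable_root -zy hz andbF.
have [q|s [sy sm]] := @extend_conjugate M C C m m y z algm.
  by rewrite (irreducible_root q firr fy) (irreducible_root q firr fz).
by exists s; rewrite sy.
Qed.

(** * Degrees *)

Lemma degree_le (K L : fieldType) (i : {rmorphism K -> L}) n m (b : 'I_n -> L) (e : 'I_m -> L) :
  (forall y, exists c : {ffun 'I_n -> K}, y = \sum_k i (c k) * b k) ->
  (forall c c' : {ffun 'I_m -> K}, \sum_k i (c k) * e k = \sum_k i (c' k) * e k -> c = c') ->
  (m <= n)%N.
Proof.
move=> bspan efree; rewrite leqNgt; apply/negP => nm.
pose D : 'M[K]_(m, n) := \matrix_(k, l) projT1 (cid (bspan (e k))) l.
have eE k : e k = \sum_l i (D k l) * b l.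
  rewrite {1}(projT2 (cid (bspan (e k)))); apply: eq_bigr => l _; rewrite mxE //.
have : ~~ row_free D by rewrite /row_free neq_ltn (leq_ltn_trans (rank_leq_col D) nm).
rewrite -kermx_eq0 => /rowV0Pn[r /sub_kermxP rD /negP]; apply; apply/eqP/rowP => k.
suff /ffunP/(_ k) : [ffun k => r 0 k] = [ffun => 0 : K] by rewrite !ffunE mxE.
apply: efree; rewrite [RHS]big1 => [|l _]; last by rewrite ffunE rmorph0 mul0r.
under eq_bigr => l _ do rewrite ffunE eE mulr_sumr.
rewrite exchange_big big1 //= => l _; have /rowP/(_ l) := rD; rewrite !mxE => rDl.
transitivity (i (\sum_k r 0 k * D k l) * b l); last by rewrite rDl rmorph0 mul0r.
by rewrite rmorph_sum mulr_suml; apply: eq_bigr => a _; rewrite rmorphM mulrA.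
Qed.

Lemma degree_unique (K L : fieldType) (i : {rmorphism K -> L}) n m :
  degree i n -> degree i m -> n = m.
Proof.
move=> [b bP] [e eP].
have span d (a : 'I_d -> L) : (forall y, exists! c : {ffun 'I_d -> K}, y = \sum_k i (c k) * a k) ->
    forall y, exists c : {ffun 'I_d -> K}, y = \sum_k i (c k) * a k.
  by move=> aP y; have [c [cE _]] := aP y; exists c.
have free d (a : 'I_d -> L) : (forall y, exists! c : {ffun 'I_d -> K}, y = \sum_k i (c k) * a k) ->
    forall c c' : {ffun 'I_d -> K}, \sum_k i (c k) * a k = \sum_k i (c' k) * a k -> c = c'.
  move=> aP c c' cc'; have [z [_ zu]] := aP (\sum_k i (c k) * a k).
  by rewrite -(zu c erefl) (zu c' cc').
apply/eqP; rewrite eqn_leq.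
rewrite (degree_le (span _ _ eP) (free _ _ bP)).
exact: (degree_le (span _ _ bP) (free _ _ eP)).
Qed.

Lemma degree1 (K L : fieldType) (i : {rmorphism K -> L}) :
  (forall y, exists c, y = i c) -> degree i 1.
Proof.
move=> isurj; exists (fun=> 1) => y; have [c yc] := isurj y.
exists [ffun=> c]; split=> [|c']; first by rewrite big_ord1 ffunE mulr1.
rewrite big_ord1 mulr1 yc => /fmorph_inj cc'; apply/ffunP => k.
by rewrite ord1 ffunE cc'.
Qed.

(** The polynomials in y form a field: a polynomial that does not vanish at y is
    coprime to f, hence invertible modulo f by a Bezout relation. *)
Lemma simple_extension (K A : fieldType) (i : {rmorphism K -> A}) (y : A) (f : {poly K}) :
    irreducible_poly f -> root (map_poly i f) y ->
  exists (E : fieldType) (j : {rmorphism K -> E}) (k : {rmorphism E -> A}),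
    [/\ k \o j =1 i, exists z, k z = y, degree j (size f).-1 &
        forall z, exists q : {poly K}, k z = (map_poly i q).[y]].
Proof.
move=> firr fy; have f0 : f != 0 by apply/eqP => f0; have := firr.1; rewrite f0 size_poly0.
pose P : {pred A} := fun z => `[< exists q : {poly K}, z = (map_poly i q).[y] >].
have divP q : ((map_poly i q).[y] == 0) = (f %| q) by apply: irreducible_root.
have Pdiv : divring_closed P.
  split; first by apply/asboolP; exists 1; rewrite rmorph1 hornerC.
    move=> _ _ /asboolP[q ->] /asboolP[r ->]; apply/asboolP; exists (q - r).
    by rewrite rmorphB hornerD hornerN.
  move=> _ _ /asboolP[q ->] /asboolP[r ->]; apply/asboolP.
  have [/eqP|r0] := boolP ((map_poly i r).[y] == 0).
    by move=> ->; exists 0; rewrite rmorph0 horner0 invr0 mulr0.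
  have cop : coprimep f r.
    rewrite /coprimep; apply: contraR r0 => g1.
    have /eqp_dvdl := firr.2 _ g1 (dvdp_gcdl f r).
    by rewrite divP => <-; apply: dvdp_gcdr.
  have /Bezout_eq1_coprimepP[[a b] /= ab] := cop.
  exists (q * b); rewrite rmorphM hornerM; congr (_ * _).
  apply: (mulIf r0); rewrite mulVf // -hornerM -rmorphM.
  have -> : b * r = 1 - a * f by rewrite -ab addrAC subrr add0r.
  rewrite rmorphB rmorph1 hornerD hornerN hornerC rmorphM hornerM (eqP fy).
  by rewrite mulr0 subr0.
pose S := Subfield Pdiv.
have iS x : i x \in sf_pred S.
  by apply/asboolP; exists x%:P; rewrite map_polyC hornerC.
have [j jE] := sf_factor iS.
have yS : y \in sf_pred S by apply/asboolP; exists 'X; rewrite map_polyX hornerX.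
have [yE yEE] := sf_injP yS.
exists (subfield_type S), j, (@sf_inj _ S); split.
- exact: jE.
- by exists yE.
- pose d := (size f).-1; have sf : size f = d.+1 by rewrite prednK // size_poly_gt0.
  exists (fun k : 'I_d => yE ^+ k) => z.
  have sumE (c : {ffun 'I_d -> K}) : sf_inj (\sum_k j (c k) * yE ^+ k) =
      (map_poly i (\sum_k c k *: 'X^k)).[y].
    rewrite (rmorph_sum (@sf_inj _ S)) rmorph_sum horner_sum; apply: eq_bigr => k _.
    rewrite /= map_polyZ map_polyXn hornerZ hornerXn.
    by rewrite (rmorphM (@sf_inj _ S)) (rmorphXn (@sf_inj _ S)) /= yEE jE.
  have := sf_inj_in z => /asboolP[q zq]; pose r := q %% f.
  have zr : sf_inj z = (map_poly i r).[y].
    rewrite zq {1}(divp_eq q f) rmorphD rmorphM hornerD hornerM (eqP fy).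
    by rewrite mulr0 add0r.
  have sr : (size r <= d)%N by rewrite -ltnS -sf ltn_modp.
  exists [ffun k : 'I_d => r`_k]; split=> [|c zc].
    apply: (fmorph_inj (@sf_inj _ S)); rewrite /= sumE zr; congr (map_poly i _).[_].
    rewrite -[LHS]coefK poly_def (big_ord_widen d (fun k => r`_k *: 'X^k)) // big_mkcond.
    apply: eq_bigr => k _; rewrite ffunE; case: ltnP => // rk.
    by rewrite nth_default // scale0r.
  pose g := \sum_k c k *: 'X^k.
  have gE (k : 'I_d) : g`_k = c k.
    rewrite coef_sum (bigD1 k) //= coefZ coefXn eqxx mulr1 big1 ?addr0 // => l lk.
    by rewrite coefZ coefXn eq_sym (negPf lk : (l == k :> nat) = false) mulr0.
  suff rg : r = g by apply/ffunP => k; rewrite ffunE rg gE.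
  apply/eqP; rewrite -subr_eq0.
  have sg : (size g <= d)%N.
    apply: (leq_trans (size_sum _ _ _)); apply/bigmax_leqP => l _.
    by apply: (leq_trans (size_scale_leq _ _)); rewrite size_polyXn.
  apply: contraT => rg0; have : f %| r - g.
    by rewrite -divP rmorphB hornerD hornerN -zr zc sumE subrr.
  move/(dvdp_leq rg0); rewrite sf leqNgt ltnS.
  by rewrite (leq_trans (size_polyD _ _)) // geq_max sr size_polyN.
- by move=> z; have /asboolP := sf_inj_in z.
Qed.

(** * Tame fields are perfect *)

Lemma expr_pB (R : comNzRingType) p (cR : p \in [pchar R]) (a b : R) :
  (a - b) ^+ p = a ^+ p - b ^+ p.
Proof. by rewrite -!(pFrobenius_autE cR) rmorphB. Qed.

Lemma expr_p_horner (K A : fieldType) (i : {rmorphism K -> A}) p (cK : p \in [pchar K])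
    (q : {poly K}) b c : b ^+ p = i c -> exists d, (map_poly i q).[b] ^+ p = i d.
Proof.
move=> bc; have cA : p \in [pchar A] by rewrite (fmorph_pchar i).
exists (\sum_(k < size q) q`_k ^+ p * c ^+ k).
rewrite horner_coef size_map_poly -(pFrobenius_autE cA) rmorph_sum [RHS]rmorph_sum.
apply: eq_bigr => k _; rewrite /= pFrobenius_autE exprMn -exprM mulnC exprM bc.
by rewrite coef_map rmorphM !rmorphXn.
Qed.

Lemma map_XnsubC (K A : fieldType) (i : {rmorphism K -> A}) p (cK : p \in [pchar K])
    (a : K) (b : A) : b ^+ p = i a -> map_poly i ('X^p - a%:P) = ('X - b%:P) ^+ p.
Proof.
move=> ba; have cA : p \in [pchar {poly A}] by rewrite pchar_poly (fmorph_pchar i).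
by rewrite (expr_pB cA) rmorphB /= map_polyXn map_polyC /= -ba rmorphXn.
Qed.

Lemma irreducible_separable (K : fieldType) (f : {poly K}) :
  irreducible_poly f -> f^`() != 0 -> separable_poly f.
Proof.
move=> [f1 firr] df0; rewrite unlock; apply: contraT => g1.
have f0 : f != 0 by rewrite -size_poly_gt0 ltnW.
have := dvdp_gcdr f f^`(); rewrite (eqp_dvdl _ (firr _ g1 (dvdp_gcdl f f^`()))).
by move/(dvdp_leq df0); rewrite leqNgt lt_size_deriv.
Qed.

Section TamePerfect.
Variables (K : fieldType) (C : closedFieldType) (i : {rmorphism K -> C}) (w : valuation C).
Hypothesis tameK : tame_extension i w.

(** For b outside K with b^p = a in K, the extension K(b) has degree divisible by
    p. All of its elements have their p-th powers in K, so its residue field is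
    purely inseparable over that of K; tameness makes it separable too, hence
    trivial, and the degree is the ramification index, which p does not divide. *)
Lemma tame_pth_root p (cK : p \in [pchar K]) (a : K) : exists c, a = c ^+ p.
Proof.
have p_pr := pcharf_prime cK.
have [b ba] : exists b, b ^+ p = i a.
  have [|b] := @closed_rootP C ('X^p - (i a)%:P) _.
    by rewrite size_XnsubC ?prime_gt0 // eqSS -lt0n prime_gt0.
  by rewrite /root hornerD hornerN hornerXn hornerC subr_eq0 => /eqP; exists b.
have [[c bc]|bK] := pselect (exists c, b = i c).
  by exists c; apply: (fmorph_inj i); rewrite rmorphXn /= -bc.
have [algK _ finK] := tameK; exfalso.
have [f [fm firr fb fdiv]] := minimal_polynomial (algK b).
have f0 := monic_neq0 fm; pose n := (size f).-1.
have sf : size f = n.+1 by rewrite prednK // size_poly_gt0.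
have n0 : (0 < n)%N by have := firr.1; rewrite sf; case: (n).
have pn : (p %| n)%N.
  rewrite (dvdn_pcharf cK); apply/negP => /negP nn; apply: bK.
  apply: (@separable_purely_inseparable _ _ i _ ('X^p - a%:P) p.-1); last first.
    by rewrite prednK ?prime_gt0 // (map_XnsubC cK ba).
  exists f; split=> //; apply: irreducible_separable => //.
  apply: contraNneq nn => /polyP/(_ n.-1); rewrite coef_deriv coef0 prednK //.
  by rewrite -[n in f`_n]/((size f).-1) -lead_coefE (monicP fm) => ->.
have [E [j [k [kj _ degj Eq]]]] := simple_extension firr fb.
have [e [g [_ degg epn sepE nE]]] := finK E j k n kj degj.
have cE : p \in [pchar E] by rewrite (fmorph_pchar j).
set u := restrict k w in degg epn sepE *.
have cR : p \in [pchar (residue (restrict j u))].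
  rewrite inE p_pr /= -(rmorph_nat (@residue_pi _ (restrict j u))) -(rmorph0 (@residue_pi _ (restrict j u))).
  by apply/eqP; congr residue_pi; apply: val_inj; rewrite rmorph_nat /= pcharf0.
have resK y : exists c, y = @residue_map _ _ j u c.
  rewrite -[y]residue_piK; move: (repr y) => z.
  have [q zq] := Eq (val z); have [d zd] := expr_p_horner cK q ba.
  have jd : val z ^+ p = j d.
    by apply: (fmorph_inj k); rewrite rmorphXn /= zq zd; apply/esym/kj.
  have dO : d \in in_vring (restrict j u).
    rewrite unfold_in /in_vring /= -jd.
    by have -> : val z ^+ p = val (z ^+ p); [rewrite rmorphXn | exact: (valP (z ^+ p))].
  apply: (@separable_purely_inseparable _ _ (@residue_map _ _ j u) _ ('X^p - (residue_pi (VRing dO))%:P) p.-1).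
    exact: sepE.
  rewrite prednK ?prime_gt0 //; apply: map_XnsubC => //.
  rewrite -rmorphXn /= residue_map_pi; congr residue_pi; apply: val_inj.
  by rewrite rmorphXn /= jd.
have g1 : g = 1%N by apply: (degree_unique degg); apply: degree1.
by have := epn _ cR; rewrite -[e]muln1 -g1 -nE pn.
Qed.

(** A minimal polynomial with zero derivative would be a polynomial in 'X^p, and
    taking p-th roots of its coefficients would make it a p-th power. *)
Theorem tame_separable y : separable_over i y.
Proof.
have [algK _ _] := tameK.
have [f [fm firr fy fdiv]] := minimal_polynomial (algK y).
have f0 := monic_neq0 fm; have f1 := firr.1.
exists f; split=> //; apply: irreducible_separable => //; apply/eqP => df0.
exfalso; pose n := (size f).-1.
have sf : size f = n.+1 by rewrite prednK // size_poly_gt0.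
have n0 : (0 < n)%N by move: f1; rewrite sf.
have [p cK] : exists p, p \in [pchar K].
  apply: (@natf0_pchar _ n) => //; have /polyP/(_ n.-1) := df0.
  rewrite coef_deriv coef0 prednK // -[n in f`_n]/((size f).-1) -lead_coefE (monicP fm).
  by move=> /eqP.
have p_pr := pcharf_prime cK; have p_gt0 := prime_gt0 p_pr.
have fdvd k : f`_k != 0 -> (p %| k)%N.
  move=> fk; rewrite (dvdn_pcharf cK); case: k fk => [|k] fk; first by rewrite eqxx.
  have : f`_k.+1 * k.+1%:R = 0 by rewrite mulr_natr -coef_deriv df0 coef0.
  by move/eqP; rewrite mulf_eq0 (negPf fk).
have root_p k := projT2 (cid (tame_pth_root cK f`_k)).
pose r k := projT1 (cid (tame_pth_root cK f`_k)).
pose h := \sum_(k < n.+1) r (k * p)%N *: 'X^k.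
have cP : p \in [pchar {poly K}] by rewrite pchar_poly.
have hE : h ^+ p = f.
  rewrite -(pFrobenius_autE cP) rmorph_sum /=.
  under eq_bigr => k _ do rewrite pFrobenius_autE exprZn -root_p -exprM.
  apply/polyP => k; rewrite coef_sum.
  under eq_bigr => l _ do rewrite coefZ coefXn.
  have [pk|npk] := boolP (p %| k)%N; last first.
    rewrite big1 => [|l _]; first by apply/esym/eqP; apply: contraNT npk; apply: fdvd.
    by case: eqP => [kl|_]; rewrite ?mulr0 //; case/negP: npk; rewrite kl dvdn_mull.
  have /dvdnP[l kl] := pk; have [ln|nl] := ltnP l n.+1.
    rewrite (bigD1 (Ordinal ln)) //= kl eqxx mulr1 big1 ?addr0 // => m ml.
    by rewrite eqn_pmul2r // eq_sym (negPf ml : (m == l :> nat) = false) mulr0.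
  rewrite big1 => [|m _].
    rewrite nth_default // sf kl (leq_trans nl) // leq_pmulr //.
  case: eqP => [klm|]; rewrite ?mulr0 //.
  have : (l <= m)%N by rewrite -(leq_pmul2r p_gt0) -klm kl.
  by rewrite leqNgt (leq_trans (ltn_ord m)).
have h0 : h != 0 by apply: contraTneq f1 => h0; rewrite -hE h0 expr0n gtn_eqF // size_poly0.
have sh : (size f).-1 = (p * (size h).-1)%N by rewrite -hE size_exp mulnC.
have hf : h %| f by rewrite -hE -[p]prednK // exprS dvdp_mulr.
have h1 : size h != 1.
  by apply/eqP => h1; move: sh n0; rewrite h1 muln0 /n => ->.
have /eqp_size shf := firr.2 _ h1 hf.
move: sh; rewrite shf sf /= -{1}[n]mul1n => /eqP; rewrite eqn_pmul2r // => /eqP p1.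
by move: p_pr; rewrite -p1.
Qed.

End TamePerfect.

(** * Galois theory *)

(** Dedekind's argument: given a relation with c a != 0 and some b != a, choose x
    on which sg a and sg b differ, replace y by x * y and subtract sg a x times
    the relation. The result lacks the index a, so by induction on the number of
    nonzero coefficients it is trivial, and c b = 0. *)
Lemma embeddings_independent (N D : fieldType) n (sg : 'I_n -> {rmorphism N -> D})
    (c : 'I_n -> D) :
  (forall a b, a != b -> exists y, sg a y != sg b y) ->
  (forall y, \sum_a c a * sg a y = 0) -> forall a, c a = 0.
Proof.
move=> dist; have [m] := ubnP #|[pred a | c a != 0]|.
elim: m c => // m IH c; rewrite ltnS => cm sum0 a; apply/eqP; apply: contraT => ca.
have c0 b : b != a -> c b = 0.
  move=> ba; have [x xab] := dist _ _ ba.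
  pose c' e := c e * (sg e x - sg a x).
  have c'0 : forall e, c' e = 0.
    apply: IH => [|y].
      apply: leq_trans cm; apply: proper_card; apply/fintype.properP; split.
        by apply/fintype.subsetP => e; rewrite !inE /c' mulf_eq0 negb_or => /andP[].
      by exists a; rewrite !inE // /c' subrr mulr0 eqxx.
    transitivity (\sum_e c e * sg e (x * y) - sg a x * \sum_e c e * sg e y).
      by rewrite mulr_sumr -sumrB; apply: eq_bigr => e _; rewrite /c' rmorphM; ring.
    by rewrite !sum0 mulr0 subr0.
  move/eqP: (c'0 b); rewrite /c' mulf_eq0 subr_eq0 (negPf xab) orbF => /eqP //.
have := sum0 1; rewrite (bigD1 a) //= big1 => [|b ba]; last by rewrite c0 // mul0r.
by rewrite addr0 rmorph1 mulr1 => /eqP; rewrite (negPf ca).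
Qed.

(** Artin's theorem. The embeddings of N in D need not be automorphisms: this
    allows coset representatives, which do not form a group, to act on residue
    fields. The set E of endomorphisms of D replaces the group. *)
Section Artin.
Variables (k N D : fieldType) (j : {rmorphism k -> N}) (dl : {rmorphism k -> D}).
Variables (n : nat) (sg : 'I_n -> {rmorphism N -> D}) (E : {rmorphism D -> D} -> Prop).
Hypothesis n_gt0 : (0 < n)%N.
Hypothesis sg_base : forall a c, sg a (j c) = dl c.
Hypothesis sg_dist : forall a b, a != b -> exists y, sg a y != sg b y.
Hypothesis sg_stable : forall t, E t -> forall a, exists b, forall y, t (sg a y) = sg b y.
Hypothesis E_fixed : forall y, (forall t, E t -> t y = y) -> exists c, y = dl c.

Definition embedding_mx m (y : 'I_m -> N) : 'M[D]_(m, n) := \matrix_(l, a) sg a (y l).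

(** A column c orthogonal to the rows chosen so far is not orthogonal to all rows
    (sg a z), by the independence of embeddings; z gives the next row. *)
Lemma embedding_mx_free m : (m <= n)%N -> exists y : 'I_m -> N, row_free (embedding_mx y).
Proof.
elim: m => [|m IH] mn.
  by exists (fun=> 0); rewrite /row_free -leqn0 rank_leq_row.
have [y yfree] := IH (ltnW mn).
have : ~~ row_free (embedding_mx y)^T.
  by rewrite /row_free mxrank_tr neq_ltn (leq_ltn_trans (rank_leq_row _) mn).
rewrite -kermx_eq0 => /rowV0Pn[c /sub_kermxP cM c0].
have [z zc] : exists z, \sum_a c 0 a * sg a z != 0.
  apply: contrapT => nz; case/negP: c0; apply/eqP/rowP => a; rewrite mxE.
  apply: (embeddings_independent sg_dist) => z; apply/eqP; apply: contraT => zc.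
  by case: nz; exists z.
pose y' (l : 'I_(m + 1)) := match fintype.split l with inl l => y l | inr _ => z end.
have y'E : embedding_mx y' = col_mx (embedding_mx y) (\row_a sg a z).
  apply/matrixP => l a; rewrite !mxE /y'; case: splitP => b _; rewrite mxE //.
have y'free : row_free (embedding_mx y').
  rewrite y'E; apply: inj_row_free => v; rewrite -[v]hsubmxK mul_row_col => v0.
  have : (lsubmx v *m embedding_mx y + rsubmx v *m \row_a sg a z) *m c^T = 0.
    by rewrite v0 mul0mx.
  rewrite mulmxDl -mulmxA -[embedding_mx y *m c^T]trmxK trmx_mul trmxK cM trmx0 mulmx0 add0r.
  have zE : (\row_a sg a z *m c^T) 0 0 = \sum_a c 0 a * sg a z.
    by rewrite mxE; apply: eq_bigr => a _; rewrite !mxE mulrC.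
  move=> /matrixP/(_ 0 0); rewrite -mulmxA [LHS]mxE big_ord1 zE [RHS]mxE => /eqP.
  rewrite mulf_eq0 (negPf zc) orbF => /eqP rv.
  have rv0 : rsubmx v = 0 by apply/matrixP => a b; rewrite !ord1 rv mxE.
  move: v0; rewrite rv0 mul0mx addr0 => lv.
  have -> : lsubmx v = 0 by apply: (row_free_inj yfree); rewrite mul0mx.
  by rewrite row_mx0.
by rewrite -(addn1 m); exists y'.
Qed.

(** The coordinates c of the row (sg a z) on the rows (sg a (y l)) exist and are
    unique in D. An element of E permutes the columns of this linear system, so it
    fixes c, which therefore has its entries in k. *)
Theorem artin_degree : degree j n.
Proof.
have [y yfree] := embedding_mx_free (leqnn n).
pose M := embedding_mx y; have Mu : M \in unitmx by rewrite -row_free_unit.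
pose v z : 'rV[D]_n := \row_a sg a z.
have vsum (c : 'rV[D]_n) a : (c *m M) 0 a = \sum_l c 0 l * sg a (y l).
  by rewrite mxE; apply: eq_bigr => l _; rewrite mxE.
exists y => z; pose c := v z *m invmx M.
have cM : c *m M = v z by rewrite mulmxKV.
have cfix l t : E t -> t (c 0 l) = c 0 l.
  move=> Et; pose tau a := projT1 (cid (sg_stable Et a)).
  have tauE a x : t (sg a x) = sg (tau a) x by exact: (projT2 (cid (sg_stable Et a))).
  have tau_inj : injective tau.
    move=> a b tab; apply/eqP; apply: contraT => /sg_dist[x /eqP[]].
    by apply: (fmorph_inj t); rewrite !tauE tab.
  suff : map_mx t c = c by move=> /rowP/(_ l); rewrite mxE.
  apply: (row_free_inj yfree); apply/rowP => b; rewrite cM vsum mxE.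
  have [tau' _ tauK] := injF_bij tau_inj; rewrite -[b]tauK; move: (tau' b) => a.
  have <- : t ((c *m M) 0 a) = sg (tau a) z by rewrite cM mxE tauE.
  rewrite vsum rmorph_sum; apply: eq_bigr => e _.
  by rewrite mxE rmorphM tauE.
have cK l : exists d, c 0 l = dl d by apply: E_fixed => t; apply: cfix.
pose d := [ffun l => projT1 (cid (cK l))].
have dE l : dl (d l) = c 0 l by rewrite ffunE -(projT2 (cid (cK l))).
have sgsum (e : {ffun 'I_n -> k}) a :
    sg a (\sum_l j (e l) * y l) = \sum_l dl (e l) * sg a (y l).
  by rewrite rmorph_sum; apply: eq_bigr => l _; rewrite rmorphM sg_base.
exists d; split=> [|e ze].
  apply: (fmorph_inj (sg (Ordinal n_gt0))); rewrite sgsum.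
  have /rowP/(_ (Ordinal n_gt0)) := cM; rewrite vsum mxE => <-.
  by apply: eq_bigr => l _; rewrite dE.
apply/ffunP => l; apply: (fmorph_inj dl); rewrite dE.
suff : c = \row_l dl (e l) by move=> ->; rewrite mxE.
apply: (row_free_inj yfree); rewrite cM; apply/rowP => a; rewrite mxE vsum ze sgsum.
by apply: eq_bigr => b _; rewrite mxE.
Qed.

End Artin.

(** * Traces in tame Galois extensions *)

Lemma residue_morphism (A D : fieldType) (al : valuation A) (de : valuation D)
    (phi : {rmorphism A -> D}) : equivalent al (restrict phi de) ->
  exists rho : {rmorphism residue al -> residue de},
    forall (a : vring al) (b : vring de), val b = phi (val a) ->
      rho (residue_pi a) = residue_pi b.
Proof.
move=> eqv.
have im (a : vring al) : phi (val a) \in in_vring de.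
  exact: (etrans (esym (eqv (val a))) (valP a)).
pose F (a : vring al) : vring de := VRing (im a).
pose rho (q : residue al) : residue de := residue_pi (F (repr q)).
have rhoE (a : vring al) (b : vring de) : val b = phi (val a) ->
    rho (residue_pi a) = residue_pi b.
  move=> ba; apply/eqP; rewrite /rho residue_pi_eq unfold_in /vmaximal.
  have : repr (residue_pi a) - a \in @vmaximal A al.
    by rewrite -residue_pi_eq residue_piK.
  have -> : val (F (repr (residue_pi a)) - b) = phi (val (repr (residue_pi a) - a)).
    by rewrite !rmorphB /= ba.
  rewrite unfold_in /vmaximal -(vmap1 al) -(vmap1 de) -(rmorph1 phi).
  by rewrite (equivalent_vle _ _ eqv).
have surj (q : residue al) : exists a, q = residue_pi a by exists (repr q); rewrite residue_piK.
have radd : zmod_morphism rho.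
  move=> p q; have [a ->] := surj p; have [b ->] := surj q.
  rewrite (rhoE a (F a)) // (rhoE b (F b)) // -!rmorphB; apply: rhoE.
  by rewrite !rmorphB.
have rmul : monoid_morphism rho.
  split=> [|p q].
    by rewrite -(rmorph1 (@residue_pi _ al)) -(rmorph1 (@residue_pi _ de)); apply: rhoE; rewrite !rmorph1.
  have [a ->] := surj p; have [b ->] := surj q.
  rewrite (rhoE a (F a)) // (rhoE b (F b)) // -!rmorphM; apply: rhoE.
  by rewrite !rmorphM.
pose rA := GRing.isZmodMorphism.Build _ _ rho radd.
pose rM := GRing.isMonoidMorphism.Build _ _ rho rmul.
by exists (HB.pack rho rA rM : {rmorphism residue al -> residue de}).
Qed.

Section TameGalois.
Local Open Scope group_scope.
Variables (gT : finGroupType) (G : {group gT}) (K N : fieldType).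
Variables (j : {rmorphism K -> N}) (u : valuation N) (sN : gT -> {rmorphism N -> N}).
Hypothesis sN_M : forall p r, p \in G -> r \in G -> forall y, sN (p * r) y = sN r (sN p y).
Hypothesis sN_base : forall p, p \in G -> forall c, sN p (j c) = j c.
Hypothesis sN_faithful : forall p, p \in G -> (forall y, sN p y = y) -> p = 1.
Hypothesis sN_fixed : forall y, (forall p, p \in G -> sN p y = y) -> exists c, y = j c.
Hypothesis sN_u : forall p, p \in G -> equivalent u (restrict (sN p) u).

Lemma sN_1 y : sN 1 y = y.
Proof. by apply: (fmorph_inj (sN 1)); rewrite -sN_M ?group1 // mulg1. Qed.

Lemma galois_degree : degree j #|G|.
Proof.
apply: (@artin_degree K N N j j #|G| (fun a => sN (enum_val a))
          (fun t => exists2 p, p \in G & forall y, t y = sN p y)).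
- exact: cardG_gt0.
- by move=> a c; apply: sN_base; apply: enum_valP.
- move=> a b ab; apply: contrapT => nex; case/eqP: ab; apply: enum_val_inj.
  have aG := enum_valP a; have bG := enum_valP b.
  apply/(mulIg (enum_val b)^-1)/etrans/esym/mulgV; apply: sN_faithful => [|y].
    by rewrite groupM ?groupV.
  rewrite sN_M ?groupV //.
  have -> : sN (enum_val a) y = sN (enum_val b) y.
    by apply/eqP; apply: contraT => ny; case: nex; exists y.
  by rewrite -sN_M ?groupV // mulgV sN_1.
- move=> t [p pG tE] a; exists (enum_rank_in (group1 G) (enum_val a * p)) => y.
  by rewrite enum_rankK_in ?groupM ?enum_valP // tE sN_M ?enum_valP.
move=> y yfix; apply: sN_fixed => p pG; apply: (yfix (sN p)).
by exists p.
Qed.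

Definition residual_action (p : gT) : {rmorphism residue u -> residue u} :=
  match pselect (p \in G) with
  | left pG => projT1 (cid (residue_morphism (sN_u pG)))
  | right _ => idfun
  end.
Local Notation bar := residual_action.

Lemma residual_actionE p (a b : vring u) : p \in G -> val b = sN p (val a) ->
  bar p (residue_pi a) = residue_pi b.
Proof.
move=> pG; rewrite /residual_action; case: pselect => // pG'.
exact: (projT2 (cid (residue_morphism (sN_u pG'))) a b).
Qed.

Lemma vring_action p (a : vring u) : p \in G -> exists b : vring u, val b = sN p (val a).
Proof.
move=> pG; have aO : sN p (val a) \in in_vring u.
  exact: (etrans (esym (sN_u pG (val a))) (valP a)).
by exists (VRing aO).
Qed.

Lemma residual_actionM p r q : p \in G -> r \in G -> bar (p * r) q = bar r (bar p q).
Proof.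
move=> pG rG; rewrite -[q]residue_piK; move: (repr q) => a.
have [b ba] := vring_action a pG; have [c cb] := vring_action b rG.
rewrite (residual_actionE pG ba) (residual_actionE rG cb).
by apply: residual_actionE; rewrite ?groupM // cb ba sN_M.
Qed.

Lemma residual_action1 q : bar 1 q = q.
Proof. by apply: (fmorph_inj (bar 1)); rewrite -residual_actionM ?group1 // mulg1. Qed.

Definition inertia_set := [set p in G | `[< forall q, bar p q = q >]].

Lemma inertiaP p : reflect (p \in G /\ forall q, bar p q = q) (p \in inertia_set).
Proof. by rewrite inE; apply: (iffP andP) => -[pG /asboolP]. Qed.

Fact inertia_group_set : group_set inertia_set.
Proof.
apply/group_setP; split; first by apply/inertiaP; split=> [|q]; rewrite ?residual_action1.
move=> p r /inertiaP[pG pI] /inertiaP[rG rI]; apply/inertiaP; split; first exact: groupM.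
by move=> q; rewrite residual_actionM // pI rI.
Qed.

Definition inertia_group : {group gT} := Group inertia_group_set.
Local Notation I := inertia_group.

Lemma inertia_sub : I \subset G.
Proof. by apply/fintype.subsetP => p /inertiaP[]. Qed.

Lemma residual_action_eq p r : p \in G -> r \in G ->
  (forall q, bar p q = bar r q) <-> p * r^-1 \in I.
Proof.
move=> pG rG; split=> [pr|/inertiaP[prG prI] q].
  apply/inertiaP; split=> [|q]; first by rewrite groupM ?groupV.
  by rewrite residual_actionM ?groupV // pr -residual_actionM ?groupV // mulgV residual_action1.
by rewrite -{1}[p](mulgKV r) residual_actionM // prI.
Qed.

Section Subgroup.
Variable H : {group gT}.
Hypothesis HG : H \subset G.
Let J : {group gT} := (I :&: H)%G.

Let inG p : p \in H -> p \in G. Proof. exact: (fintype.subsetP HG). Qed.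

Lemma rcoset_action c p : c \in rcosets J H -> p \in c ->
  [/\ fingroup.repr c \in H, p \in H & forall q, bar p q = bar (fingroup.repr c) q].
Proof.
move=> /rcosetsP[x xH ->] pc.
have rc : fingroup.repr (J :* x) \in J :* x by exact: mem_repr (rcoset_refl J x).
have mem z : z \in J :* x -> z \in H /\ forall q, bar z q = bar x q.
  rewrite mem_rcoset inE => /andP[zI zH].
  have zH' : z \in H by rewrite -(mulgKV x z) groupM.
  by split=> //; apply/residual_action_eq; rewrite ?inG.
have [rH rE] := mem _ rc; have [pH pE] := mem _ pc.
by split=> // q; rewrite pE rE.
Qed.

Lemma rcoset_repr_mem c : c \in rcosets J H -> fingroup.repr c \in c.
Proof. by move=> /rcosetsP[x xH ->]; exact: mem_repr (rcoset_refl J x). Qed.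

Lemma rcoset_action_inj c d : c \in rcosets J H -> d \in rcosets J H ->
  (forall q, bar (fingroup.repr c) q = bar (fingroup.repr d) q) -> c = d.
Proof.
move=> cR dR; have cc := rcoset_repr_mem cR; have dd := rcoset_repr_mem dR.
have [cH _ _] := rcoset_action cR cc; have [dH _ _] := rcoset_action dR dd.
move/residual_action_eq => /(_ (inG cH) (inG dH)) cdI.
have cdJ : fingroup.repr c * (fingroup.repr d)^-1 \in J by rewrite inE cdI groupM ?groupV.
move: cR dR cc dd cdJ => /rcosetsP[x _ ->] /rcosetsP[y _ ->].
move: (fingroup.repr _) (fingroup.repr _) => a b; move=> /rcoset_eqP <- /rcoset_eqP <-.
by rewrite -mem_rcoset => /rcoset_eqP.
Qed.

End Subgroup.

Section TameData.
Local Open Scope ring_scope.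
Variables (e f : nat).
Hypothesis f_deg : inertia_degree j u f.
Hypothesis e_char : forall p, p \in [pchar (residue (restrict j u))] -> ~~ (p %| e)%N.
Hypothesis res_sep : residually_separable j u.
Hypothesis G_ef : #|G| = (e * f)%N.

Lemma residual_action_base p (c : residue (restrict j u)) :
  p \in G -> bar p (residue_map c) = residue_map c.
Proof.
move=> pG; rewrite -[c]residue_piK residue_map_pi; apply: residual_actionE => //=.
by rewrite sN_base.
Qed.

Let orbit_poly (A : gT -> vring u) : {poly vring u} :=
  \prod_(p in G) ('X - (A p)%:P).

(** A residue fixed by G is purely inseparable over the residue field of K:
    the polynomial whose roots are the conjugates of a lift has coefficients in
    K and reduces to a power of a linear polynomial. *)
Lemma residue_fixed q : (forall p, p \in G -> bar p q = q) ->
  exists c : residue (restrict j u), q = residue_map c.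
Proof.
rewrite -[q]residue_piK; move: (repr q) => a {q} afix.
have act p : exists b : vring u, p \in G -> val b = sN p (val a).
  have [/(vring_action a)[b ba]|pG] := boolP (p \in G); first by exists b.
  by exists 0.
pose A p := projT1 (cid (act p)).
have AE p : p \in G -> val (A p) = sN p (val a) by exact: (projT2 (cid (act p))).
pose P := orbit_poly A.
have PvE : map_poly val P = (\prod_(p in G) ('X - (sN p (val a))%:P))%R.
  rewrite rmorph_prod; apply: eq_bigr => p pG.
  by rewrite [LHS]map_polyXsubC /= -AE.
have PrE : map_poly (@residue_pi _ u) P = (('X - (residue_pi a)%:P) ^+ #|G|)%R.
  rewrite rmorph_prod -prodr_const; apply: eq_bigr => p pG.
  by rewrite [LHS]map_polyXsubC -(afix p pG) (residual_actionE pG (AE p pG)).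
have PK m : exists c, val P`_m = j c.
  apply: sN_fixed => r rG; have -> : val P`_m = (map_poly val P)`_m by rewrite coef_map.
  rewrite -[sN r _]coef_map; suff -> : map_poly (sN r) (map_poly val P) = map_poly val P by [].
  rewrite PvE rmorph_prod /=.
  rewrite [RHS](reindex_inj (mulIg r)) /=; apply: eq_big => [p|p pG].
    by rewrite groupMr.
  by rewrite [LHS]map_polyXsubC /= sN_M.
pose c m := projT1 (cid (PK m)).
have cE m : val P`_m = j (c m) by exact: (projT2 (cid (PK m))).
have cO m : c m \in in_vring (restrict j u).
  by have := valP P`_m; rewrite cE.
pose h := (\poly_(m < size P) @residue_pi _ (restrict j u) (VRing (cO m)))%R.
have hE : map_poly (@residue_map _ _ j u) h = map_poly (@residue_pi _ u) P.
  apply/polyP => m; rewrite !coef_map coef_poly /=; case: ltnP => mP.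
    by rewrite residue_map_pi; congr residue_pi; apply: val_inj; rewrite /= -cE.
  by rewrite (nth_default _ mP) !rmorph0.
apply: (@separable_purely_inseparable _ _ (@residue_map _ _ j u) _ h #|G|.-1).
  exact: res_sep.
by rewrite hE PrE prednK ?cardG_gt0.
Qed.

(** By Artin's theorem, as the representatives of the cosets of I act on the
    residue field by distinct automorphisms, whose fixed field is the residue
    field of K. *)
Lemma inertia_index : #|rcosets I G| = f.
Proof.
have GG : G \subset G by [].
have IG : (I :&: G)%G = I by apply/val_inj/finset.setIidPl/inertia_sub.
apply: (degree_unique _ f_deg).
have cP (a : 'I_#|rcosets I G|) : enum_val a \in rcosets (I :&: G)%G G.
  by rewrite IG; apply: enum_valP.
apply: (@artin_degree _ _ _ (@residue_map _ _ j u) (@residue_map _ _ j u) _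
    (fun a => bar (fingroup.repr (enum_val a)))
    (fun t => exists2 p, p \in G & forall y, t y = bar p y)).
- by apply/card_gt0P; exists (I :* 1%g); apply/rcosetsP; exists 1%g.
- move=> a c; have [aG _ _] := rcoset_action GG (cP a) (rcoset_repr_mem (cP a)).
  exact: residual_action_base.
- move=> a b ab; apply: contrapT => nex; case/eqP: ab; apply: enum_val_inj.
  apply: (rcoset_action_inj GG (cP a) (cP b)) => q.
  by apply/eqP; apply: contraT => nq; case: nex; exists q.
- move=> t [p pG tE] a; have [aG _ _] := rcoset_action GG (cP a) (rcoset_repr_mem (cP a)).
  have dR : I :* (fingroup.repr (enum_val a) * p)%g \in rcosets I G.
    by apply/rcosetsP; exists (fingroup.repr (enum_val a) * p)%g; rewrite ?groupM.
  exists (enum_rank_in dR (I :* (fingroup.repr (enum_val a) * p)%g)) => q.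
  rewrite enum_rankK_in // tE -residual_actionM //.
  have dR' : I :* (fingroup.repr (enum_val a) * p)%g \in rcosets (I :&: G)%G G by rewrite IG.
  have mem : (fingroup.repr (enum_val a) * p)%g \in I :* (fingroup.repr (enum_val a) * p)%g.
    exact: rcoset_refl.
  by have [_ _ ->] := rcoset_action GG dR' mem.
move=> q qfix; apply: residue_fixed => p pG; apply: (qfix (bar p)).
by exists p.
Qed.

Lemma inertia_card : #|I| = e.
Proof.
have f0 : (0 < f)%N.
  by rewrite -inertia_index; apply/card_gt0P; exists (I :* 1%g); apply/rcosetsP; exists 1%g.
apply/eqP; rewrite -(eqn_pmul2r f0) -G_ef -inertia_index; apply/eqP.
exact: Lagrange inertia_sub.
Qed.

(** On residues, the trace of H is |I :&: H| times a sum of distinct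
    automorphisms, one for each coset of I :&: H. The factor divides e, hence does
    not vanish, and by independence the sum does not vanish everywhere. *)
Theorem tame_trace (H : {group gT}) : H \subset G ->
  exists t, in_vring u t /\ u (\sum_(p in H) sN p t)%R = Some 0%R.
Proof.
move=> HG; pose J := (I :&: H)%G.
have J0 : (#|J|%:R != 0 :> residue u)%R.
  apply/negP => J0.
  have [p cp] := natf0_pchar (cardG_gt0 J) J0.
  have pJ : (p %| #|J|)%N by rewrite (dvdn_pcharf cp).
  have cp' : p \in [pchar (residue (restrict j u))].
    by rewrite -(fmorph_pchar (@residue_map _ _ j u)).
  case/negP: (e_char cp'); apply: dvdn_trans pJ _.
  by rewrite -inertia_card; apply/cardSg/subsetIl.
have JH : J \subset H by apply: subsetIr.
pose c (a : 'I_#|rcosets J H|) := enum_val a.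
have cP a : c a \in rcosets J H by apply: enum_valP.
have [y yP] : exists y, (\sum_a #|J|%:R * bar (fingroup.repr (c a)) y != 0)%R.
  apply: contrapT => nex; case/eqP: J0.
  have R0 : (0 < #|rcosets J H|)%N.
    by apply/card_gt0P; exists (J :* 1%g); apply/rcosetsP; exists 1%g.
  apply: (@embeddings_independent _ _ _ (fun a => bar (fingroup.repr (c a)))
            (fun=> #|J|%:R%R) _ _ (Ordinal R0)) => [a b ab|y].
    apply: contrapT => nq; case/eqP: ab; apply: enum_val_inj.
    apply: (rcoset_action_inj HG (cP a) (cP b)) => q.
    by apply/eqP; apply: contraT => qn; case: nq; exists q.
  by apply/eqP; apply: contraT => yn; case: nex; exists y.
have sumE : (\sum_(p in H) bar p y = \sum_a #|J|%:R * bar (fingroup.repr (c a)) y)%R.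
  rewrite (set_partition_big _ (rcosets_partition JH)) /=.
  rewrite -(big_enum_val (A := mem (rcosets J H)) (fun C => #|J|%:R * bar (fingroup.repr C) y)%R) /=.
  apply: eq_bigr => C CR; rewrite mulr_natl.
  have -> : #|J| = #|C| by have /rcosetsP[z _ ->] := CR; rewrite card_rcoset.
  rewrite -sumr_const; apply: eq_bigr => p pC.
  by have [_ _ ->] := rcoset_action HG CR pC.
rewrite -sumE in yP; move: yP; rewrite -[y]residue_piK; move: (repr y) => t tP.
exists (val t); split; first exact: valP.
have act p : exists b : vring u, p \in H -> val b = sN p (val t).
  have [pH|pH] := boolP (p \in H); last by exists 0%R.
  by have [b bt] := vring_action t (fintype.subsetP HG p pH); exists b.
pose B p := projT1 (cid (act p)).
have BE p : p \in H -> val (B p) = sN p (val t) by exact: (projT2 (cid (act p))).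
have : residue_pi (\sum_(p in H) B p)%R != 0%R.
  have <- : \sum_(p in H) bar p (residue_pi t) = residue_pi (\sum_(p in H) B p).
    rewrite [RHS](rmorph_sum (@residue_pi _ u)); apply: eq_bigr => p pH.
    exact: (residual_actionE (fintype.subsetP HG p pH) (BE p pH)).
  exact: tP.
rewrite residue_pi_eq0 unfold_in /vmaximal negbK => le0.
have sE : (\sum_(p in H) sN p (val t) = val (\sum_(p in H) B p))%R.
  by rewrite rmorph_sum; apply: eq_bigr => p pH; exact: esym (BE p pH).
by rewrite sE; apply: vle_anti => //; exact: (valP (\sum_(p in H) B p)%R).
Qed.

End TameData.
End TameGalois.

(** * Best approximations in tame extensions *)

Section TameApproximation.
Variables (K : fieldType) (C : closedFieldType) (i : {rmorphism K -> C}) (w : valuation C).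
Hypothesis tameK : tame_extension i w.

Definition fixes (M : fieldType) (m : {rmorphism M -> C}) (s : {rmorphism C -> C}) :=
  forall c, s (m c) = m c.

Lemma fixes_invariant s : fixes i s -> equivalent w (restrict s w).
Proof.
move=> si; have [_ unib _] := tameK; apply: unib => c.
by rewrite /in_vring /= si.
Qed.

Lemma fixes_comp (M : fieldType) (m : {rmorphism M -> C}) s s' :
  fixes m s -> fixes m s' -> fixes m (s \o s').
Proof. by move=> ms ms' c; rewrite /= ms' ms. Qed.

Section Intermediate.
Variables (M : fieldType) (mu : {rmorphism K -> M}) (m : {rmorphism M -> C}).
Hypothesis m_mu : m \o mu =1 i.

Lemma fixesW s : fixes m s -> fixes i s.
Proof. by move=> ms c; rewrite -m_mu /= ms. Qed.

Lemma algebraic_over_intermediate : algebraic_extension m.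
Proof.
have [algK _ _] := tameK; move=> y; have [p p0 py] := algK y.
exists (map_poly mu p); first by rewrite map_poly_eq0.
by rewrite -map_poly_comp (eq_map_poly m_mu).
Qed.

Lemma fixed_in_base y : (forall s, fixes m s -> s y = y) -> exists c, y = m c.
Proof.
move=> yfix; apply: contrapT => ny.
have sep := separable_tower m_mu (tame_separable tameK y).
by have [s [sy ms]] := separable_moved algebraic_over_intermediate sep ny; apply/sy/yfix.
Qed.

End Intermediate.

Section Normal.
Variables (d : nat) (rt : 'I_d -> C) (f : {poly K}).
Hypothesis rt_inj : injective rt.
Hypothesis rtP : forall z, root (map_poly i f) z <-> exists k, z = rt k.

Lemma fixes_perm s : fixes i s -> exists p : 'S_d, forall k, s (rt k) = rt (p k).
Proof.
move=> si; have stab k : exists l, s (rt k) = rt l.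
  apply/rtP; have kr : root (map_poly i f) (rt k) by apply/rtP; exists k.
  have -> : map_poly i f = map_poly s (map_poly i f).
    by rewrite -map_poly_comp; apply: eq_map_poly => c; rewrite /= si.
  by rewrite /root horner_map (eqP kr) rmorph0.
pose g k := projT1 (cid (stab k)).
have gE k : s (rt k) = rt (g k) by exact: (projT2 (cid (stab k))).
have g_inj : injective g.
  by move=> k l gkl; apply/rt_inj/(fmorph_inj s); rewrite !gE gkl.
by exists (perm g_inj) => k; rewrite permE gE.
Qed.

Section Group.
Variables (M : fieldType) (m : {rmorphism M -> C}).

Definition root_perms := [set p : 'S_d |
  `[< exists2 s, fixes m s & forall k, s (rt k) = rt (p k) >]].

Lemma root_permsP (p : 'S_d) : reflect (exists2 s, fixes m s & forall k, s (rt k) = rt (p k))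
  (p \in root_perms).
Proof. by rewrite inE; apply: asboolP. Qed.

Fact root_perms_group : group_set root_perms.
Proof.
apply/group_setP; split.
  by apply/root_permsP; exists idfun => // k; rewrite perm1.
move=> p r /root_permsP[s ms sp] /root_permsP[t mt tr]; apply/root_permsP.
by exists (t \o s); [apply: fixes_comp | move=> k; rewrite permM /= sp tr].
Qed.

Canonical root_group : {group 'S_d} := Group root_perms_group.
End Group.

(** The normal closure generated by the roots of f, described as the set of the
    elements on which embeddings over K are determined by their action on the
    roots: in this form the permutations of the roots act on it by definition. *)
Definition normal_pred : {pred C} := fun y =>
  `[< forall s s', fixes i s -> fixes i s' -> (forall k, s (rt k) = s' (rt k)) -> s y = s' y >].

Fact normal_divring : divring_closed normal_pred.
Proof.
split; first by apply/asboolP => s s' _ _ _; rewrite !rmorph1.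
  move=> x y /asboolP xN /asboolP yN; apply/asboolP => s s' si s'i ss'.
  by rewrite !rmorphB (xN _ _ si s'i ss') (yN _ _ si s'i ss').
move=> x y /asboolP xN /asboolP yN; apply/asboolP => s s' si s'i ss'.
by rewrite !fmorph_div (xN _ _ si s'i ss') (yN _ _ si s'i ss').
Qed.

Let S := Subfield normal_divring.
Let N := subfield_type S.
Let inj : {rmorphism N -> C} := @sf_inj _ S.
Local Notation G := (root_group i).

Lemma normal_base c : i c \in sf_pred S.
Proof. by apply/asboolP => s s' si s'i _; rewrite si s'i. Qed.

Lemma normal_root k : rt k \in sf_pred S.
Proof. by apply/asboolP => s s' _ _; apply. Qed.

Lemma normal_agree (y : N) s s' : fixes i s -> fixes i s' ->
  (forall k, s (rt k) = s' (rt k)) -> s (inj y) = s' (inj y).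
Proof. by have /asboolP := sf_inj_in y; apply. Qed.

Lemma normal_stable s y : fixes i s -> y \in sf_pred S -> s y \in sf_pred S.
Proof.
move=> si /asboolP yN; apply/asboolP => t t' ti t'i tt'.
have [p sp] := fixes_perm si.
apply: (yN (t \o s) (t' \o s)); [exact: fixes_comp | exact: fixes_comp |].
by move=> k; rewrite /= sp tt'.
Qed.

Lemma perm_action (p : 'S_d) : exists t : {rmorphism N -> N}, p \in G ->
  exists2 s, fixes i s /\ (forall k, s (rt k) = rt (p k)) & forall y, inj (t y) = s (inj y).
Proof.
have [pG|pG] := boolP (p \in G); last by exists idfun.
have [s si sp] := root_permsP _ _ pG.
have [|t tE] := @sf_factor N C S (s \o inj).
  by move=> y; apply: normal_stable => //; apply: sf_inj_in.
by exists t => _; exists s.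
Qed.

Definition perm_act p : {rmorphism N -> N} := projT1 (cid (perm_action p)).

Lemma perm_actE (p : 'S_d) s : p \in G -> fixes i s -> (forall k, s (rt k) = rt (p k)) ->
  forall y, inj (perm_act p y) = s (inj y).
Proof.
move=> pG si sp y; have [t [ti tp] ->] := projT2 (cid (perm_action p)) pG.
by apply: normal_agree => // k; rewrite sp tp.
Qed.

Lemma perm_actM p r : p \in G -> r \in G ->
  forall y, perm_act (p * r)%g y = perm_act r (perm_act p y).
Proof.
move=> pG rG y; have [s si sp] := root_permsP _ _ pG; have [t ti tr] := root_permsP _ _ rG.
apply: (fmorph_inj inj); rewrite (perm_actE rG ti tr) (perm_actE pG si sp).
rewrite (@perm_actE _ (t \o s)) //; first exact: groupM.
  exact: fixes_comp.
by move=> k; rewrite permM /= sp tr.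
Qed.

Lemma perm_act_base (j : {rmorphism K -> N}) : (forall c, inj (j c) = i c) ->
  forall p, p \in G -> forall c, perm_act p (j c) = j c.
Proof.
move=> jE p pG c; have [s si sp] := root_permsP _ _ pG.
by apply: (fmorph_inj inj); rewrite (perm_actE pG si sp) jE si.
Qed.

Lemma perm_act_faithful p : p \in G -> (forall y, perm_act p y = y) -> p = 1%g.
Proof.
move=> pG pid; apply/permP => k; rewrite perm1; apply: rt_inj.
have [s si sp] := root_permsP _ _ pG; have [y yk] := sf_injP (normal_root k).
by rewrite -sp -yk -(perm_actE pG si sp) pid.
Qed.

Lemma perm_act_fixed (M : fieldType) (mu : {rmorphism K -> M}) (m : {rmorphism M -> C}) y :
  m \o mu =1 i -> (forall p, p \in root_group m -> perm_act p y = y) ->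
  exists c, inj y = m c.
Proof.
move=> mmu yfix; apply: (fixed_in_base mmu) => s ms; have si := fixesW mmu ms.
have [p sp] := fixes_perm si.
have pG : p \in G by apply/root_permsP; exists s.
by rewrite -(perm_actE pG si sp) yfix //; apply/root_permsP; exists s.
Qed.

Lemma root_group_sub (M : fieldType) (mu : {rmorphism K -> M}) (m : {rmorphism M -> C}) :
  m \o mu =1 i -> root_group m \subset G.
Proof.
move=> mmu; apply/fintype.subsetP => p /root_permsP[s ms sp].
by apply/root_permsP; exists s => //; apply: fixesW ms.
Qed.

Lemma perm_act_invariant p : p \in G ->
  equivalent (restrict inj w) (restrict (perm_act p) (restrict inj w)).
Proof.
move=> pG y; have [s si sp] := root_permsP _ _ pG.
by rewrite /in_vring /= (perm_actE pG si sp); apply: (fixes_invariant si).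
Qed.

(** By Artin's theorem the normal closure has degree |G| over K; it is finite, and
    tameness applies to it. *)
Lemma normal_trace (M : fieldType) (mu : {rmorphism K -> M}) (m : {rmorphism M -> C}) :
  m \o mu =1 i -> exists t : N, in_vring w (inj t) /\
    w (inj (\sum_(p in root_group m) perm_act p t)) = Some 0.
Proof.
move=> mmu; have [j jE] := sf_factor normal_base; have [_ _ finK] := tameK.
have fixK y : (forall p, p \in G -> perm_act p y = y) -> exists c, y = j c.
  move=> yfix; have [c yc] := @perm_act_fixed K idfun i y (fun=> erefl) yfix.
  by exists c; apply: (fmorph_inj inj); rewrite [RHS]jE.
have deg := galois_degree perm_actM (perm_act_base jE) perm_act_faithful fixK.
have [e [g [_ degg echar sep nE]]] := finK N j inj _ jE deg.
exact: (tame_trace perm_actM (perm_act_base jE) fixK perm_act_invariant degg echar sep nE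
  (root_group_sub mmu)).
Qed.

End Normal.

(** Take t in the normal closure, integral and of unit trace T over M, and let b
    be the trace of t * a divided by T. Then T * (a - b) is the sum of the
    conjugates of t times the differences of a and its conjugates, so its value,
    which is that of a - b, is at least the least value of these differences. *)
Theorem tame_approximation (M : fieldType) (mu : {rmorphism K -> M})
    (m : {rmorphism M -> C}) (a : C) : m \o mu =1 i ->
  exists b s, fixes m s /\ vle (w (a - s a)) (w (a - m b)).
Proof.
move=> mmu; have [f [firr fsep fa]] := tame_separable tameK a.
have f0 : f != 0 by apply: separable_poly_neq0.
have [rs rsE] := closed_field_poly_normal (map_poly i f).
have l0 : lead_coef (map_poly i f) != 0 by rewrite lead_coef_eq0 map_poly_eq0.
have rs_uniq : uniq rs.
  rewrite -separable_prod_XsubC -(eqp_separable (eqp_scale _ l0)) -rsE separable_map //.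
pose rt (k : 'I_(size rs)) := rs`_k.
have rt_inj : injective rt.
  move=> k l kl; apply/val_inj/eqP; rewrite -(nth_uniq 0 _ _ rs_uniq) ?ltn_ord //.
  exact/eqP.
have rtP z : root (map_poly i f) z <-> exists k, z = rt k.
  rewrite rsE rootZ // root_prod_XsubC; split=> [zr|[k ->]]; last exact: mem_nth.
  by exists (Ordinal (etrans (index_mem z rs) zr)); rewrite /rt /= nth_index.
have [t [tO T1]] := normal_trace rt_inj rtP mmu.
pose S := Subfield (normal_divring rt).
pose inj : {rmorphism subfield_type S -> C} := @sf_inj C S.
pose H := root_group rt m; pose T := \sum_(p in H) perm_act rt_inj rtP p t.
rewrite -/(inj t) -/T -/(inj T) in tO T1.
have [k0 ak0] : exists k, a = rt k by apply/rtP.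
have [al alE] := sf_injP (normal_root rt k0); rewrite -ak0 in alE.
have alE' : inj al = a by exact: alE.
have HG := root_group_sub rt mmu.
have inG p : p \in H -> p \in root_group rt i by exact: (fintype.subsetP HG).
pose trH z := \sum_(p in H) perm_act rt_inj rtP p z.
have trH_fixed z r : r \in H -> perm_act rt_inj rtP r (trH z) = trH z.
  move=> rH; rewrite /trH rmorph_sum [RHS](reindex_inj (mulIg r)) /=.
  apply: eq_big => [p|p pH]; first by rewrite groupMr.
  by rewrite (perm_actM rt_inj rtP) ?inG.
have T0 : T != 0 by apply/eqP => T0; move: T1; rewrite T0 rmorph0 vmap0.
pose be := trH (t * al) / T.
have [r rH|b bE] := @perm_act_fixed _ rt f rt_inj rtP M mu m be mmu.
  by rewrite /be fmorph_div !trH_fixed.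
apply: contrapT => nex.
have far s : fixes m s -> vlt (w (a - m b)) (w (a - s a)).
  by move=> ms; apply/negP => h; apply: nex; exists b, s.
have c0 : w (a - m b) != None.
  have := far idfun (fun=> erefl); rewrite subrr vmap0.
  by case: (w (a - m b)).
have : vlt (w (a - m b)) (w (inj (\sum_(p in H) perm_act rt_inj rtP p t * (al - perm_act rt_inj rtP p al)))).
  rewrite rmorph_sum; apply: vlt_vmap_sum => // p pH; have pG := inG p pH.
  have /root_permsP[s ms sp] := pH; have si := fixesW mmu ms.
  rewrite rmorphM rmorphB vmapM !(perm_actE rt_inj rtP pG si sp).
  rewrite -[s (sf_inj al)]/(s (inj al)) alE'.
  apply: (vlt_le_trans (far s ms)); rewrite -[X in vle X]vadd0.
  apply: (vle_add (vgroupP w)); last exact: vle_refl.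
  by rewrite -[vle _ _]/(in_vring (restrict s w) (inj t)) -(fixes_invariant si).
have -> : \sum_(p in H) perm_act rt_inj rtP p t * (al - perm_act rt_inj rtP p al) = T * (al - be).
  rewrite mulrBr mulrCA divff // mulr1 mulr_suml -sumrB; apply: eq_bigr => p _.
  by rewrite mulrBr rmorphM.
by rewrite rmorphM vmapM T1 vadd0 rmorphB -bE alE' vltxx.
Qed.

End TameApproximation.

(** * Generated subfields *)

Section Generated.
Variables (K L : fieldType) (i : {rmorphism K -> L}).
Implicit Types S : L -> Prop.

Lemma generated_base S c : generated i S (i c).
Proof. by move=> P _ iP _. Qed.

Lemma generated_mem S y : S y -> generated i S y.
Proof. by move=> Sy P _ _; apply. Qed.

Lemma generated_sub S S' y : (forall z, S z -> generated i S' z) ->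
  generated i S y -> generated i S' y.
Proof.
by move=> SS' yS P Pdiv iP S'P; apply: yS => // z /SS' zS'; apply: zS'.
Qed.

Lemma generated_divring S : divring_closed (fun y => `[< generated i S y >] : bool).
Proof.
split; first by apply/asboolP => P [].
  move=> x y /asboolP xS /asboolP yS; apply/asboolP => P Pdiv iP SP.
  by have [_ PB _] := Pdiv; apply: PB; [apply: xS | apply: yS].
move=> x y /asboolP xS /asboolP yS; apply/asboolP => P Pdiv iP SP.
by have [_ _ PD] := Pdiv; apply: PD; [apply: xS | apply: yS].
Qed.

Lemma generated_ind S (Q : L -> Prop) :
  (forall c, Q (i c)) -> (forall y, S y -> Q y) ->
  (forall y z, Q y -> Q z -> Q (y - z)) -> (forall y z, Q y -> Q z -> Q (y / z)) ->
  forall y, generated i S y -> Q y.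
Proof.
move=> Qi QS QB QD y yS; apply/asboolP.
apply: (yS (fun z => `[< Q z >])) => [|c|z /QS Qz]; try exact/asboolP.
split; first by apply/asboolP; rewrite -(rmorph1 i).
  by move=> a b /asboolP Qa /asboolP Qb; apply/asboolP/QB.
by move=> a b /asboolP Qa /asboolP Qb; apply/asboolP/QD.
Qed.

(** The subfields generated by the initial segments increase. *)
Lemma generated_initial (a : nat -> L) y : generated i (fun z => exists n, z = a n) y ->
  exists n, generated i (fun z => exists2 k, (k < n)%N & z = a k) y.
Proof.
pose Fn n := generated i (fun z => exists2 k, (k < n)%N & z = a k).
have Fmono n m z : (n <= m)%N -> Fn n z -> Fn m z.
  move=> nm; apply: generated_sub => t [k kn ->]; apply: generated_mem.
  by exists k => //; apply: leq_trans nm.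
have op (f : L -> L -> L) : (forall n, (forall u v, Fn n u -> Fn n v -> Fn n (f u v))) ->
    forall u v, (exists n, Fn n u) -> (exists n, Fn n v) -> exists n, Fn n (f u v).
  move=> fF u v [n un] [m vm]; exists (maxn n m); apply: fF.
    by apply: Fmono un; apply: leq_maxl.
  by apply: Fmono vm; apply: leq_maxr.
move: y; apply: generated_ind.
- by move=> c; exists 0%N; apply: generated_base.
- by move=> _ [n ->]; exists n.+1; apply: generated_mem; exists n.
- apply: op => n u v un vn P Pdiv iP SP; have [_ PB _] := Pdiv.
  by apply: PB; [apply: un | apply: vn].
apply: op => n u v un vn P Pdiv iP SP; have [_ _ PD] := Pdiv.
by apply: PD; [apply: un | apply: vn].
Qed.

(** Monomials in the a k are enumerated by the codes of finite sequences of
    indices; a number that codes no sequence gives the empty monomial. *)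
Definition monomial (a : nat -> L) (n : nat) : L :=
  \prod_(k <- odflt [::] (unpickle n : option (seq nat))) a k.

(** The span of the monomials is closed under products, as monomials are, and
    under inverses, as the inverse of an algebraic element is a polynomial in it. *)
Lemma generated_span (a : nat -> L) y : algebraic_extension i ->
  generated i (fun z => exists n, z = a n) y ->
  exists n (c : nat -> K), y = \sum_(k < n) i (c k) * monomial a k.
Proof.
move=> algi; pose Q y := exists n (c : nat -> K), y = \sum_(k < n) i (c k) * monomial a k.
have Q0 : Q 0 by exists 0%N, (fun=> 0); rewrite big_ord0.
have Qmono c n : Q (i c * monomial a n).
  exists n.+1, (fun k => if k == n then c else 0).
  rewrite (bigD1 ord_max) //= eqxx big1 ?addr0 // => k kn.
  by rewrite (negPf kn : (k == n :> nat) = false) rmorph0 mul0r.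
have QDZ c u v : Q u -> Q v -> Q (i c * u + v).
  move=> [n [d ->]] [m [e ->]]; exists (maxn n m), (fun k =>
    c * (if (k < n)%N then d k else 0) + (if (k < m)%N then e k else 0)).
  under [RHS]eq_bigr => k _ do rewrite rmorphD rmorphM mulrDl -mulrA.
  rewrite big_split /= -mulr_sumr; congr (_ * _ + _).
    rewrite (big_ord_widen _ (fun k => i (d k) * monomial a k) (leq_maxl n m)) big_mkcond.
    by apply: eq_bigr => k _; case: ifP; rewrite ?rmorph0 ?mul0r.
  rewrite (big_ord_widen _ (fun k => i (e k) * monomial a k) (leq_maxr n m)) big_mkcond.
  by apply: eq_bigr => k _; case: ifP; rewrite ?rmorph0 ?mul0r.
have QD u v : Q u -> Q v -> Q (u + v) by move=> Qu Qv; have := QDZ 1 u v Qu Qv; rewrite rmorph1 mul1r.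
have QZ c u : Q u -> Q (i c * u) by move=> Qu; have := QDZ c u 0 Qu Q0; rewrite addr0.
have Qsum n (f : 'I_n -> L) : (forall k, Q (f k)) -> Q (\sum_k f k).
  by move=> Qf; apply: (big_ind Q) => // u v; apply: QD.
have mono_mul n m : exists k, monomial a n * monomial a m = monomial a k.
  exists (pickle (odflt [::] (unpickle n : option (seq nat)) ++
                  odflt [::] (unpickle m : option (seq nat)))).
  by rewrite [RHS]/monomial pickleK /= big_cat.
have QM u v : Q u -> Q v -> Q (u * v).
  move=> [n [d ->]] [m [e ->]]; rewrite mulr_suml; apply: (Qsum n) => k.
  rewrite mulr_sumr; apply: (Qsum m) => l; rewrite mulrACA -rmorphM.
  by have [t ->] := mono_mul k l.
have Q1 : Q 1.
  have := Qmono 1 (pickle ([::] : seq nat)).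
  by rewrite /monomial pickleK /= big_nil rmorph1 mulr1.
have Qi c : Q (i c) by rewrite -[i c]mulr1; apply: QZ.
have QX u n : Q u -> Q (u ^+ n).
  by move=> Qu; elim: n => [|n IH]; rewrite ?expr0 // exprS; apply: QM.
have QV u : Q u -> Q u^-1.
  move=> Qu; have [->|u0] := eqVneq u 0; first by rewrite invr0.
  have [f [fm firr fu fdiv]] := minimal_polynomial (algi u).
  have [E [j [k [_ [z zu] _ kq]]]] := simple_extension firr fu.
  have [q qE] := kq z^-1; rewrite -zu -fmorphV qE horner_coef size_map_poly.
  by apply: Qsum => l; rewrite coef_map; apply: QZ; apply: QX.
move: y; apply: (generated_ind (Q := Q)) => //.
- by move=> _ [n ->]; have := Qmono 1 (pickle [:: n]); rewrite /monomial pickleK /= big_seq1 rmorph1 mul1r.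
- by move=> u v Qu Qv; apply: QD => //; have := QZ (-1) v Qv; rewrite rmorphN rmorph1 mulN1r.
by move=> u v Qu Qv; apply: QM => //; apply: QV.
Qed.

End Generated.

(** The family s is in echelon form: s n has leading term e n whenever A contains
    an element with that leading term, so that subtracting multiples of the s n
    reduces every element of A to 0. *)
Lemma countable_subspace (K L D : fieldType) (i : {rmorphism K -> L})
    (g : {rmorphism L -> D}) (e : nat -> D) (A : L -> Prop) :
  A 0 -> (forall y z, A y -> A z -> A (y - z)) -> (forall c y, A y -> A (i c * y)) ->
  (forall y, A y -> exists n (c : nat -> K), g y = \sum_(k < n) g (i (c k)) * e k) ->
  exists s : nat -> L, (forall n, A (s n)) /\
    forall y, A y -> exists n (c : nat -> K), y = \sum_(k < n) i (c k) * s k.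
Proof.
move=> A0 AB AZ Ae; pose V n x := exists c : nat -> K, x = \sum_(k < n) g (i (c k)) * e k.
have VB n a x y : V n x -> V n y -> V n (x - g (i a) * y).
  move=> [c ->] [d ->]; exists (fun k => c k - a * d k).
  rewrite mulr_sumr -sumrB; apply: eq_bigr => k _.
  by rewrite mulrA -!rmorphM -mulrBl -!rmorphB.
have sP n : exists z, A z /\ ((exists z', A z' /\ V n (g z' - e n)) -> V n (g z - e n)).
  have [[z' [Az' Vz']]|nz] := pselect (exists z', A z' /\ V n (g z' - e n)).
    by exists z'.
  by exists 0.
pose s n := projT1 (cid (sP n)).
have sA n : A (s n) by have [] := projT2 (cid (sP n)).
have sV n : (exists z', A z' /\ V n (g z' - e n)) -> V n (g (s n) - e n).
  by have [] := projT2 (cid (sP n)).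
exists s; split=> // y Ay; have [n yn] := Ae y Ay; have {}yn : V n (g y) := yn.
elim: n y Ay yn => [|n IH] y Ay [c yc].
  exists 0%N, (fun=> 0); rewrite big_ord0; apply: (fmorph_inj g).
  by rewrite rmorph0 yc big_ord0.
have Vn : V n (g y - g (i (c n)) * e n) by exists c; rewrite yc big_ord_recr /= addrK.
have [c0|cn0] := eqVneq (c n) 0.
  have [|m [d yd]] := IH y Ay; first by move: Vn; rewrite c0 !rmorph0 mul0r subr0.
  by exists m, d.
have V0 : V n 0 by exists (fun=> 0); rewrite big1 // => k _; rewrite !rmorph0 mul0r.
have sn : V n (g (s n) - e n).
  apply: sV; exists (i (c n)^-1 * y); split; first exact: AZ.
  have := VB n (- (c n)^-1) 0 _ V0 Vn.
  rewrite !rmorphN mulNr opprK add0r mulrBr mulrA -!rmorphM mulVf // !rmorph1 mul1r.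
  by rewrite rmorphM.
have [||m [d yd]] := IH (y - i (c n) * s n).
- by apply: AB => //; apply: AZ.
- have := VB n (c n) _ _ Vn sn; congr (V n _); rewrite rmorphB rmorphM.
  by ring.
exists (maxn m n.+1), (fun k => (if (k < m)%N then d k else 0) + (if k == n then c n else 0)).
under eq_bigr => k _ do rewrite rmorphD mulrDl.
rewrite big_split /= -[y in LHS](subrK (i (c n) * s n)) yd; congr (_ + _).
  rewrite (big_ord_widen _ (fun k => i (d k) * s k) (leq_maxl m n.+1)) big_mkcond.
  by apply: eq_bigr => k _; case: ifP; rewrite ?rmorph0 ?mul0r.
rewrite (bigD1 (Ordinal (leq_maxr m n.+1))) //= eqxx big1 ?addr0 // => k kn.
by rewrite (negPf kn : (k == n :> nat) = false) rmorph0 mul0r.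
Qed.

(** * Approximation of a transcendental element *)

Section Approximation.
Variables (K : fieldType) (C : closedFieldType) (i : {rmorphism K -> C}) (wC : valuation C).
Hypothesis tameK : tame_extension i wC.
Variables (Om : closedFieldType) (om : valuation Om) (c : {rmorphism C -> Om}) (X : Om).
Hypothesis wC_om : equivalent wC (restrict c om).
Let GP := vgroupP om.

(** An embedding over K preserves the valuation ring; it also preserves values,
    as otherwise an orbit, which is finite, would have strictly monotone
    values. *)
Lemma fixes_value s y : fixes i s -> om (c (s y)) = om (c y).
Proof.
move=> si; have [algK _ _] := tameK; have [p p0 py] := algK y.
pose v z := om (c z).
have mono a b : vlt (v a) (v b) = vlt (v (s a)) (v (s b)).
  rewrite -[v a]/(restrict c om a) -[v b]/(restrict c om b) -(equivalent_vlt _ _ wC_om).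
  rewrite (equivalent_vlt _ _ (fixes_invariant tameK si)) -[restrict s wC a]/(wC (s a)).
  by rewrite -[restrict s wC b]/(wC (s b)) (equivalent_vlt _ _ wC_om).
have root_iter n : root (map_poly i p) (iter n s y).
  elim: n => //= n IH; have -> : map_poly i p = map_poly s (map_poly i p).
    by rewrite -map_poly_comp; apply: eq_map_poly => d; rewrite /= si.
  by rewrite /root horner_map (eqP IH) rmorph0.
have nochain (r : rel C) : (forall a, ~~ r a a) -> transitive r ->
    (forall n, r (iter n s y) (iter n.+1 s y)) -> False.
  move=> rirr rtr rn; have lt n m : (n < m)%N -> r (iter n s y) (iter m s y).
    elim: m => // m IH; rewrite ltnS leq_eqVlt => /orP[/eqP->|/IH nm]; first exact: rn.
    exact: rtr nm (rn m).
  pose l := [seq iter n s y | n <- iota 0 (size (map_poly i p))].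
  have : (size l < size (map_poly i p))%N.
    apply: max_poly_roots; first by rewrite map_poly_eq0.
      by apply/allP => _ /mapP[n _ ->].
    rewrite map_inj_in_uniq ?iota_uniq // => n m _ _ nm.
    by case: (ltngtP n m) => // /lt; rewrite nm (negPf (rirr _)).
  by rewrite size_map size_iota ltnn.
apply: contrapT => /vlt_neqVgt[h|h].
  apply: (nochain (fun a b => vlt (v b) (v a))) => [a|b a z ab zb|n].
  - by rewrite vltxx.
  - exact: (vlt_trans GP) zb ab.
  by elim: n => //= n IH; rewrite -mono.
apply: (nochain (fun a b => vlt (v a) (v b))) => [a|b a z ab bz|n].
- by rewrite vltxx.
- exact: (vlt_trans GP) ab bz.
by elim: n => //= n IH; rewrite -mono.
Qed.

Definition closeness y := om (X - c y).

Lemma closeness_sub a b : vlt (closeness b) (closeness a) ->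
  om (c (a - b)) = closeness b.
Proof.
move=> ba; have -> : c (a - b) = (X - c b) - (X - c a) by rewrite rmorphB; ring.
by apply: vmapD_lt; rewrite vmapN.
Qed.

(** Let b and a conjugate s y over the subfield be as in [tame_approximation], and
    let a n be closer to X than b. As y is closer still, y - b and y - a n have
    the values of X - b and X - a n. So y - s y = (y - a n) - s (y - a n) has a
    larger value than y - b, which contradicts the choice of b. *)
Lemma no_limit (a : nat -> C) y :
  (forall b, generated i (fun z => exists n, z = a n) b ->
     vlt (closeness b) (closeness y) /\
     exists n, vlt (closeness b) (closeness (a n))) -> False.
Proof.
move=> close; pose S := Subfield (generated_divring i (fun z => exists n, z = a n)).
have iS d : i d \in sf_pred S by apply/asboolP; apply: generated_base.
have [mu muE] := sf_factor iS.
have [b [s [ms ab]]] := tame_approximation tameK y (muE : @sf_inj _ S \o mu =1 i).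
have si : fixes i s by move=> d; rewrite -muE; apply: ms.
have gen z : generated i (fun z => exists n, z = a n) z -> s z = z.
  by move=> zS; have [t <-] := @sf_injP _ S z (asboolT zS); apply: ms.
have bS : generated i (fun z => exists n, z = a n) (sf_inj b).
  by have /asboolP := sf_inj_in b.
have [by_ [n bn]] := close _ bS.
have anS : generated i (fun z => exists n, z = a n) (a n).
  by apply: generated_mem; exists n.
have [any _] := close _ anS.
move: ab; rewrite (equivalent_vle _ _ wC_om) /= (closeness_sub by_); apply/negP.
apply: (vlt_le_trans bn); rewrite -(closeness_sub any).
have -> : c (y - s y) = c (y - a n) - c (s (y - a n)).
  by rewrite -rmorphB [s (y - _)]rmorphB (gen _ anS); congr (c _); ring.
apply: vle_vmapB; first exact: vle_refl.
by rewrite (fixes_value _ si) vle_refl.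
Qed.

(** If X has no best approximation in C, each term of the sequence is chosen to
    improve on all elements generated by the preceding ones. When this is
    impossible, finitely many terms already generate a field that comes
    arbitrarily close to X. Otherwise the whole sequence does, as an element
    closer to X than the generated field would contradict [no_limit]. *)
Lemma approximating_sequence : exists a : nat -> C,
  let gen := generated i (fun z => exists n, z = a n) in
  (exists2 b, gen b & forall y, vle (closeness y) (closeness b)) \/
  (forall y, exists2 b, gen b & vlt (closeness y) (closeness b)).
Proof.
have [[b bmax]|nomax] := pselect (exists b, forall y, vle (closeness y) (closeness b)).
  by exists (fun=> b); left; exists b => //; apply: generated_mem; exists 0%N.
have {}nomax b : exists y, vlt (closeness b) (closeness y).
  apply: contrapT => nb; apply: nomax; exists b => y; apply: contraT => yb.
  by case: nb; exists y.
pose F (s : seq C) := generated i (fun z => z \in s).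
have [[s scof]|ncof] := pselect (exists s, forall y, exists2 b, F s b & vlt (closeness y) (closeness b)).
  exists (fun n => nth 0 s n); right => y; have [b bs yb] := scof y; exists b => //.
  apply: generated_sub bs => z zs; apply: generated_mem; exists (index z s).
  by rewrite nth_index.
have far (P : C -> Prop) : (~ forall y, exists2 b, P b & vlt (closeness y) (closeness b)) ->
    exists y, forall b, P b -> vlt (closeness b) (closeness y).
  move=> nP; apply: contrapT => ny; apply: nP => y; apply: contrapT => nb; apply: ny.
  have [z yz] := nomax y; exists z => b Pb; apply: vle_lt_trans yz.
  by apply: contraT => h; case: nb; exists b.
have nextP s : exists y, forall b, F s b -> vlt (closeness b) (closeness y).
  by apply: far => h; apply: ncof; exists s.
pose next s := projT1 (cid (nextP s)).
pose pre n := iter n (fun s => rcons s (next s)) [::].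
pose a n := next (pre n).
have pre_mem k n : (k < n)%N -> a k \in pre n.
  elim: n => // n IH; rewrite ltnS leq_eqVlt /= mem_rcons in_cons => /orP[/eqP->|/IH->].
    by rewrite eqxx.
  by rewrite orbT.
have better b : generated i (fun z => exists n, z = a n) b ->
    exists n, vlt (closeness b) (closeness (a n)).
  move=> /generated_initial[n bn]; exists n; apply: (projT2 (cid (nextP (pre n)))).
  by apply: generated_sub bn => z [k kn ->]; apply: generated_mem; apply: pre_mem.
exists a; right; apply: contrapT => /far[y ya]; apply: (@no_limit a y) => b bS.
by split; [apply: ya | apply: better].
Qed.

(** The value of X - y is the smaller one of the values of y - b and of X - b, for
    b closest to X or closer to X than y; the former is that of s y - b as well,
    because s fixes b. *)
Lemma approximating_closeness (a : nat -> C) :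
  let gen := generated i (fun z => exists n, z = a n) in
  (exists2 b, gen b & forall y, vle (closeness y) (closeness b)) \/
  (forall y, exists2 b, gen b & vlt (closeness y) (closeness b)) ->
  forall s, fixes i s -> (forall z, gen z -> s z = z) ->
  forall y, closeness (s y) = closeness y.
Proof.
move=> gen dich s si sgen y.
have val b : gen b -> om (c (s y - b)) = om (c (y - b)).
  by move=> bS; rewrite -(fixes_value (y - b) si) [s (y - b)]rmorphB (sgen b bS).
have small b : gen b -> vlt (om (c (y - b))) (closeness b) -> closeness (s y) = closeness y.
  move=> bS lt; have E z : om (c (z - b)) = om (c (y - b)) -> closeness z = om (c (y - b)).
    move=> zb; rewrite /closeness.
    have -> : X - c z = - c (z - b) + (X - c b) by rewrite rmorphB; ring.
    by rewrite vmapD_lt ?vmapN ?zb.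
  by rewrite (E _ (val b bS)) (E y).
case: dich => [[b bS bmax]|cof]; last first.
  have [b bS yb] := cof y; apply: (small b bS).
  by rewrite -[y - b]opprB rmorphN vmapN (closeness_sub yb).
have [|lt] := boolP (vle (closeness b) (om (c (y - b)))); last exact: (small b bS).
move=> le; have E z : om (c (z - b)) = om (c (y - b)) -> closeness z = closeness b.
  move=> zb; apply: vle_anti; first exact: bmax.
  rewrite {2}/closeness; have -> : X - c z = (X - c b) - c (z - b) by rewrite rmorphB; ring.
  by apply: vle_vmapB; [exact: vle_refl | rewrite zb].
by rewrite (E _ (val b bS)) (E y).
Qed.

(** Polynomials over C are products of linear factors. *)
Lemma closeness_poly (s : {rmorphism C -> C}) (p : {poly C}) : fixes i s ->
  (forall y, closeness (s y) = closeness y) ->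
  om (evaluation (c \o s) X p) = om (evaluation c X p).
Proof.
move=> si sclose; have [rs ->] := closed_field_poly_normal p.
move: (lead_coef p) => k; rewrite -mul_polyC !(rmorphM (evaluation _ X)) !vmapM !evaluationC.
congr (vadd _ _); first exact: (fixes_value k si).
elim: rs => [|r rs IH]; first by rewrite !big_nil !rmorph1.
rewrite !big_cons !(rmorphM (evaluation _ X)) !vmapM IH; congr (vadd _ _).
by rewrite !evaluationXsubC; apply: sclose.
Qed.

End Approximation.

(** * Henselizations and constants *)

Lemma root_over_closed (Om : closedFieldType) (L : fieldType) (k : {rmorphism Om -> L})
    (p : {poly Om}) y : p != 0 -> root (map_poly k p) y -> exists x, y = k x.
Proof.
have [rs pE] := closed_field_poly_normal p => p0.
rewrite pE map_polyZ rootZ ?fmorph_eq0 ?lead_coef_eq0 // -(prod_map_poly _ _ predT).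
by rewrite root_prod_XsubC => /mapP[x _ ->]; exists x.
Qed.

(** Algebraic extensions of Om are trivial, hence have a single valuation over om. *)
Lemma closed_henselian (Om : closedFieldType) (om : valuation Om) : henselian om.
Proof.
move=> L k w algk _ w' ww' y; have [p p0 py] := algk y.
by have [x ->] := root_over_closed p0 py; apply: ww'.
Qed.

Section Main.
Variables (K : fieldType) (v : valuation K) (F : fieldType) (w : valuation F).
Variables (i : {rmorphism K -> F}) (x : F) (H : fieldType) (u : valuation H).
Variables (h : {rmorphism F -> H}).
Hypothesis trx : ~ algebraicOver i x.
Hypothesis genx : forall y : F, generated i (fun z => z = x) y.
Hypothesis henH : henselization h w u.
Variables (C : closedFieldType) (iC : {rmorphism K -> C}) (wC : valuation C).
Hypothesis tameK : tame_extension iC wC.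
Variables (Om : closedFieldType) (l : {rmorphism F -> Om}) (om : valuation Om).
Hypothesis algl : algebraic_extension l.
Hypothesis l_om : extends l w om.
Variables (c : {rmorphism C -> Om}).
Hypothesis c_i : forall a, c (iC a) = l (i a).
Hypothesis wC_om : equivalent wC (restrict c om).
Variables (g : {rmorphism H -> Om}).
Hypothesis g_h : g \o h =1 l.
Hypothesis g_om : extends g u om.
Let X := l x.

(** An equation over F has a multiple with coefficients in K[x]. *)
Lemma algebraic_over_polynomials y : exists2 p : {poly {poly C}},
  map_poly (evaluation c X) p != 0 & root (map_poly (evaluation c X) p) y.
Proof.
have rat := rational_function trx genx; have [f f0 fy] := algl y.
have nz q : q != 0 -> (map_poly i q).[x] != 0.
  by move=> q0; apply/negP => qx; apply: trx; exists q.
have [q [q0 qf]] := rational_common_denominator (fun k => f`_k) (size f) rat trx.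
have lE r : evaluation c X (map_poly iC r) = l (map_poly i r).[x].
  rewrite /= /horner_eval -map_poly_comp -horner_map -map_poly_comp.
  by congr (_.[_]); apply: eq_map_poly => a; exact: c_i.
have rP k : exists r : {poly K}, f`_k * (map_poly i q).[x] = (map_poly i r).[x].
  have [/qf//|kf] := ltnP k (size f); exists 0.
  by rewrite nth_default // mul0r rmorph0 horner0.
pose r k := projT1 (cid (rP k)).
have rE k : f`_k * (map_poly i q).[x] = (map_poly i (r k)).[x] by exact: (projT2 (cid (rP k))).
pose p : {poly {poly C}} := \poly_(k < size f) map_poly iC (r k).
have pE : map_poly (evaluation c X) p = l (map_poly i q).[x] *: map_poly l f.
  apply/polyP => k; rewrite coefZ !coef_map coef_poly; case: ltnP => kf.
    by transitivity (l (map_poly i (r k)).[x]); [exact: lE | rewrite -rE rmorphM mulrC].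
  transitivity (0 : Om); first exact: (rmorph0 (evaluation c X)).
  rewrite [X in _ * X](_ : _ = 0) ?mulr0 //.
  by transitivity (l 0); [congr (l _); apply: nth_default | apply: rmorph0].
have q1 : l (map_poly i q).[x] != 0 by rewrite fmorph_eq0 nz.
exists p; rewrite pE ?rootZ // scaler_eq0 negb_or q1 map_poly_eq0 //.
Qed.

(** The embedding s extends to an embedding t of Om over F that preserves values.
    Then t o g is an embedding of the henselization, as g is; so they are equal
    and t fixes the image of H. *)
Lemma constant_fixed (s : {rmorphism C -> C}) z z' : fixes iC s ->
  (forall p, om (evaluation (c \o s) X p) = om (evaluation c X p)) ->
  g z = c z' -> s z' = z'.
Proof.
move=> si sval gz; pose phi (a : vgroup om) : vgroup om := a.
have phiD : {morph phi : a b / a + b} by [].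
have phi_le : {mono phi : a b / a <= b} by [].
have omap_phi a : omap phi a = a by case: a.
have [p|t [tE tval]] := @extend_embedding Om Om om om phi phiD phi_le {poly C}
    (evaluation c X) (evaluation (c \o s) X) _ algebraic_over_polynomials.
  by rewrite omap_phi sval.
have tc a : t (c a) = c (s a) by rewrite -(evaluationC c X) tE evaluationC.
have tX : t X = X by rewrite -{1}(evaluationX c X) tE evaluationX.
have tl y : t (l y) = l y.
  move: (genx y); move: y; apply: (generated_ind (Q := fun y => t (l y) = l y)) => [a|_ ->|a b ta tb|a b ta tb] //.
  - by rewrite -c_i tc si.
  - by rewrite !rmorphB ta tb.
  by rewrite !fmorph_div ta tb.
have [_ _ univ] := henH.
have [g0 _ g0u] := univ Om l om l_om (@closed_henselian Om om).
have gE : g =1 g0 by apply: g0u; split.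
have tgE : t \o g =1 g0.
  apply: g0u; split=> [y|y]; first by rewrite /= [g (h y)]g_h tl.
  by rewrite (g_om y) /in_vring /= tval omap_phi.
by apply: (fmorph_inj c); rewrite -tc -gz [t (g z)]tgE -gE.
Qed.

Lemma algebraic_constant z : algebraicOver (h \o i) z -> exists z', g z = c z'.
Proof.
move=> [p p0 pz]; have pgz : root (map_poly c (map_poly iC p)) (g z).
  have -> : map_poly c (map_poly iC p) = map_poly g (map_poly (h \o i) p).
    by rewrite -!map_poly_comp; apply: eq_map_poly => a; rewrite /= c_i -g_h.
  by rewrite /root horner_map (eqP pz) rmorph0.
by apply: root_over_closed pgz; rewrite map_poly_eq0.
Qed.

Lemma constants_separable : separable_algebraic (h \o i) (implicit_constant_field i h).
Proof.
move=> z /algebraic_constant[z' gz]; have [f [firr fsep fz]] := tame_separable tameK z'.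
exists f; split=> //; rewrite -(fmorph_root g) gz -map_poly_comp.
have -> : map_poly (g \o (h \o i)) f = map_poly c (map_poly iC f).
  by rewrite -map_poly_comp; apply: eq_map_poly => a; rewrite /= c_i -g_h.
by rewrite fmorph_root.
Qed.

Lemma constants_countably_generated :
  countably_generated (h \o i) (implicit_constant_field i h).
Proof.
have [algC _ _] := tameK.
have [a dich] := approximating_sequence tameK X wC_om.
pose gen := generated iC (fun z => exists n, z = a n).
have genC z : implicit_constant_field i h z -> exists2 z', g z = c z' & gen z'.
  move=> /algebraic_constant[z' gz]; exists z' => //; apply: contrapT => nz.
  pose S := Subfield (generated_divring iC (fun z => exists n, z = a n)).
  have iS d : iC d \in sf_pred S by apply/asboolP; apply: generated_base.
  have [mu muE] := sf_factor iS.
  have mmu : @sf_inj _ S \o mu =1 iC by exact: muE.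
  have [|s [sz ms]] := separable_moved (algebraic_over_intermediate tameK mmu)
      (separable_tower mmu (tame_separable tameK z')).
    by move=> [b zb]; apply: nz; rewrite zb; have /asboolP := sf_inj_in b.
  have si : fixes iC s by move=> d; rewrite -muE; apply: ms.
  apply: sz; apply: (constant_fixed si) gz => p; apply: (closeness_poly tameK wC_om) => //.
  apply: (approximating_closeness tameK wC_om dich si) => y yS.
  by have [t <-] := @sf_injP _ S y (asboolT yS); apply: ms.
pose A := implicit_constant_field i h.
have [|y z Ay Az|d y Ay|y Ay|s [sA sspan]] :=
    @countable_subspace K H Om (h \o i) g (fun n => c (monomial a n)) A.
- exact: algebraic0.
- exact: algebraic_sub.
- by apply: algebraic_mul => //; apply: algebraic_id.
- have [z' gz genz] := genC y Ay; have [n [d zE]] := generated_span algC genz.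
  exists n, d; rewrite gz zE rmorph_sum; apply: eq_bigr => k _.
  by rewrite rmorphM c_i [g _]g_h.
exists s => y; split=> [/sspan[n [d ->]] P [P1 PB PD] iP sP|].
  have P0 : 0 \in P by rewrite -(subrr 1); apply: PB.
  have PM p q : p \in P -> q \in P -> p * q \in P.
    move=> Pp Pq; rewrite -[q]invrK; apply: (PD) => //.
    by rewrite -[q^-1]mul1r; apply: PD.
  have PA p q : p \in P -> q \in P -> p + q \in P.
    by move=> Pp Pq; rewrite -[q]opprK; apply: (PB) => //; rewrite -sub0r; apply: PB.
  apply: (big_ind (fun z => z \in P)) => // k _; apply: PM; first exact: iP.
  by apply: sP; exists k.
apply: (generated_ind (Q := A)) => [d|_ [n ->]|p q|p q]; first exact: algebraic_id.
- exact: sA.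
- exact: algebraic_sub.
exact: algebraic_div.
Qed.

End Main.

Theorem corollary2 (K : fieldType) (v : valuation K)
    (F : fieldType) (w : valuation F) (i : {rmorphism K -> F}) (x : F)
    (H : fieldType) (u : valuation H) (h : {rmorphism F -> H}) :
  tame_field v ->
  extends i v w ->
  ~ algebraicOver i x ->
  (forall y : F, generated i (fun z => z = x) y) ->
  henselization h w u ->
  separable_algebraic (h \o i) (implicit_constant_field i h) /\
  countably_generated (h \o i) (implicit_constant_field i h).
Proof.
move=> [_ [C [iC [wC [algC vC tameK]]]]] vw trx genx henH.
have [Om1 [d [xi xi_tr]]] := closed_transcendental C.
have [|Om [l algl]] := @rational_function_closure K F Om1 i x (d \o iC) xi trx genx.
  move=> [p p0]; apply/negP; rewrite map_poly_comp; apply: xi_tr.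
  by rewrite map_poly_eq0.
have [om l_om] := valuation_extends l w.
have [a|y|c cE] := @extend_to_algebraic C Om K iC (l \o i).
- by rewrite !fmorph_eq0.
- by have [p p0 py] := algC y; exists p; rewrite ?map_poly_eq0.
have c_i a : c (iC a) = l (i a) by exact: cE.
have wC_om : equivalent wC (restrict c om).
  have [_ unib _] := tameK; apply: unib => a.
  by rewrite -[LHS]vC vw -[LHS]/(in_vring w (i a)) l_om /in_vring /= c_i.
have [_ _ univ] := henH.
have [g [g_h g_om] _] := univ Om l om l_om (@closed_henselian Om om).
split.
  exact: (constants_separable tameK c_i g_h).
exact: (constants_countably_generated trx genx henH tameK algl l_om c_i wC_om g_h g_om).
Qed.
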